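(* Let $\mathbb K\in\{\mathbb R,\mathbb C,\mathbb H\}$, $\kappa=\dim_{\mathbb R}\mathbb K$, $n\ge2$, and $\lambda_1,\dots,\lambda_{n-1}\in\mathbb C$. Consider the map $\mathcal Z_n(\mathbb K)\to\mathcal Z_{n-1}(\mathbb K)$, $Z^{\{n\}}\mapsto Z^{\{n-1\}}$, forgetting the last column of a matrix $Z^{\{n\}}$, and the (complex-valued if the $\lambda_p$ are not real) measure $$\prod_{p=1}^{n-1}s_{pn}(Z^{\{n\}})^{-\lambda_p}\,dZ^{\{n\}}$$ on $\mathcal Z_n(\mathbb K)$. Assume that $$\operatorname{Re}(\lambda_p+\lambda_{p+1}+\dots+\lambda_{n-1})>\frac12(n-p)\kappa\qquad\text{for all } 1\le p\le n-1.$$ Then the pushforward of this measure under the forgetting map is $$\pi^{\frac{(n-1)\kappa}{2}}\prod_{p=1}^{n-1}\frac{\Gamma\bigl(\lambda_p+\dots+\lambda_{n-1}-(n-p)\kappa/2\bigr)}{\Gamma\bigl(\lambda_p+\dots+\lambda_{n-1}-(n-p-1)\kappa/2\bigr)}\cdot\prod_{p=1}^{n-2}s_{p(n-1)}(Z^{\{n-1\}})^{-\lambda_p}\,dZ^{\{n-1\}}.$$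
   Context: $\mathbb H$ denotes the quaternions, and $dz$ denotes Lebesgue measure on $\mathbb K\cong\mathbb R^\kappa$ (standard real coordinates). $\mathcal Z_n(\mathbb K)$ is the space of $n\times n$ matrices $Z=\{z_{km}\}$ over $\mathbb K$ with $z_{km}=0$ for $k>m$, $z_{kk}=1$, and arbitrary entries $z_{km}\in\mathbb K$ for $k<m$. The measure $dZ=dZ^{\{n\}}=\prod_{1\le k<m\le n}dz_{km}$ is Lebesgue measure on $\mathcal Z_n(\mathbb K)$ (for $n=1$ the space is a single point with unit mass); the superscript $\{n\}$ only emphasizes the size of the matrix. Forgetting the last column of $Z^{\{n\}}\in\mathcal Z_n(\mathbb K)$ (together with the last row, whose other entries are $0$) gives its upper left $(n-1)\times(n-1)$ block, an element $Z^{\{n-1\}}\in\mathcal Z_{n-1}(\mathbb K)$. For $Z\in\mathcal Z_n(\mathbb K)$, $[Z]_{pq}$ denotes the upper left corner of $Z$ with $p$ rows and $q$ columns, and $s_{pq}(Z):=\det([Z]_{pq}[Z]_{pq}^* )$, where $*$ is the conjugate transpose. These numbers are positive for $p<q$, and $s^{-\lambda}=e^{-\lambda\ln s}$ for $s>0$. For $\mathbb K=\mathbb H$ the determinant of an $m\times m$ quaternionic matrix $A$ is $\det(A):=\sqrt[4]{\det(A_{\mathbb R})}$, where $A_{\mathbb R}$ is the real linear operator on $\mathbb R^{4m}=\mathbb H^m$ determined by $A$ (one has $\det(A_{\mathbb R})\ge0$). That $\nu$ is the pushforward of $\mu$ means: $\int\Psi(Z^{\{n-1\}})\,d\mu(Z^{\{n\}})=\int\Psi\,d\nu$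 for every bounded measurable compactly supported function $\Psi$ on $\mathcal Z_{n-1}(\mathbb K)$, viewed on the left as a function on $\mathcal Z_n(\mathbb K)$ not depending on the last column. *)

(* Defs.v *)
From HB Require Import structures.
From mathcomp Require Import all_boot all_order all_algebra.
From mathcomp Require Import ring.
From mathcomp Require Import all_classical all_reals all_analysis.
From mathcomp.real_closed Require Import complex.

Set Implicit Arguments.
Unset Strict Implicit.
Unset Printing Implicit Defensive.

Import Order.TTheory GRing.Theory Num.Theory.
Import numFieldNormedType.Exports.

Local Open Scope classical_set_scope.
Local Open Scope ring_scope.
Local Open Scope complex_scope.

(** Quaternions: [Quat a b c d] is a + b i + c j + d k. *)

Record quat (R : Type) : Type :=
  Quat { q_re : R; q_i : R; q_j : R; q_k : R }.

Section QuatRing.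
Variable R : comNzRingType.
Implicit Types x y z : quat R.

Definition quat_to_prod x := (q_re x, q_i x, q_j x, q_k x).
Definition quat_of_prod (t : R * R * R * R) :=
  let: (a, b, c, d) := t in Quat a b c d.

Lemma quat_to_prodK : cancel quat_to_prod quat_of_prod.
Proof. by case. Qed.

HB.instance Definition _ := Equality.copy (quat R) (can_type quat_to_prodK).
HB.instance Definition _ := Choice.copy (quat R) (can_type quat_to_prodK).

Definition quat_zero : quat R := Quat 0 0 0 0.
Definition quat_one : quat R := Quat 1 0 0 0.
Definition quat_add x y :=
  Quat (q_re x + q_re y) (q_i x + q_i y) (q_j x + q_j y) (q_k x + q_k y).
Definition quat_opp x := Quat (- q_re x) (- q_i x) (- q_j x) (- q_k x).
Definition quat_mul x y :=
  let: Quat a b c d := x in let: Quat a' b' c' d' := y in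
  Quat (a * a' - b * b' - c * c' - d * d')
       (a * b' + b * a' + c * d' - d * c')
       (a * c' - b * d' + c * a' + d * b')
       (a * d' + b * c' - c * b' + d * a').
Definition quat_conj x := Quat (q_re x) (- q_i x) (- q_j x) (- q_k x).

Fact quat_addA : associative quat_add.
Proof. by move=> [????] [????] [????]; congr Quat => /=; ring. Qed.
Fact quat_addC : commutative quat_add.
Proof. by move=> [????] [????]; congr Quat => /=; ring. Qed.
Fact quat_add0 : left_id quat_zero quat_add.
Proof. by move=> [????]; congr Quat => /=; ring. Qed.
Fact quat_addN : left_inverse quat_zero quat_opp quat_add.
Proof. by move=> [????]; congr Quat => /=; ring. Qed.
Fact quat_mulA : associative quat_mul.
Proof. by move=> [????] [????] [????]; congr Quat => /=; ring. Qed.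
Fact quat_mul1q : left_id quat_one quat_mul.
Proof. by move=> [????]; congr Quat => /=; ring. Qed.
Fact quat_mulq1 : right_id quat_one quat_mul.
Proof. by move=> [????]; congr Quat => /=; ring. Qed.
Fact quat_mulDl : left_distributive quat_mul quat_add.
Proof. by move=> [????] [????] [????]; congr Quat => /=; ring. Qed.
Fact quat_mulDr : right_distributive quat_mul quat_add.
Proof. by move=> [????] [????] [????]; congr Quat => /=; ring. Qed.
Fact quat_one_neq0 : quat_one != quat_zero.
Proof. by apply/eqP => -[] /eqP; rewrite oner_eq0. Qed.

HB.instance Definition _ := GRing.isZmodule.Build (quat R)
  quat_addA quat_addC quat_add0 quat_addN.
HB.instance Definition _ := GRing.Zmodule_isNzRing.Build (quat R)
  quat_mulA quat_mul1q quat_mulq1 quat_mulDl quat_mulDr quat_one_neq0.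
End QuatRing.

Inductive division_algebra : Set := realK | complexK | quaternionK.

Definition kappa (K : division_algebra) : nat :=
  match K with realK => 1 | complexK => 2 | quaternionK => 4 end.

Section Scalars.
Variable R : realType.

Definition scalar (K : division_algebra) : nzRingType :=
  match K with
  | realK => R : nzRingType
  | complexK => R[i] : nzRingType
  | quaternionK => quat R : nzRingType
  end.

Definition sconj (K : division_algebra) : scalar K -> scalar K :=
  match K return scalar K -> scalar K with
  | realK => id
  | complexK => @conjc R
  | quaternionK => @quat_conj R
  end.

Definition to_reals (K : division_algebra) : scalar K -> seq R :=
  match K return scalar K -> seq R with
  | realK => fun x : R => [:: x]
  | complexK => fun z : R[i] => [:: complex.Re z; complex.Im z]
  | quaternionK => fun q : quat R => [:: q_re q; q_i q; q_j q; q_k q]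
  end.

Definition of_reals (K : division_algebra) : seq R -> scalar K :=
  match K return seq R -> scalar K with
  | realK => fun s => s`_0
  | complexK => fun s => s`_0 +i* s`_1
  | quaternionK => fun s => Quat s`_0 s`_1 s`_2 s`_3
  end.

Lemma size_to_reals K (x : scalar K) : size (to_reals x) = kappa K.
Proof. by case: K x. Qed.

Lemma to_realsK K : cancel (@to_reals K) (@of_reals K).
Proof. by case: K => //; case. Qed.

Lemma of_realsK K s : size s = kappa K -> to_reals (of_reals K s) = s.
Proof.
by case: K => /=; [case: s => [|?[]]|case: s => [|?[|?[]]]
  |case: s => [|?[|?[|?[|?[]]]]]].
Qed.

Definition ctrmx K m n (A : 'M[scalar K]_(m, n)) : 'M[scalar K]_(n, m) :=
  \matrix_(i, j) sconj (A j i).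

(** Matrix of the real operator v |-> A v on H^m = R^(4m); an element of R^(4m)
    is written as an m x 4 real matrix, row i holding the coordinates of v_i.
    [lin_mx] makes operators act on row vectors on the right, so this is the
    transpose of the usual matrix, which has the same determinant. *)
Definition real_operator m (A : 'M[quat R]_m) : 'M[R]_(m * 4) :=
  lin_mx (fun v : 'M[R]_(m, 4) => \matrix_(i, c)
    (@to_reals quaternionK
      ((A *m \col_k (of_reals quaternionK [seq v k d | d : 'I_4] : quat R)) i 0))`_c).

(** Only used for A = B B^*, so that the complex determinant is real and [Re] is
    just a change of type. *)
Definition rdet (K : division_algebra) (m : nat) : 'M[scalar K]_m -> R :=
  match K return 'M[scalar K]_m -> R with
  | realK => fun A : 'M[R]_m => \det A
  | complexK => fun A : 'M[R[i]]_m => complex.Re (\det A)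
  | quaternionK => fun A : 'M[quat R]_m => (\det (real_operator A)) `^ 4^-1
  end.

End Scalars.

Arguments to_reals {R K}.
Arguments of_reals {R}.

Section Unitriangular.
Variable R : realType.
Variable K : division_algebra.

Definition is_unitri n (Z : 'M[scalar R K]_n) : bool :=
  [forall k : 'I_n, forall m : 'I_n, ((m < k)%N ==> (Z k m == 0)) && ((k == m) ==> (Z k m == 1))].

Record unitri n := Unitri { umx :> 'M[scalar R K]_n; _ : is_unitri umx }.

HB.instance Definition _ n := [isSub for @umx n].
HB.instance Definition _ n := [Choice of unitri n by <:].

Fact unitri1_subproof n : is_unitri (1%:M : 'M[scalar R K]_n).
Proof.
apply/forallP => k; apply/forallP => m; rewrite mxE -val_eqE /=.
by case: ltngtP => //= _; rewrite !eqxx.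
Qed.

HB.instance Definition _ n := isPointed.Build (unitri n)
  (Unitri (unitri1_subproof n)).

(** The real coordinates on Z_n(K) are the triples (k, m, c) with k < m:
    coordinate c of the entry z_km. *)
Definition coords n : seq ('I_n * 'I_n * 'I_(kappa K)) :=
  [seq x <- enum {: 'I_n * 'I_n * 'I_(kappa K)} | (val x.1.1 < val x.1.2)%N].

Definition coord n (Z : unitri n) (x : 'I_n * 'I_n * 'I_(kappa K)) : R :=
  (to_reals (Z x.1.1 x.1.2))`_x.2.

Definition to_tuple n (Z : unitri n) : (size (coords n)).-tuple R :=
  map_tuple (coord Z) (in_tuple (coords n)).

Definition to_row n (Z : unitri n) : 'rV[R]_(size (coords n)) :=
  \row_l tnth (to_tuple Z) l.

Definition of_tuple_mx n (t : (size (coords n)).-tuple R) : 'M[scalar R K]_n :=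
  \matrix_(k, m) if (k < m)%N
    then of_reals K [seq t`_(index (k, m, c) (coords n)) | c : 'I_(kappa K)]
    else (k == m)%:R.

Fact of_tuple_subproof n (t : (size (coords n)).-tuple R) :
  is_unitri (of_tuple_mx t).
Proof.
apply/forallP => k; apply/forallP => m; rewrite mxE -val_eqE /=.
by case: ltngtP => //= _; rewrite !eqxx.
Qed.

Definition of_tuple n (t : (size (coords n)).-tuple R) : unitri n :=
  Unitri (of_tuple_subproof t).

Lemma mem_coords n x : (x \in coords n) = (x.1.1 < x.1.2)%N.
Proof. by rewrite mem_filter mem_enum andbT. Qed.

Lemma of_tupleK n : cancel (@of_tuple n) (@to_tuple n).
Proof.
move=> t; apply: eq_from_tnth => l.
rewrite tnth_map (tnth_nth 0); set x := tnth (in_tuple (coords n)) l.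
have lx : (x.1.1 < x.1.2)%N by rewrite -mem_coords mem_tnth.
rewrite /coord /= mxE lx of_realsK; last by rewrite size_image card_ord.
rewrite (nth_map x.2) ?size_enum_ord // nth_ord_enum -!surjective_pairing.
by rewrite /x (tnth_nth x) index_uniq // filter_uniq // enum_uniq.
Qed.

Lemma to_tupleK n : cancel (@to_tuple n) (@of_tuple n).
Proof.
move=> Z; apply: val_inj; apply/matrixP => k m; rewrite mxE.
have /forallP/(_ k)/forallP/(_ m)/andP[Z0 Z1] := valP Z.
rewrite -val_eqE /=; case: ltngtP => km; last 2 first.
- by rewrite km /= in Z0; rewrite (eqP Z0).
- by rewrite -val_eqE /= km eqxx in Z1; rewrite (eqP Z1).
rewrite -[RHS]to_realsK; congr of_reals.
apply: (@eq_from_nth _ 0) => [|c]; first by rewrite size_image card_ord size_to_reals.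
rewrite size_image card_ord => cK.
have -> : c = Ordinal cK by [].
rewrite (nth_map (Ordinal cK)) ?size_enum_ord // nth_ord_enum.
by rewrite (nth_map (k, m, Ordinal cK)) ?index_mem ?mem_coords // nth_index ?mem_coords.
Qed.

Definition forget_mx n (Z : unitri n) : 'M[scalar R K]_n.-1 :=
  \matrix_(k, m) Z (widen_ord (leq_pred n) k) (widen_ord (leq_pred n) m).

Fact forget_subproof n (Z : unitri n) : is_unitri (forget_mx Z).
Proof.
apply/forallP => k; apply/forallP => m; rewrite mxE.
by have /forallP/(_ (widen_ord (leq_pred n) k))
  /forallP/(_ (widen_ord (leq_pred n) m)) := valP Z.
Qed.

Definition forget n (Z : unitri n) : unitri n.-1 := Unitri (forget_subproof Z).

(** Only meaningful for p, q <= n: entries outside Z are padded with 0. *)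
Definition corner n (Z : unitri n) (p q : nat) : 'M[scalar R K]_(p, q) :=
  \matrix_(i, j) if insub (val i) is Some k then
                   if insub (val j) is Some m then Z k m else 0
                 else 0.

Definition s_ n (Z : unitri n) (p q : nat) : R :=
  rdet (corner Z p q *m ctrmx (corner Z p q)).

(** The topology and the Borel sigma-algebra of Z_n(K) are transported from its
    real coordinate space, represented by row vectors for the former and by tuples
    for the latter. *)
HB.instance Definition _ n :=
  Topological.copy (unitri n) (initial_topology (@to_row n)).

HB.instance Definition _ n :=
  Measurable.copy (unitri n) (g_sigma_algebra_preimageType (@to_tuple n)).

Lemma measurable_of_tuple n : measurable_fun setT (@of_tuple n).
Proof.
move=> _ A [B mB <-]; rewrite setTI setTI.
by rewrite [X in measurable X](_ : _ = B) //; apply/seteqP; split => t /=;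
  rewrite of_tupleK.
Qed.

End Unitriangular.

Definition pushforward_measure d1 d2 (T1 : measurableType d1)
    (T2 : measurableType d2) (R : realType) (m : {measure set T1 -> \bar R})
    (f : T1 -> T2) (mf : measurable_fun setT f) : {measure set T2 -> \bar R} :=
  measure_function_pushforward__canonical__measure_function_Measure m mf.

Section LebesgueTuple.
Variable R : realType.

Definition cons_pair N (p : N.-tuple R * R) : N.+1.-tuple R :=
  [tuple of p.2 :: p.1].

Lemma measurable_cons_pair N : measurable_fun setT (@cons_pair N).
Proof. by apply: measurable_cons; [exact: measurable_snd|exact: measurable_fst]. Qed.

Fixpoint lebesgue_tuple (N : nat) : {measure set (N.-tuple R) -> \bar R} :=
  match N with
  | 0 => \d_ ([tuple] : 0.-tuple R)
  | N.+1 => pushforward_measure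
      (lebesgue_tuple N \x (@lebesgue_measure R))%E (@measurable_cons_pair N)
  end.

End LebesgueTuple.

Definition dZ (R : realType) (K : division_algebra) (n : nat) :
    {measure set (unitri R K n) -> \bar R} :=
  pushforward_measure (lebesgue_tuple R (size (coords K n)))
    (@measurable_of_tuple R K n).

Arguments dZ : clear implicits.

Section ComplexFunctions.
Variable R : realType.

Definition cexp (z : R[i]) : R[i] :=
  (expR (complex.Re z))%:C * (cos (complex.Im z) +i* sin (complex.Im z)).

(** Only meaningful for x > 0. *)
Definition cpow (x : R) (z : R[i]) : R[i] := cexp (z * (ln x)%:C).

Section Integral.
Context d (T : measurableType d).
Variable mu : {measure set T -> \bar R}.

Definition cmeasurable (f : T -> R[i]) : Prop :=
  measurable_fun setT (fun x => complex.Re (f x)) /\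
  measurable_fun setT (fun x => complex.Im (f x)).

Definition cintegrable (D : set T) (f : T -> R[i]) : Prop :=
  mu.-integrable D (fun x => (complex.Re (f x))%:E) /\
  mu.-integrable D (fun x => (complex.Im (f x))%:E).

Definition cintegral (D : set T) (f : T -> R[i]) : R[i] :=
  (\int[mu]_(x in D) complex.Re (f x)) +i* (\int[mu]_(x in D) complex.Im (f x)).
End Integral.

(** Euler's integral; it is the Gamma function on the half-plane 0 < Re z. *)
Definition Gamma (z : R[i]) : R[i] :=
  cintegral (@lebesgue_measure R) `]0, +oo[
    (fun t => cpow t (z - 1) * (expR (- t))%:C).

End ComplexFunctions.

Definition cbounded (R : realType) (T : Type) (f : T -> R[i]) : Prop :=
  exists M : R, forall x, Normc.normc (f x) <= M.

Definition compactly_supported (R : realType) (T : topologicalType)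
    (f : T -> R[i]) : Prop :=
  exists2 A : set T, compact A & forall x, ~ A x -> f x = 0.

(** The complex measure sigma dZ^(n-1) is the pushforward of rho dZ^(n). Both
    integrals are required to converge absolutely, as [cintegral] is also defined
    on functions that are not integrable. *)
Definition is_pushforward (R : realType) (K : division_algebra) (n : nat)
    (rho : unitri R K n -> R[i]) (sigma : unitri R K n.-1 -> R[i]) : Prop :=
  forall Psi : unitri R K n.-1 -> R[i],
    cmeasurable Psi -> cbounded Psi -> compactly_supported Psi ->
    [/\ cintegrable (dZ R K n) setT (fun Z => Psi (forget Z) * rho Z),
        cintegrable (dZ R K n.-1) setT (fun Z => Psi Z * sigma Z) &
        cintegral (dZ R K n) setT (fun Z => Psi (forget Z) * rho Z) =
        cintegral (dZ R K n.-1) setT (fun Z => Psi Z * sigma Z)].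

(* Main.v *)
Require Import Defs.
From mathcomp Require Import all_boot all_order all_algebra.
From HB Require Import structures.
From mathcomp Require Import fingroup perm.
From mathcomp Require Import ring lra.
From mathcomp Require Import all_classical all_reals all_analysis.
From mathcomp Require Import measurable_realfun.
From mathcomp.real_closed Require Import complex.

Import Order.TTheory GRing.Theory Num.Theory.
Import numFieldNormedType.Exports.

Set Implicit Arguments.
Unset Strict Implicit.
Unset Printing Implicit Defensive.

Local Open Scope classical_set_scope.
Local Open Scope ring_scope.
Local Open Scope complex_scope.

(** Write N = n - 1, fix Z' in Z_N(K) and let z run over K^N, the last columns of
    the matrices Z above Z'.  The theorem says that the integral over z of the
    product of the s_pn(Z)^(-lambda_p) is a constant times the product of the
    s_pN(Z')^(-lambda_p).  The constant comes out independent of Z' for the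
    following reason.

    Orthonormalize the rows of Z' in order: there is a lower triangular T, with
    positive diagonal tau, such that the rows of T Z' are orthonormal
    ([gram_schmidt]).  Put u = T z.  The first p rows of T Z are orthonormal
    vectors extended by the entries of u, so their Gram matrix is 1 + w w^* with
    w the column of the first p entries of u, and
      s_pN(Z') = (tau_1 ... tau_p)^(-2),
      s_pn(Z)  = s_pN(Z') (1 + |u_1|^2 + ... + |u_p|^2)
    ([corner_gram]).  The second identity rests on det (1 + U V) = det (1 + V U),
    applied over the quaternions to the real operators ([rdet_gram]).
    Since s_NN(Z') = 1, the product of all tau_i is 1.

    Now u_i is tau_i z_i plus a combination of z_1, ..., z_(i-1).  In the real
    coordinates v_j of z the integrand is therefore a product of powers of
    the partial sums of 1 + sum_j (tau_j v_j + gamma_j(v_1, ..., v_(j-1)))^2, and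
    the coordinates can be integrated out one at a time, the last one first
    ([qprod_integral]), by
      int (S + (tau x + gamma)^2)^(-mu) dx = tau^(-1) B(mu) S^(1/2 - mu),
      B(mu) = sqrt pi Gamma(mu - 1/2) / Gamma(mu)
    ([cintegral_quad]).  Each step moves a power of S to the next
    coordinate with its exponent lowered by 1/2; the kappa factors B coming from
    the coordinates of one entry telescope ([prod_beta]), and the factors
    tau^(-1) multiply to 1.  The same computation with absolute values gives
    absolute convergence; the condition Re mu > 1/2 for all coordinates is exactly
    the hypothesis on the lambda_p.

    Fubini's theorem concludes, because dZ on Z_n(K) is the product of dZ on Z_N(K)
    and of Lebesgue measure on the last column ([dZ_join_column]).  On the base,
    integrability against a bounded function of compact support follows from
    1 <= s_pN <= C on compact sets ([base_integrable]).

    The formula for B is Euler's: Gamma(mu) (1 + v^2)^(-mu) is the integral of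
    s^(mu - 1) exp (- s (1 + v^2)) over s > 0, and the integral over v is then
    Gaussian ([mellin], [beta_Gamma]).  Dividing by Gamma(mu) requires that Gamma
    has no zero in the right half-plane ([Gamma_neq0]). *)

(** * Integrals of complex functions *)
Arguments cpow : simpl never.
Arguments cexp : simpl never.

Section ComplexBasics.
Variable R : realType.
Implicit Types x y z : R[i].

Lemma Re_addc x y : complex.Re (x + y) = complex.Re x + complex.Re y.
Proof. by case: x y => ? ? []. Qed.
Lemma Im_addc x y : complex.Im (x + y) = complex.Im x + complex.Im y.
Proof. by case: x y => ? ? []. Qed.
Lemma Re_oppc x : complex.Re (- x) = - complex.Re x. Proof. by case: x. Qed.
Lemma Im_oppc x : complex.Im (- x) = - complex.Im x. Proof. by case: x. Qed.
Lemma Re_mulc x y : complex.Re (x * y) =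
  complex.Re x * complex.Re y - complex.Im x * complex.Im y.
Proof. by case: x y => ? ? []. Qed.
Lemma Im_mulc x y : complex.Im (x * y) =
  complex.Re x * complex.Im y + complex.Im x * complex.Re y.
Proof. by case: x y => ? ? []. Qed.
Lemma Re_realM (a : R) x : complex.Re (a%:C * x) = a * complex.Re x.
Proof. by rewrite Re_mulc /= mul0r subr0. Qed.
Lemma Im_realM (a : R) x : complex.Im (a%:C * x) = a * complex.Im x.
Proof. by rewrite Im_mulc /= mul0r addr0. Qed.

Lemma complex_ext x y : complex.Re x = complex.Re y ->
  complex.Im x = complex.Im y -> x = y.
Proof. by case: x y => ? ? [? ?] /= -> ->. Qed.

Lemma normc_ge0 x : 0 <= Normc.normc x.
Proof. by case: x => a b; rewrite /= sqrtr_ge0. Qed.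

Lemma normc_real (a : R) : Normc.normc a%:C = `|a|.
Proof. by rewrite /= expr0n addr0 sqrtr_sqr. Qed.

Lemma Re_le_normc x : `|complex.Re x| <= Normc.normc x.
Proof. by case: x => a b /=; rewrite -sqrtr_sqr ler_wsqrtr// lerDl sqr_ge0. Qed.
Lemma Im_le_normc x : `|complex.Im x| <= Normc.normc x.
Proof. by case: x => a b /=; rewrite -sqrtr_sqr ler_wsqrtr// lerDr sqr_ge0. Qed.

Lemma normc_le_ReIm x : Normc.normc x <= `|complex.Re x| + `|complex.Im x|.
Proof.
rewrite [x in Normc.normc x](_ : _ = (complex.Re x)%:C + (0 +i* complex.Im x)).
  rewrite (le_trans (le_normcD _ _))// normc_real lerD2l /= expr0n add0r.
  by rewrite sqrtr_sqr.
by apply: complex_ext; rewrite ?Re_addc ?Im_addc /= ?addr0 ?add0r.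
Qed.

Lemma cexpD x y : cexp (x + y) = cexp x * cexp y.
Proof.
rewrite /cexp Re_addc Im_addc expRD cosD sinD.
by apply: complex_ext; rewrite !(Re_mulc, Im_mulc) /=; ring.
Qed.

Lemma Re_cexp x : complex.Re (cexp x) = expR (complex.Re x) * cos (complex.Im x).
Proof. by rewrite /cexp Re_realM. Qed.
Lemma Im_cexp x : complex.Im (cexp x) = expR (complex.Re x) * sin (complex.Im x).
Proof. by rewrite /cexp Im_realM. Qed.

Lemma cexp0 : cexp 0 = 1 :> R[i].
Proof. by rewrite /cexp /= expR0 cos0 sin0 mul1r. Qed.

Lemma cexp_real (a : R) : cexp a%:C = (expR a)%:C.
Proof. by rewrite /cexp /= cos0 sin0 mulr1. Qed.

Lemma normc_cexp x : Normc.normc (cexp x) = expR (complex.Re x).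
Proof.
rewrite /cexp Normc.normcM normc_real ger0_norm ?expR_ge0//=.
by rewrite cos2Dsin2 sqrtr1 mulr1.
Qed.

Lemma cexp_neq0 x : cexp x != 0.
Proof.
apply/eqP => /(congr1 (@Normc.normc R)); rewrite normc_cexp Normc.normc0.
by apply/eqP; rewrite gt_eqF ?expR_gt0.
Qed.

Lemma cpowD (a : R) x y : cpow a (x + y) = cpow a x * cpow a y.
Proof. by rewrite /cpow mulrDl cexpD. Qed.
Lemma cpow0 (a : R) : cpow a 0 = 1.
Proof. by rewrite /cpow mul0r cexp0. Qed.
Lemma cpow1 x : cpow (1 : R) x = 1.
Proof. by rewrite /cpow ln1 mulr0 cexp0. Qed.
Lemma cpow_neq0 (a : R) x : cpow a x != 0. Proof. exact: cexp_neq0. Qed.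
Lemma cpowN (a : R) x : cpow a (- x) = (cpow a x)^-1.
Proof.
by apply: (mulIf (cpow_neq0 a x)); rewrite mulVf ?cpow_neq0// -cpowD addNr cpow0.
Qed.
Lemma cpowM (a b : R) x : 0 < a -> 0 < b -> cpow (a * b) x = cpow a x * cpow b x.
Proof. by move=> a0 b0; rewrite /cpow lnM// raddfD mulrDr cexpD. Qed.
Lemma cpow_real (a b : R) : 0 < a -> cpow a b%:C = (a `^ b)%:C.
Proof. by move=> a0; rewrite /cpow -rmorphM/= cexp_real /powR gt_eqF. Qed.
Lemma cpow_1r (a : R) : 0 < a -> cpow a 1 = a%:C.
Proof. by move=> a0; rewrite -[1]/(1%:C) cpow_real// powRr1// ltW. Qed.
Lemma normc_cpow (a : R) x : 0 < a -> Normc.normc (cpow a x) = a `^ complex.Re x.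
Proof.
move=> a0; rewrite /cpow normc_cexp Re_mulc /= mulr0 subr0 /powR gt_eqF//.
Qed.

End ComplexBasics.

Arguments Normc.normc : simpl never.

Section CMeasurable.
Context d (T : measurableType d) (R : realType).
Implicit Types f g : T -> R[i].

Lemma cmeasurable_cst (c : R[i]) : cmeasurable (fun _ : T => c).
Proof. by split; exact: measurable_cst. Qed.

Lemma cmeasurable_real (f : T -> R) : measurable_fun setT f ->
  cmeasurable (fun x => (f x)%:C).
Proof. by split => //=; exact: measurable_cst. Qed.

Lemma cmeasurableD f g : cmeasurable f -> cmeasurable g ->
  cmeasurable (fun x => f x + g x).
Proof.
move=> [f1 f2] [g1 g2]; split.
  by under eq_fun do rewrite Re_addc; exact: measurable_funD.
by under eq_fun do rewrite Im_addc; exact: measurable_funD.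
Qed.

Lemma cmeasurableM f g : cmeasurable f -> cmeasurable g ->
  cmeasurable (fun x => f x * g x).
Proof.
move=> [f1 f2] [g1 g2]; split.
  under eq_fun do rewrite Re_mulc.
  by apply: measurable_funB; exact: measurable_funM.
under eq_fun do rewrite Im_mulc.
by apply: measurable_funD; exact: measurable_funM.
Qed.

Lemma cmeasurable_prod I (s : seq I) (P : pred I) (f : I -> T -> R[i]) :
  (forall i, P i -> cmeasurable (f i)) ->
  cmeasurable (fun x => \prod_(i <- s | P i) f i x).
Proof.
move=> mf; elim: s => [|i s IH].
  by under eq_fun do rewrite big_nil; exact: cmeasurable_cst.
under eq_fun do rewrite big_cons.
by case E: (P i) => //; apply: cmeasurableM => //; exact: mf.
Qed.

Lemma cmeasurable_cexp f : cmeasurable f -> cmeasurable (fun x => cexp (f x)).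
Proof.
move=> [f1 f2].
have mcos := continuous_measurable_fun (@continuous_cos R).
have msin := continuous_measurable_fun (@continuous_sin R).
split.
  under eq_fun do rewrite Re_cexp.
  apply: measurable_funM; first exact: measurableT_comp f1.
  exact: measurableT_comp mcos f2.
under eq_fun do rewrite Im_cexp.
apply: measurable_funM; first exact: measurableT_comp f1.
exact: measurableT_comp msin f2.
Qed.

Lemma cmeasurable_cpow (f : T -> R) z : measurable_fun setT f ->
  cmeasurable (fun x => cpow (f x) z).
Proof.
move=> mf; apply: cmeasurable_cexp; apply: cmeasurableM.
  exact: cmeasurable_cst.
by apply: cmeasurable_real; apply: measurableT_comp => //; exact: measurable_ln.
Qed.

Lemma measurable_normc f : cmeasurable f ->
  measurable_fun setT (fun x => Normc.normc (f x)).
Proof.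
move=> [f1 f2].
rewrite (_ : (fun _ => _) = fun x =>
    Num.sqrt (complex.Re (f x) ^+ 2 + complex.Im (f x) ^+ 2)); last first.
  by apply/funext => x; case: (f x).
apply: (measurableT_comp (continuous_measurable_fun (@sqrt_continuous R))).
by apply: measurable_funD; exact: measurable_funX.
Qed.

Lemma cmeasurable_comp d' (T' : measurableType d') (phi : T' -> T) f :
  measurable_fun setT phi -> cmeasurable f -> cmeasurable (f \o phi).
Proof.
by move=> mphi [f1 f2]; split;
  [apply: (measurableT_comp f1)|apply: (measurableT_comp f2)].
Qed.

End CMeasurable.

Section CIntegral.
Context d (T : measurableType d) (R : realType).
Variable mu : {measure set T -> \bar R}.
Implicit Types f g : T -> R[i].

Lemma le_integrable1 (f g : T -> R) : measurable_fun setT f ->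
  (forall x, `|f x| <= g x) -> mu.-integrable setT (EFin \o g) ->
  mu.-integrable setT (EFin \o f).
Proof.
move=> mf fg; apply: le_integrable => //; first exact/measurable_EFinP.
by move=> x _ /=; rewrite lee_fin (le_trans (fg x))// ler_norm.
Qed.

(** The form in which integrability is established everywhere below: a complex
    function is dominated by a real one whose integral is known. *)
Lemma cintegrable_le f (g : T -> R) : cmeasurable f ->
  (forall x, Normc.normc (f x) <= g x) -> mu.-integrable setT (EFin \o g) ->
  cintegrable mu setT f.
Proof.
move=> [f1 f2] fg ig; split; apply: le_integrable1 ig => //= x.
  exact: le_trans (Re_le_normc _) _.
exact: le_trans (Im_le_normc _) _.
Qed.

Lemma cintegrable_measurable f : cintegrable mu setT f -> cmeasurable f.
Proof.
by move=> [/measurable_int/measurable_EFinP f1 /measurable_int/measurable_EFinP f2].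
Qed.

Lemma cintegrable_normc f : cintegrable mu setT f ->
  mu.-integrable setT (fun x => (Normc.normc (f x))%:E).
Proof.
move=> fi; have mf := cintegrable_measurable fi; case: fi => f1 f2.
apply: (le_integrable1 (g := fun x => `|complex.Re (f x)| + `|complex.Im (f x)|)).
- exact: measurable_normc.
- by move=> x; rewrite ger0_norm ?normc_ge0 ?normc_le_ReIm.
- rewrite (_ : EFin \o _ = ((fun x => `|(complex.Re (f x))%:E|) \+
    (fun x => `|(complex.Im (f x))%:E|))%E) //.
  by apply: integrableD => //; exact: integrable_abse.
Qed.

Lemma ge0_integrable (g : T -> R) (c : R) : measurable_fun setT g ->
  (forall x, 0 <= g x) -> (\int[mu]_x (g x)%:E = c%:E)%E ->
  mu.-integrable setT (EFin \o g).
Proof.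
move=> mg g0 gc; apply/integrableP; split; first exact/measurable_EFinP.
under eq_integral do rewrite /= ger0_norm//.
by rewrite gc ltry.
Qed.

Lemma cintegral_real (g : T -> R) (c : R) : (\int[mu]_x (g x)%:E = c%:E)%E ->
  cintegral mu setT (fun x => (g x)%:C) = c%:C.
Proof.
move=> gc; rewrite /cintegral; apply: complex_ext => /=.
  by rewrite /Rintegral gc.
by rewrite /Rintegral integral0.
Qed.

Lemma cintegrableZl c f : cintegrable mu setT f ->
  cintegrable mu setT (fun x => c * f x).
Proof.
move=> fi; have mf := cintegrable_measurable fi.
apply: (cintegrable_le (g := fun x => Normc.normc c * Normc.normc (f x))).
- by apply: cmeasurableM => //; exact: cmeasurable_cst.
- by move=> x; rewrite Normc.normcM.
- rewrite (_ : EFin \o _ =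
      fun x => ((Normc.normc c)%:E * (Normc.normc (f x))%:E)%E).
    exact: integrableZl (cintegrable_normc fi).
  by apply/funext => x; rewrite /= EFinM.
Qed.

Lemma cintegralZl c f : cintegrable mu setT f ->
  cintegral mu setT (fun x => c * f x) = c * cintegral mu setT f.
Proof.
move=> [f1 f2]; have Zi (a : R) (h : T -> R) : mu.-integrable setT (EFin \o h) ->
    mu.-integrable setT (EFin \o (fun x => a * h x)).
  move=> hi; rewrite (_ : EFin \o _ = fun x => (a%:E * (h x)%:E)%E).
    exact: integrableZl.
  by apply/funext => x; rewrite /= EFinM.
rewrite /cintegral; apply: complex_ext; rewrite ?Re_mulc ?Im_mulc /=.
  under eq_Rintegral do rewrite Re_mulc.
  by rewrite RintegralB ?RintegralZl//; exact: Zi.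
under eq_Rintegral do rewrite Im_mulc.
by rewrite RintegralD ?RintegralZl//; exact: Zi.
Qed.

Lemma eq_cintegral f g : f =1 g -> cintegral mu setT f = cintegral mu setT g.
Proof. by move=> /funext ->. Qed.

End CIntegral.

Lemma ge0_integral_pushforward_measure d1 d2 (T1 : measurableType d1)
    (T2 : measurableType d2) (R : realType) (m : {measure set T1 -> \bar R})
    (phi : T1 -> T2) (mphi : measurable_fun setT phi) (f : T2 -> R) :
  measurable_fun setT f -> (forall y, 0 <= f y) ->
  (\int[pushforward_measure m mphi]_y (f y)%:E = \int[m]_x (f (phi x))%:E)%E.
Proof.
move=> mf f0; rewrite (ge0_integral_pushforward mphi)//.
  exact/measurable_EFinP.
by move=> y _; rewrite lee_fin.
Qed.

Lemma cintegral_pushforward d1 d2 (T1 : measurableType d1)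
    (T2 : measurableType d2) (R : realType) (m : {measure set T1 -> \bar R})
    (phi : T1 -> T2) (mphi : measurable_fun setT phi) (f : T2 -> R[i]) :
  cmeasurable f -> cintegrable m setT (f \o phi) ->
  cintegrable (pushforward_measure m mphi) setT f /\
  cintegral (pushforward_measure m mphi) setT f = cintegral m setT (f \o phi).
Proof.
move=> [f1 f2] [i1 i2]; split.
  by split; apply: integrable_pushforward => //; exact/measurable_EFinP.
rewrite /cintegral /Rintegral; congr (fine _ +i* fine _).
  by rewrite integral_pushforward//; exact/measurable_EFinP.
by rewrite integral_pushforward//; exact/measurable_EFinP.
Qed.

Section CFubini.
Context d1 d2 (T1 : measurableType d1) (T2 : measurableType d2) (R : realType).
Variable m1 : {sigma_finite_measure set T1 -> \bar R}.
Variable m2 : {sigma_finite_measure set T2 -> \bar R}.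

Let fubini1r (f : T1 * T2 -> R) : (m1 \x m2)%E.-integrable setT (EFin \o f) ->
  (forall x, m2.-integrable setT (fun y => (f (x, y))%:E)) ->
  Rintegral (m1 \x m2)%E setT f =
  Rintegral m1 setT (fun x => Rintegral m2 setT (fun y => f (x, y))).
Proof.
move=> fi fi2; rewrite /Rintegral -integral12_prod_meas1//; congr fine.
apply: eq_integral => x _; rewrite /fubini_F fineK//.
exact: integrable_fin_num.
Qed.

(** Integrability of all sections (rather than almost all) makes the inner
    integrals meaningful everywhere. *)
Lemma cfubini1 (f : T1 * T2 -> R[i]) : cintegrable (m1 \x m2)%E setT f ->
  (forall x, cintegrable m2 setT (fun y => f (x, y))) ->
  cintegral (m1 \x m2)%E setT f =
  cintegral m1 setT (fun x => cintegral m2 setT (fun y => f (x, y))).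
Proof.
move=> [i1 i2] fi; rewrite [LHS]/cintegral.
by rewrite !fubini1r// => x; [case: (fi x)|case: (fi x)].
Qed.

Lemma cintegrable_prod (f : T1 * T2 -> R[i]) : cmeasurable f ->
  (\int[m1]_x \int[m2]_y (Normc.normc (f (x, y)))%:E < +oo)%E ->
  cintegrable (m1 \x m2)%E setT f.
Proof.
move=> mf fi; apply: (cintegrable_le mf (fun x => lexx _)).
apply/integrable12ltyP; first by apply/measurable_EFinP; exact: measurable_normc.
apply: le_lt_trans fi; rewrite le_eqVlt; apply/orP; left; apply/eqP.
apply: eq_integral => x _; apply: eq_integral => y _.
by rewrite /= ger0_norm ?normc_ge0.
Qed.

End CFubini.

Lemma cfubini_swap d1 d2 (T1 : measurableType d1) (T2 : measurableType d2)
    (R : realType) (m1 : {sigma_finite_measure set T1 -> \bar R})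
    (m2 : {sigma_finite_measure set T2 -> \bar R}) (f : T1 * T2 -> R[i]) :
  cintegrable (m1 \x m2)%E setT f ->
  (forall x, cintegrable m2 setT (fun y => f (x, y))) ->
  (forall y, cintegrable m1 setT (fun x => f (x, y))) ->
  cintegral m1 setT (fun x => cintegral m2 setT (fun y => f (x, y))) =
  cintegral m2 setT (fun y => cintegral m1 setT (fun x => f (x, y))).
Proof.
move=> fi fi2 fi1; rewrite -cfubini1//; case: fi => i1 i2.
rewrite /cintegral /Rintegral; congr (_ +i* _).
  rewrite -integral21_prod_meas1//; congr fine.
  apply: eq_integral => y _; rewrite fineK//.
  by case: (fi1 y) => h _; exact: integrable_fin_num h.
rewrite -integral21_prod_meas1//; congr fine.
apply: eq_integral => y _; rewrite fineK//.
by case: (fi1 y) => _ h; exact: integrable_fin_num h.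
Qed.

Section Affine.
Variable R : realType.
Local Notation leb := (@lebesgue_measure R).
Variables (a b : R).
Hypothesis a0 : 0 < a.

Let phi (x : R) : R := a * x + b.

Let mphi : measurable_fun setT (phi : measurableTypeR R -> measurableTypeR R).
Proof. by apply: measurable_funD => //; exact: measurable_funM. Qed.

Let phi_meas A : measurable A ->
  leb A = mscale (NngNum (ltW a0)) (pushforward_measure leb mphi) A.
Proof.
move=> mA; apply: lebesgue_measure_unique => //= _ [[x y]] _ <-.
(* It suffices to compare the two measures on intervals. *)
rewrite /mscale /= /pushforward.
rewrite (_ : phi @^-1` _ = `](x - b) / a, (y - b) / a]%classic); last first.
  apply/seteqP; split => z /=; rewrite !in_itv /= /phi ltr_pdivrMr//;
    rewrite ler_pdivlMr//; rewrite mulrC => /andP[h1 h2]; apply/andP; split; lra.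
rewrite !lebesgue_measure_itv/= !lte_fin ltr_pM2r ?invr_gt0// ltrD2r.
case: ifPn => _; last by rewrite mule0.
rewrite -EFinM; congr EFin; field; exact: lt0r_neq0.
Qed.

Lemma ge0_integral_affine (f : R -> R) : measurable_fun setT f ->
  (forall x, 0 <= f x) ->
  (\int[leb]_x (f (a * x + b)%R)%:E = (a^-1)%:E * \int[leb]_x (f x)%:E)%E.
Proof.
move=> mf f0; rewrite [in RHS](eq_measure_integral
   (mscale (NngNum (ltW a0)) (pushforward_measure leb mphi))); last first.
  by move=> A mA _; exact: phi_meas.
rewrite ge0_integral_mscale//=; [|exact/measurable_EFinP|by move=> x _; rewrite lee_fin].
rewrite muleA -EFinM mulVf ?mul1e ?gt_eqF//.
rewrite (ge0_integral_pushforward mphi)//.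
  exact/measurable_EFinP.
by move=> x _; rewrite lee_fin.
Qed.

Lemma cintegral_affine (f : R -> R[i]) : cintegrable leb setT f ->
  cintegrable leb setT (fun x => f (a * x + b)) /\
  cintegral leb setT (fun x => f (a * x + b)) = a^-1%:C * cintegral leb setT f.
Proof.
move=> fi; have mf := cintegrable_measurable fi.
have fi' : cintegrable leb setT (fun x => f (a * x + b)).
  have mfp : cmeasurable (f \o phi) by exact: (cmeasurable_comp mphi).
  refine (@cintegrable_le _ _ _ leb _ _ mfp (fun x => lexx _) _).
  apply/integrableP; split.
    apply/measurable_EFinP; apply: measurable_normc.
    exact: (cmeasurable_comp mphi).
  have /integrableP[_] := cintegrable_normc fi.
  under eq_integral do rewrite /= ger0_norm ?normc_ge0//.
  under [X in _ -> (X < _)%E]eq_integral do rewrite /= ger0_norm ?normc_ge0//.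
  move=> h; rewrite (ge0_integral_affine (f := @Normc.normc R \o f)) /=.
  - by rewrite lte_mul_pinfty// lee_fin invr_ge0 ltW.
  - exact: measurable_normc.
  - by move=> x; exact: normc_ge0.
split => //.
have key (g : R -> R) : leb.-integrable setT (EFin \o g) ->
    Rintegral leb setT (fun x => g (a * x + b)) = a^-1 * Rintegral leb setT g.
  move=> gi; have gfin := integrable_fin_num measurableT gi.
  have mg : measurable_fun setT g by move: gi => /measurable_int/measurable_EFinP.
  suff gE : (\int[leb]_x (g (a * x + b)%R)%:E = (a^-1)%:E * \int[leb]_x (g x)%:E)%E.
    by rewrite /Rintegral gE fineM //.
  rewrite integralE [in RHS]integralE.
  have fp := integrable_pos_fin_num measurableT gi.
  rewrite (funerpos g) (funerneg g) (funerpos (fun x => g (a * x + b))).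
  rewrite (funerneg (fun x => g (a * x + b))).
  rewrite /=.
  have -> : (fun x => g (a * x + b))^\+ = fun x => (g^\+ (a * x + b))%R by [].
  have -> : (fun x => g (a * x + b))^\- = fun x => (g^\- (a * x + b))%R by [].
  rewrite !ge0_integral_affine//;
    [|by first [exact: measurable_funrneg|exact: measurable_funrpos]..].
  apply/esym/muleBr => //.
  by apply: fin_num_adde_defr; move: fp; rewrite (funerpos g).
case: fi => i1 i2; rewrite /cintegral.
apply: complex_ext; rewrite ?Re_realM ?Im_realM /=.
  exact: (key (fun x => complex.Re (f x))).
exact: (key (fun x => complex.Im (f x))).
Qed.

End Affine.

(** * The Gamma function on the positive half-line *)
Section GammaReal.
Variable R : realType.
Local Notation leb := (@lebesgue_measure R).

Definition gammar (x t : R) : R := if 0 < t then t `^ (x - 1) * expR (- t) else 0.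

Lemma gammar_ge0 x t : 0 <= gammar x t.
Proof. by rewrite /gammar; case: ifP => // _; rewrite mulr_ge0 ?powR_ge0 ?expR_ge0. Qed.

Lemma measurable_pos : measurable_fun setT (fun t : R => 0 < t).
Proof. exact: measurable_fun_ltr. Qed.

Lemma measurable_gammar x : measurable_fun setT (gammar x).
Proof.
apply: measurable_fun_ifT; [exact: measurable_pos| |exact: measurable_cst].
by apply: measurable_funM; [exact: measurable_powR|exact: measurableT_comp].
Qed.

(** The antiderivative x^-1 t^x is differentiable on the intervals [1/n, 1] only,
    so the interval is exhausted by these. *)
Lemma integral_powR_01 (x : R) : 0 < x ->
  (\int[leb]_(t in `]0%R, 1%R]) (t `^ (x - 1))%:E <= (x^-1)%:E)%E.
Proof.
move=> x0.
pose A (n : nat) : set R := `[n.+1%:R^-1, 1]%classic.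
have An n t : A n t -> 0 < t.
  by rewrite /A /= in_itv /= => /andP[h _]; rewrite (lt_le_trans _ h)// invr_gt0.
have -> : `]0, 1]%classic = \bigcup_n A n.
  apply/seteqP; split => t /=; last by case=> n _ h; rewrite in_itv/= (An n)//=;
    move: h; rewrite /A/= in_itv/= => /andP[].
  rewrite in_itv/= => /andP[t0 t1].
  exists (Num.truncn t^-1) => //; rewrite /A /= in_itv/= t1 andbT.
  rewrite -[leRHS]invrK lef_pV2 ?posrE ?invr_gt0//.
  by apply/ltW; rewrite truncnS_gt.
have mp D : measurable_fun D (fun t : R => (t `^ (x - 1))%:E).
  by apply/measurable_EFinP/measurable_funTS; exact: measurable_powR.
have cv : (\int[leb]_(t in A n) (t `^ (x - 1))%:E @[n --> \oo] -->
    \int[leb]_(t in \bigcup_n A n) (t `^ (x - 1))%:E)%E.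
  apply: ge0_nondecreasing_set_cvg_integral => //.
  - apply/nondecreasing_seqP => n; rewrite subsetEset => t /=.
    rewrite /A/= !in_itv/= => /andP[h ->]; rewrite andbT (le_trans _ h)//.
    by rewrite lef_pV2 ?posrE// ler_nat.
  - by move=> i; rewrite /A.
  - by move=> i; exact: mp.
  - by move=> i t At; rewrite lee_fin powR_ge0.
rewrite -(cvg_lim _ cv)//; apply: lime_le; first exact: (cvgP _ cv).
apply: nearW => n.
have n1 : (n.+1%:R^-1 : R) <= 1 by rewrite invf_le1// ler1n.
move: n1; rewrite le_eqVlt => /predU1P[n1|n1].
  rewrite /A n1 set_itv1 integral_set1//.
  by rewrite lee_fin invr_ge0 ltW.
have dF (t : R) : 0 < t -> is_derive t 1 (fun t : R => x^-1 * t `^ x) (t `^ (x - 1)).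
  move=> t0; have := @is_derive1_powR R x t t0 => dP.
  have := is_deriveZ x^-1 dP; rewrite /GRing.scale/=.
  by rewrite mulrA mulVf ?mul1r ?gt_eqF.
have cF (t : R) : 0 < t -> {for t, continuous (fun t : R => x^-1 * t `^ x)}.
  move=> t0; apply: differentiable_continuous; apply/derivable1_diffP.
  by have [] := dF t t0.
rewrite (@continuous_FTC2 _ _ (fun t => x^-1 * t `^ x))//.
+ rewrite powR1 mulr1 -EFinB lee_fin gerBl mulr_ge0 ?powR_ge0//.
  by rewrite invr_ge0 ltW.
+ apply: derivable_within_continuous => t /An t0.
  have h : t \in `]0, +oo[ by rewrite in_itv/= t0.
  exact: derivable_powR.
+ split.
  * move=> t; rewrite in_itv/= => /andP[t0 _].
    by have [] := dF t (lt_trans _ t0); rewrite // invr_gt0.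
  * by apply: cvg_at_right_filter; apply: cF; rewrite invr_gt0.
  * by apply: cvg_at_left_filter; apply: cF.
+ move=> t; rewrite in_itv/= => /andP[t0 _].
  rewrite derive1E; have := dF t; case => //.
  by rewrite (lt_trans _ t0)// invr_gt0.
Qed.

(** The integrand is dominated by t^(x-1) near 0.  For t > 1 it is dominated
    by a multiple of exp (- t / 2), because ln y <= y - 1 at y = t / (2 x) gives
    x ln t <= x ln (2 x) + t / 2. *)
Lemma gammar_integrable (x : R) : 0 < x -> leb.-integrable setT (EFin \o gammar x).
Proof.
move=> x0.
pose h1 : R -> R := (fun t : R => t `^ (x - 1)) \_ (`]0, 1]%classic : set R).
pose C := 2 * expR (x * ln (2 * x)).
pose h2 (t : R) := C * exponential_pdf 2^-1 t.
have i1 : leb.-integrable setT (EFin \o h1).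
  apply/integrableP; split.
    apply/measurable_EFinP/(measurable_restrictT (fun t : R => t `^ (x - 1))) => //.
    by apply: measurable_funTS; exact: measurable_powR.
  apply: le_lt_trans (ltry (x^-1)); apply: le_trans (integral_powR_01 x0).
  rewrite [leRHS]integral_mkcond; apply: ge0_le_integral => //.
  - apply: measurableT_comp => //; apply/measurable_EFinP.
    apply/(measurable_restrictT (fun t : R => t `^ (x - 1))) => //.
    by apply: measurable_funTS; exact: measurable_powR.
  - apply/(measurable_restrictT (fun t : R => (t `^ (x - 1))%:E)) => //.
    by apply/measurable_EFinP/measurable_funTS; exact: measurable_powR.
  - move=> t _; rewrite /h1 /= /patch; case: ifP => _; last by rewrite normr0.
    by rewrite ger0_norm// powR_ge0.
have i2 : leb.-integrable setT (EFin \o h2).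
  rewrite (_ : EFin \o h2 = fun t => (C%:E * (exponential_pdf 2^-1 t)%:E)%E).
    apply: integrableZl => //.
    by apply: integrable_exponential_pdf; rewrite invr_gt0.
  by apply/funext => t; rewrite /h2 /= EFinM.
refine (@le_integrable1 _ _ _ leb _ (fun t => h1 t + h2 t) _ _ _).
- exact: measurable_gammar.
- move=> t; rewrite ger0_norm ?gammar_ge0// /gammar.
  have h20 : 0 <= h2 t.
    by rewrite mulr_ge0 ?mulr_ge0 ?expR_ge0// exponential_pdf_ge0// invr_ge0.
  have h10 : 0 <= h1 t by rewrite /h1 /patch; case: ifP => // _; exact: powR_ge0.
  case: ifPn => [t0|_]; last exact: addr_ge0.
  have [t1|t1] := leP t 1.
    rewrite -[leLHS]addr0 lerD// /h1 patchE mem_set; last by rewrite /= in_itv/= t0.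
    by rewrite ler_piMr ?powR_ge0// -expR0 ler_expR oppr_le0 ltW.
  rewrite -[leLHS]add0r lerD// /h2 exponential_pdfE; last exact: ltW.
  rewrite /C.
  rewrite [leRHS](_ : _ = expR (x * ln (2 * x) - 2^-1 * t)); last first.
    by rewrite -mulNr expRD; field.
  rewrite /powR gt_eqF// -expRD ler_expR.
  have x20 : 0 < 2 * x by rewrite mulr_gt0.
  have := @le_ln1Dx R (t / (2 * x) - 1).
  rewrite addrCA subrr addr0 => /(_ _); rewrite ltrBrDl subrr divr_gt0// => /(_ isT).
  rewrite lnM ?posrE ?invr_gt0// lnV ?posrE// => h.
  have lt0 : 0 <= ln t by rewrite ln_ge0// ltW.
  have : x * (ln t - ln (2 * x)) <= x * (t / (2 * x) - 1) by rewrite ler_pM2l.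
  have -> : x * (t / (2 * x) - 1) = t / 2 - x by field; exact: lt0r_neq0.
  by move=> h'; lra.
- rewrite (_ : EFin \o _ = (EFin \o h1) \+ (EFin \o h2))%E//.
  exact: integrableD.
Qed.

Definition Gammar (x : R) : R := Rintegral leb setT (gammar x).

Lemma integral_gammar x : 0 < x -> (\int[leb]_t (gammar x t)%:E = (Gammar x)%:E)%E.
Proof.
move=> x0; rewrite /Gammar /Rintegral fineK//.
by apply: integrable_fin_num => //; exact: gammar_integrable.
Qed.

(** A nonnegative function with zero integral vanishes almost everywhere. *)
Lemma gt0_integral_gt0 (f : R -> R) : measurable_fun setT f ->
  (forall t, 0 <= f t) -> (forall t, 0 < t -> 0 < f t) ->
  (0 < \int[leb]_t (f t)%:E)%E.
Proof.
move=> mf f0 f1; rewrite lt0e integral_ge0 ?andbT; last first.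
  by move=> t _; rewrite lee_fin.
apply/eqP => I0.
have : leb (`]0, +oo[%classic : set R) = 0%E.
  apply/eqP; rewrite eq_le measure_ge0 andbT.
  have mEf : measurable_fun setT (EFin \o f : measurableTypeR R -> _).
    exact/measurable_EFinP.
  have [ae0 _] := ae_eq_integral_abs leb measurableT mEf.
  have /ae0[N [mN N0 sub]] : (\int[leb]_t `|(EFin \o f) t| = 0)%E.
    by under eq_integral do rewrite /= ger0_norm//.
  rewrite -N0; apply: le_measure; rewrite ?inE//.
  move=> t /= ; rewrite in_itv/= andbT => t0; apply: sub => /= /(_ I)[] fE.
  by have := f1 _ t0; rewrite fE ltxx.
by rewrite lebesgue_measure_itv/= ltry.
Qed.

Lemma Gammar_gt0 x : 0 < x -> 0 < Gammar x.
Proof.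
move=> x0; rewrite -lte_fin -integral_gammar//; apply: gt0_integral_gt0.
- exact: measurable_gammar.
- exact: gammar_ge0.
- by move=> t t0; rewrite /gammar t0 mulr_gt0 ?expR_gt0 ?powR_gt0.
Qed.

Lemma integral_gammar_scale (x c : R) : 0 < x -> 0 < c ->
  (\int[leb]_t (if 0 < t then t `^ (x - 1) * expR (- (c * t)) else 0)%:E =
   (c `^ (- x) * Gammar x)%:E)%E.
Proof.
move=> x0 c0.
have := ge0_integral_affine 0 c0 (measurable_gammar x) (gammar_ge0 x).
rewrite integral_gammar// -EFinM => h.
have cx : c `^ (1 - x) = c * c `^ (- x).
  by rewrite powRD ?powRr1 ?ltW//; apply/implyP => _; rewrite gt_eqF.
transitivity ((c `^ (1 - x))%:E * \int[leb]_t (gammar x (c * t + 0)%R)%:E)%E.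
  rewrite -ge0_integralZl//; first last.
  - by rewrite lee_fin powR_ge0.
  - by move=> t _; rewrite lee_fin gammar_ge0.
  - apply/measurable_EFinP; apply: measurableT_comp; first exact: measurable_gammar.
    by apply: measurable_funD => //; exact: measurable_funM.
  apply: eq_integral => t _; rewrite addr0 /gammar pmulr_rgt0//.
  case: ifPn => [t0|_]; last by rewrite mule0.
  rewrite -EFinM powRM ?ltW// !mulrA -powRD; last first.
    by apply/implyP => _; rewrite gt_eqF.
  by rewrite subrKA subrr powRr0 mul1r.
by rewrite h -EFinM cx; congr EFin; field; exact: lt0r_neq0.
Qed.

End GammaReal.

(** * The Mellin transform of an exponential *)
Section CIf.
Context d (T : measurableType d) (R : realType).

Lemma cmeasurable_if (b : T -> bool) (f : T -> R[i]) : measurable_fun setT b ->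
  cmeasurable f -> cmeasurable (fun x => if b x then f x else 0).
Proof.
move=> mb [f1 f2]; split.
  rewrite (_ : (fun _ => _) = fun x => if b x then complex.Re (f x) else 0).
    exact: measurable_fun_ifT.
  by apply/funext => x; case: ifP.
rewrite (_ : (fun _ => _) = fun x => if b x then complex.Im (f x) else 0).
  exact: measurable_fun_ifT.
by apply/funext => x; case: ifP.
Qed.

End CIf.

Section Mellin.
Variable R : realType.
Local Notation leb := (@lebesgue_measure R).
Local Notation RT := (measurableTypeR R).

(** Extended by 0, so that all integrals run over the whole line.  Its integral over t
    is the Laplace transform of t^(z-1) at c. *)
Definition gammac (z : R[i]) (c t : R) : R[i] :=
  if 0 < t then cpow t (z - 1) * (expR (- (c * t)))%:C else 0.

Lemma Re_sub1 (z : R[i]) : complex.Re (z - 1) = complex.Re z - 1.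
Proof. by rewrite Re_addc Re_oppc. Qed.

Lemma normc_gammac z c t : Normc.normc (gammac z c t) =
  if 0 < t then t `^ (complex.Re z - 1) * expR (- (c * t)) else 0.
Proof.
rewrite /gammac; case: ifP => [t0|_]; last exact: Normc.normc0.
by rewrite Normc.normcM normc_cpow// normc_real ger0_norm ?expR_ge0// Re_sub1.
Qed.

Lemma cmeasurable_gammac d (T : measurableType d) z (c t : T -> R) :
  measurable_fun setT c -> measurable_fun setT t ->
  cmeasurable (fun x => gammac z (c x) (t x)).
Proof.
move=> mc mt; rewrite /gammac.
apply: cmeasurable_if.
  exact: (measurableT_comp (@measurable_pos R) mt).
apply: cmeasurableM; first exact: cmeasurable_cpow.
apply: cmeasurable_real; apply: measurableT_comp => //.
by apply: measurableT_comp => //; exact: measurable_funM.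
Qed.

Lemma GammaE (z : R[i]) : Gamma z = cintegral leb setT (gammac z 1).
Proof.
rewrite /Gamma /cintegral.
rewrite Rintegral_mkcond [X in _ +i* X]Rintegral_mkcond.
congr (_ +i* _); apply: eq_Rintegral => t _; rewrite patchE /gammac mul1r;
  case: ifPn => [|].
- by rewrite inE/= in_itv/= andbT => ->.
- by rewrite notin_setE/= in_itv/= andbT => /negP/negbTE ->.
- by rewrite inE/= in_itv/= andbT => ->.
- by rewrite notin_setE/= in_itv/= andbT => /negP/negbTE ->.
Qed.

Lemma normc_gammac1 z t : Normc.normc (gammac z 1 t) = gammar (complex.Re z) t.
Proof. by rewrite normc_gammac mul1r. Qed.

Lemma gammac1_integrable z : 0 < complex.Re z -> cintegrable leb setT (gammac z 1).
Proof.
move=> z0; have mg : cmeasurable (gammac z 1 : RT -> R[i]).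
  exact: (@cmeasurable_gammac _ RT z (fun=> 1) id).
refine (@cintegrable_le _ _ _ leb _ (gammar (complex.Re z)) mg _ _).
  by move=> t; rewrite normc_gammac1.
exact: gammar_integrable.
Qed.

Lemma gammac_scale z c : 0 < complex.Re z -> 0 < c ->
  cintegrable leb setT (gammac z c) /\
  cintegral leb setT (gammac z c) = cpow c (- z) * Gamma z.
Proof.
move=> z0 c0; have [i e] := cintegral_affine 0 c0 (gammac1_integrable z0).
have -> : gammac z c = fun t => cpow c (1 - z) * gammac z 1 (c * t + 0).
  apply/funext => t; rewrite /gammac addr0 pmulr_rgt0//.
  case: ifPn => [t0|_]; last by rewrite mulr0.
  rewrite cpowM// mul1r.
  have cc : cpow c (1 - z) * cpow c (z - 1) = 1.
    by rewrite -cpowD (_ : 1 - z + (z - 1) = 0) ?cpow0//; ring.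
  by rewrite -[LHS]mul1r -[X in X * (_ * _) = _]cc; ring.
split; first exact: cintegrableZl.
rewrite (cintegralZl _ i) e -(GammaE z) (cpowD c 1 (- z)) (cpow_1r c0).
have cc : c%:C * c^-1%:C = 1 by rewrite -rmorphM/= mulfV ?gt_eqF.
by rewrite -[RHS]mul1r -[X in _ = X * (_ * _)]cc; ring.
Qed.

(** Gamma(z) phi^(-z) is the integral of s^(z-1) exp (- phi s) over s.  Exchanging
    the integrals in s and v reduces integrals of g phi^(-z) to integrals of
    g exp (- phi s), which are explicit in the applications.  The functions h and
    the number M are these integrals for absolute values; they are given in closed
    form because they yield both the exchange and the value of the integral
    of absolute values. *)
Variables (z : R[i]) (g : R -> R[i]) (phi : R -> R).
Hypotheses (z0 : 0 < complex.Re z) (mg : cmeasurable g).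
Hypotheses (mphi : measurable_fun setT phi) (phi0 : forall v, 0 < phi v).
Let x := complex.Re z.

Variables (h : R -> R) (M : R).
Hypothesis hE : forall s, 0 < s ->
  (\int[leb]_v (Normc.normc (g v) * expR (- (phi v * s)))%:E = (h s)%:E)%E.
Hypothesis ME : (\int[leb]_s (if (0 < s)%R then (s `^ (x - 1) * h s)%R else 0%R)%:E =
  M%:E)%E.

Let F (p : RT * RT) : R[i] := gammac z (phi p.1) p.2 * g p.1.

Let mF : cmeasurable F.
Proof.
apply: cmeasurableM.
  apply: (@cmeasurable_gammac _ (RT * RT)%type) => //.
  by apply: (measurableT_comp mphi); exact: measurable_fst.
by apply: cmeasurable_comp mg; exact: measurable_fst.
Qed.

Let section1 v : cintegrable leb setT (fun s => F (v, s)) /\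
  cintegral leb setT (fun s => F (v, s)) = g v * cpow (phi v) (- z) * Gamma z.
Proof.
have [i e] := gammac_scale z0 (phi0 v).
have -> : (fun s => F (v, s)) = fun s => g v * gammac z (phi v) s.
  by apply/funext => s; rewrite mulrC.
by split; [exact: cintegrableZl|rewrite cintegralZl// e mulrA].
Qed.

Let norm1 v : (\int[leb]_s (Normc.normc (F (v, s)))%:E =
  (Normc.normc (g v) * phi v `^ (- x) * Gammar x)%:E)%E.
Proof.
rewrite /F /=; under eq_integral do rewrite Normc.normcM EFinM normc_gammac.
rewrite ge0_integralZr//=.
- rewrite integral_gammar_scale// -EFinM; congr EFin.
  by rewrite -/x; ring.
- by apply/measurable_EFinP; under eq_fun do rewrite -normc_gammac;
    apply: measurable_normc; exact: (@cmeasurable_gammac _ RT z (fun=> phi v) id).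
- by move=> s _; rewrite lee_fin -normc_gammac normc_ge0.
- by rewrite lee_fin normc_ge0.
Qed.

Let norm2 s : (\int[leb]_v (Normc.normc (F (v, s)))%:E =
  (if (0 < s)%R then (s `^ (x - 1) * h s)%R else 0%R)%:E)%E.
Proof.
rewrite /F /=; under eq_integral do rewrite Normc.normcM normc_gammac.
case: ifPn => s0; last by under eq_integral do rewrite mul0r; rewrite integral0.
rewrite EFinM -hE// -ge0_integralZl//=.
- by apply: eq_integral => v _; rewrite -EFinM -mulrA [expR _ * _]mulrC.
- apply/measurable_EFinP; apply: measurable_funM; first exact: measurable_normc.
  apply: measurableT_comp => //; apply: measurableT_comp => //.
  by apply: measurable_funM => //; exact: mphi.
- by move=> v _; rewrite lee_fin mulr_ge0 ?normc_ge0 ?expR_ge0.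
- by rewrite lee_fin powR_ge0.
Qed.

Let tonelli : (\int[leb]_v (Normc.normc (g v) * phi v `^ (- x) * Gammar x)%:E = M%:E)%E.
Proof.
rewrite -ME; under eq_integral do rewrite -norm1.
under [RHS]eq_integral do rewrite -norm2.
apply: (fubini_tonelli (fun p : RT * RT => (Normc.normc (F p))%:E)).
- by apply/measurable_EFinP; exact: measurable_normc.
- by move=> p; rewrite lee_fin normc_ge0.
Qed.

Let mgphi : measurable_fun setT (fun v : RT => Normc.normc (g v) * phi v `^ (- x)).
Proof.
apply: measurable_funM; first exact: measurable_normc.
by apply: measurableT_comp (measurable_powR _) mphi.
Qed.

Lemma mellin_normc :
  (\int[leb]_v (Normc.normc (g v) * phi v `^ (- x))%:E = (M / Gammar x)%:E)%E.
Proof.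
have G0 := Gammar_gt0 z0.
have := tonelli; under eq_integral do rewrite EFinM.
rewrite ge0_integralZr//=; first last.
- by rewrite lee_fin ltW.
- by move=> v _; rewrite lee_fin mulr_ge0 ?normc_ge0 ?powR_ge0.
- by apply/measurable_EFinP; exact: mgphi.
move=> e; rewrite EFinM -e -muleA -EFinM mulfV ?mule1//.
by rewrite gt_eqF.
Qed.

Lemma mellin_integrable : cintegrable leb setT (fun v => g v * cpow (phi v) (- z)).
Proof.
have m : cmeasurable (fun v : RT => g v * cpow (phi v) (- z)).
  by apply: cmeasurableM => //; exact: cmeasurable_cpow.
refine (@cintegrable_le _ _ _ leb _ (fun v => Normc.normc (g v) * phi v `^ (- x)) m _ _).
  by move=> v; rewrite Normc.normcM normc_cpow// Re_oppc.
apply: ge0_integrable mellin_normc => // v.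
by rewrite mulr_ge0 ?normc_ge0 ?powR_ge0.
Qed.

Lemma mellin : Gamma z * cintegral leb setT (fun v => g v * cpow (phi v) (- z)) =
  cintegral leb setT (fun s =>
    if 0 < s then cpow s (z - 1) *
      cintegral leb setT (fun v => (expR (- (phi v * s)))%:C * g v) else 0).
Proof.
have iF : cintegrable (leb \x leb)%E setT F.
  apply: cintegrable_prod => //; under eq_integral do rewrite norm1.
  by rewrite tonelli ltry.
have sec2 s : 0 < s -> cintegrable leb setT (fun v => (expR (- (phi v * s)))%:C * g v).
  move=> s0; have m : cmeasurable (fun v : RT => (expR (- (phi v * s)))%:C * g v).
    apply: cmeasurableM => //; apply: cmeasurable_real; apply: measurableT_comp => //.
    by apply: measurableT_comp => //; apply: measurable_funM => //; exact: mphi.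
  refine (@cintegrable_le _ _ _ leb _
    (fun v => Normc.normc (g v) * expR (- (phi v * s))) m _ _).
    by move=> v; rewrite Normc.normcM normc_real ger0_norm ?expR_ge0// mulrC.
  apply: (ge0_integrable _ _ (hE s0)) => //.
    apply: measurable_funM; first exact: measurable_normc.
    apply: measurableT_comp => //; apply: measurableT_comp => //.
    by apply: measurable_funM => //; exact: mphi.
  by move=> v; rewrite mulr_ge0 ?normc_ge0 ?expR_ge0.
have FE s : (fun v => F (v, s)) = fun v => (if 0 < s then cpow s (z - 1) else 0) *
    ((expR (- (phi v * s)))%:C * g v).
  by apply/funext => v; rewrite /F /gammac /=; case: ifP => _; rewrite ?mulrA ?mul0r.
have sec2' s : cintegrable leb setT (fun v => F (v, s)).
  rewrite FE; case: ifPn => s0; first by apply: cintegrableZl; exact: sec2.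
  rewrite (_ : (fun _ => _) = fun=> 0); last by apply/funext => v; rewrite mul0r.
  by split; exact: integrable0.
rewrite -cintegralZl; last exact: mellin_integrable.
transitivity (cintegral leb setT (fun v => cintegral leb setT (fun s => F (v, s)))).
  by apply: eq_cintegral => v; rewrite (section1 v).2 mulrC.
rewrite (cfubini_swap iF)//; last by move=> v; case: (section1 v).
apply: eq_cintegral => s; rewrite FE; case: ifPn => s0.
  by rewrite cintegralZl//; exact: sec2.
rewrite (_ : (fun _ => _) = fun=> 0); last by apply/funext => v; rewrite mul0r.
by rewrite /cintegral /Rintegral /= integral0.
Qed.

End Mellin.

(** * One-dimensional Beta integrals and the zeros of Gamma *)
Section GammaApplications.
Variable R : realType.
Local Notation leb := (@lebesgue_measure R).
Local Notation RT := (measurableTypeR R).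

Lemma half_gt0 : 0 < 2^-1 :> R. Proof. by rewrite invr_gt0. Qed.

(** The case g = 1, phi = 1 + v^2 : the inner integral is Gaussian. *)
Section Beta.
Variable z : R[i].
Hypothesis z12 : 2^-1 < complex.Re z.
Let x := complex.Re z.

Let x0 : 0 < x. Proof. exact: lt_trans half_gt0 z12. Qed.

Let phi (v : R) : R := 1 + v ^+ 2.

Let phi0 v : 0 < phi v. Proof. by rewrite /phi ltr_wpDr ?sqr_ge0. Qed.

Let mphi : measurable_fun setT phi.
Proof. by apply: measurable_funD => //; exact: measurable_funX. Qed.

Let gauss s : 0 < s -> (\int[leb]_v (expR (- (phi v * s)))%:E =
  (Num.sqrt pi * (expR (- s) * s `^ (- 2^-1)))%:E)%E.
Proof.
move=> s0; have r0 : 0 < s `^ 2^-1 by rewrite powR_gt0.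
have := ge0_integral_affine 0 r0 (@measurable_gauss_fun R) (@gauss_fun_ge0 R).
rewrite integralT_gauss -EFinM => h.
transitivity ((expR (- s))%:E * \int[leb]_v (gauss_fun (s `^ 2^-1 * v + 0)%R)%:E)%E.
  rewrite -ge0_integralZl//; first last.
  - by move=> t _; rewrite lee_fin gauss_fun_ge0.
  - apply/measurable_EFinP; apply: measurableT_comp; first exact: measurable_gauss_fun.
    by apply: measurable_funD => //; exact: measurable_funM.
  apply: eq_integral => v _; rewrite addr0 /gauss_fun -EFinM -expRD; congr (expR _)%:E.
  rewrite exprMn -powR_mulrn ?powR_ge0// -powRrM mulVf// powRr1 ?ltW//.
  by rewrite /phi; ring.
by rewrite h -EFinM powRN; congr EFin; ring.
Qed.

Let hE s : 0 < s ->
  (\int[leb]_v (Normc.normc (1 : R[i]) * expR (- (phi v * s)))%:E =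
  (Num.sqrt pi * (expR (- s) * s `^ (- 2^-1)))%:E)%E.
Proof.
by move=> s0; under eq_integral do rewrite Normc.normc1 mul1r; exact: gauss.
Qed.

Let ME : (\int[leb]_s (if (0 < s)%R then (s `^ (x - 1) *
     (Num.sqrt pi * (expR (- s) * s `^ (- 2^-1))))%R else 0%R)%:E =
  (Num.sqrt pi * Gammar (x - 2^-1))%:E)%E.
Proof.
rewrite EFinM -integral_gammar ?subr_gt0// -ge0_integralZl//.
- apply: eq_integral => s _; rewrite /gammar; case: ifPn => s0; last by rewrite mule0.
  have -> : s `^ (x - 2^-1 - 1) = s `^ (x - 1) * s `^ (- 2^-1).
    rewrite -powRD; last by apply/implyP => _; rewrite gt_eqF.
    by congr (_ `^ _); ring.
  by rewrite -EFinM; congr EFin; ring.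
- by apply/measurable_EFinP; exact: measurable_gammar.
- by move=> s _; rewrite lee_fin gammar_ge0.
Qed.

Let mcst : cmeasurable (fun _ : R => 1 : R[i]). Proof. exact: cmeasurable_cst. Qed.

Lemma beta_normc : (\int[leb]_v ((1 + v ^+ 2) `^ (- x))%:E =
  (Num.sqrt pi * Gammar (x - 2^-1) / Gammar x)%:E)%E.
Proof.
rewrite -(mellin_normc x0 mcst mphi phi0 hE ME).
by apply: eq_integral => v _; rewrite Normc.normc1 mul1r.
Qed.

Lemma beta_integrable : cintegrable leb setT (fun v : R => cpow (1 + v ^+ 2) (- z)).
Proof.
have := mellin_integrable x0 mcst mphi phi0 hE ME.
by under eq_fun do rewrite mul1r.
Qed.

Lemma beta_Gamma : Gamma z * cintegral leb setT (fun v => cpow (1 + v ^+ 2) (- z)) =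
  (Num.sqrt pi)%:C * Gamma (z - 2^-1%:C).
Proof.
have := mellin x0 mcst mphi phi0 hE ME; under eq_fun do rewrite mul1r.
move=> ->; have z120 : 0 < complex.Re (z - 2^-1%:C) by rewrite Re_addc Re_oppc /= subr_gt0.
rewrite GammaE -cintegralZl; last exact: gammac1_integrable.
apply: eq_cintegral => s; rewrite /gammac; case: ifPn => s0; last by rewrite mulr0.
have -> : cintegral leb setT (fun v => (expR (- (phi v * s)))%:C * 1) =
   (Num.sqrt pi * (expR (- s) * s `^ (- 2^-1)))%:C.
  rewrite -(cintegral_real (gauss s0)).
  by apply: eq_cintegral => v; rewrite mulr1.
rewrite !rmorphM/= mul1r -cpow_real// rmorphN/=.
rewrite (_ : z - 2^-1%:C - 1 = (z - 1) + (- 2^-1%:C)); last by ring.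
by rewrite (cpowD s (z - 1)); ring.
Qed.

End Beta.

(** The case g = v^(b-1) on the half-line : the inner integral is Gamma again. *)
Section Product.
Variables a b : R[i].
Hypotheses (a0 : 0 < complex.Re a) (b0 : 0 < complex.Re b).
Let al := complex.Re a.
Let be := complex.Re b.

Let g (v : R) : R[i] := if 0 < v then cpow v (b - 1) else 0.
(* Only v > 0 matters; the absolute value keeps phi positive on the whole line. *)
Let phi (v : R) : R := 1 + `|v|.

Let z0 : 0 < complex.Re (a + b). Proof. by rewrite Re_addc addr_gt0. Qed.

Let mg : cmeasurable g.
Proof. by apply: cmeasurable_if; [exact: measurable_pos|exact: cmeasurable_cpow]. Qed.

Let mphi : measurable_fun setT phi.
Proof. by apply: measurable_funD => //; exact: measurableT_comp. Qed.

Let phi0 v : 0 < phi v. Proof. by rewrite /phi ltr_wpDr. Qed.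

Let gE s v : (expR (- (phi v * s)))%:C * g v = (expR (- s))%:C * gammac b s v.
Proof.
rewrite /g /gammac; case: ifPn => v0; last by rewrite !mulr0.
rewrite /phi gtr0_norm// (_ : - ((1 + v) * s) = - s + - (s * v)); last by ring.
by rewrite expRD rmorphM/=; ring.
Qed.

Let hE s : 0 < s ->
  (\int[leb]_v (Normc.normc (g v) * expR (- (phi v * s)))%:E =
  (expR (- s) * (s `^ (- be) * Gammar be))%:E)%E.
Proof.
move=> s0; rewrite EFinM -integral_gammar_scale// -ge0_integralZl//.
- apply: eq_integral => v _; rewrite -normc_gammac -EFinM; congr EFin.
  rewrite -[expR (- s)]ger0_norm ?expR_ge0// -normc_real -Normc.normcM -gE.
  by rewrite Normc.normcM normc_real ger0_norm ?expR_ge0// mulrC.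
- apply/measurable_EFinP; under eq_fun do rewrite -normc_gammac.
  by apply: measurable_normc; exact: (@cmeasurable_gammac _ _ RT b (fun=> s) id).
- by move=> v _; rewrite lee_fin -normc_gammac normc_ge0.
Qed.

Let ME : (\int[leb]_s (if (0 < s)%R then (s `^ (complex.Re (a + b) - 1) *
     (expR (- s) * (s `^ (- be) * Gammar be)))%R else 0%R)%:E =
  (Gammar be * Gammar al)%:E)%E.
Proof.
rewrite EFinM -[X in (_ * X)%E]integral_gammar// -ge0_integralZl//.
- apply: eq_integral => s _; rewrite /gammar; case: ifPn => s0; last by rewrite mule0.
  have -> : s `^ (al - 1) = s `^ (complex.Re (a + b) - 1) * s `^ (- be).
    rewrite -powRD; last by apply/implyP => _; rewrite gt_eqF.
    by congr (_ `^ _); rewrite Re_addc -/al -/be; ring.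
  by rewrite -EFinM; congr EFin; ring.
- by apply/measurable_EFinP; exact: measurable_gammar.
- by move=> s _; rewrite lee_fin gammar_ge0.
- by rewrite lee_fin ltW// Gammar_gt0.
Qed.

(** Euler's identity, with B the Beta integral; its use is that Gamma (a + b) = 0
    forces Gamma a = 0 or Gamma b = 0. *)
Lemma Gamma_mul : exists B : R[i], Gamma (a + b) * B = Gamma a * Gamma b.
Proof.
exists (cintegral leb setT (fun v => g v * cpow (phi v) (- (a + b)))).
rewrite (mellin z0 mg mphi phi0 hE ME).
rewrite mulrC [Gamma a]GammaE -cintegralZl; last exact: gammac1_integrable.
apply: eq_cintegral => s; rewrite [in RHS]/gammac; case: ifPn => s0; last by rewrite mulr0.
have [i e] := gammac_scale b0 s0.
under eq_fun do rewrite gE; rewrite cintegralZl// e mul1r.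
rewrite (_ : a + b - 1 = (a - 1) + b); last by ring.
rewrite (cpowD s (a - 1)) cpowN; have := cpow_neq0 s b => sb.
by field.
Qed.

End Product.

Lemma Gamma_half_eq0 (z : R[i]) :
  0 < complex.Re z -> Gamma z = 0 -> Gamma (2^-1%:C * z) = 0.
Proof.
move=> z0 Gz; have zE : z = 2^-1%:C * z + 2^-1%:C * z.
  by apply: complex_ext; [rewrite Re_addc Re_realM|rewrite Im_addc Im_realM]; field.
have h0 : 0 < complex.Re (2^-1%:C * z) by rewrite Re_realM mulr_gt0// half_gt0.
have [B] := Gamma_mul h0 h0; rewrite -zE Gz mul0r => /esym/eqP.
by rewrite mulf_eq0 orbb => /eqP.
Qed.

(* Both terms integrate to a multiple of Gamma a, so the difference integrates to 0
   when Gamma a = 0; it stays integrable as a tends to 0. *)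
Let D (a : R[i]) (t : R) : R[i] := gammac a 1 t - gammac a 2 t.

Let D_eq0 a : 0 < complex.Re a -> Gamma a = 0 ->
  (\int[leb]_t (complex.Re (D a t))%:E = 0)%E.
Proof.
move=> a0 Ga.
have [[i1 _] e1] : cintegrable leb setT (gammac a 1) /\
    cintegral leb setT (gammac a 1) = 0.
  by split; [exact: gammac1_integrable|rewrite -GammaE].
have [[i2 _] e2] : cintegrable leb setT (gammac a 2) /\
    cintegral leb setT (gammac a 2) = 0.
  by have [] := gammac_scale a0 (ltr0n R 2); rewrite Ga mulr0.
under eq_integral do rewrite /D Re_addc Re_oppc EFinB.
rewrite integralB//.
have := congr1 (@complex.Re R) e1; have := congr1 (@complex.Re R) e2.
rewrite /cintegral /Rintegral /= => f2 f1.
have I1 := etrans (esym (fineK (integrable_fin_num measurableT i1))) (congr1 EFin f1).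
have I2 := etrans (esym (fineK (integrable_fin_num measurableT i2))) (congr1 EFin f2).
exact (etrans (congr2 (fun x y => x - y)%E I1 I2) (sube0 0%E)).
Qed.

Let DE a (t : R) : 0 < t -> D a t = cpow t (a - 1) * (expR (- t) - expR (- (2 * t)))%:C.
Proof. by move=> t0; rewrite /D /gammac t0 mul1r -mulrBr -rmorphB. Qed.

Let exp_diff (t : R) : 0 < t -> 0 < expR (- t) - expR (- (2 * t)) :> R.
Proof. by move=> t0; rewrite subr_gt0 ltr_expR; lra. Qed.

Let exp_diff_le (t : R) : 0 < t -> expR (- t) - expR (- (2 * t)) <= t * expR (- t) :> R.
Proof.
move=> t0; rewrite (_ : - (2 * t) = - t + - t) ?expRD; last by ring.
have := expR_ge1Dx (- t); have := expR_gt0 (- t).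
move: (expR (- t)) => e e0 et; rewrite -{1}[e]mul1r -mulrBl; apply: (ler_wpM2r (ltW e0)); lra.
Qed.

Let D_le z a (t : R) : 0 <= complex.Re a -> complex.Re a <= complex.Re z ->
  Normc.normc (D a t) <= gammar 1 t + gammar (complex.Re z + 1) t.
Proof.
move=> a0 az; rewrite /gammar; case: ifPn => t0; last first.
  by rewrite /D /gammac (negbTE t0) subrr Normc.normc0 addr0.
rewrite DE// Normc.normcM normc_cpow// normc_real gtr0_norm ?exp_diff//.
rewrite subrr powRr0 mul1r addrK Re_sub1.
apply: (@le_trans _ _ (t `^ complex.Re a * expR (- t))).
  have -> : t `^ complex.Re a = t `^ (complex.Re a - 1) * t.
    rewrite -[X in _ * X]powRr1 ?ltW// -powRD ?subrK//.
    by apply/implyP => _; rewrite gt_eqF.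
  by rewrite -mulrA ler_wpM2l ?powR_ge0// exp_diff_le.
rewrite -[X in X + _]mul1r -mulrDl ler_wpM2r ?expR_ge0//.
have [t1|t1] := leP t 1.
  rewrite -[leLHS]addr0 lerD ?powR_ge0// -(powRr0 t).
  by rewrite /powR gt_eqF// ler_expR mul0r mulr_ge0_le0// ln_le0.
rewrite -[leLHS]add0r lerD//.
by rewrite /powR gt_eqF// ler_expR ler_wpM2r// ln_ge0// ltW.
Qed.

(* The limit of D a as a tends to 0; it is positive on the half-line. *)
Let L (t : R) : R := if 0 < t then t `^ (-1) * (expR (- t) - expR (- (2 * t))) else 0.

Let D_cvg z (t : R) :
  complex.Re (D ((2^-1 ^+ n)%:C * z) t) @[n --> \oo] --> L t.
Proof.
rewrite /L; case: ifPn => t0; last first.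
  rewrite (_ : (fun n => _) = fun=> 0); first exact: cvg_cst.
  by apply/funext => n; rewrite /D /gammac (negbTE t0) subrr.
pose phi (e : R) : R := expR ((e * complex.Re z - 1) * ln t) *
  cos (e * complex.Im z * ln t) * (expR (- t) - expR (- (2 * t))).
have -> : (fun n => complex.Re (D ((2^-1 ^+ n)%:C * z) t)) =
    fun n => phi (2^-1 ^+ n).
  apply/funext => n; rewrite DE// mulrC Re_realM mulrC; congr (_ * _).
  rewrite /cpow Re_cexp; congr (expR _ * cos _).
    by rewrite mulrC Re_realM Re_addc Re_oppc Re_realM /= mulrC.
  by rewrite mulrC Im_realM Im_addc Im_oppc Im_realM /= oppr0 addr0 mulrC.
have -> : t `^ (-1) * (expR (- t) - expR (- (2 * t))) = phi 0.
  rewrite /phi !mul0r cos0 mulr1 sub0r; congr (_ * _).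
  by rewrite /powR gt_eqF// mulN1r.
have c0 : (2^-1 ^+ n : R) @[n --> \oo] --> (0 : R).
  by apply: cvg_expr; rewrite gtr0_norm ?half_gt0// invf_lt1// ltr1n.
have cl (u v : R) : ((2^-1 ^+ n * u - v) * ln t) @[n --> \oo] --> ((0 * u - v) * ln t).
  apply: cvgMl; apply: cvgB; last exact: cvg_cst.
  exact: cvgMl.
apply: cvgM; last exact: cvg_cst.
apply: cvgM.
  by apply: continuous_cvg; [exact: continuous_expR|exact: cl].
apply: continuous_cvg; first exact: continuous_cos.
by have := cl (complex.Im z) 0; under eq_fun do rewrite subr0; rewrite subr0.
Qed.

(** A zero z would propagate to z/2, z/4, ... by the Beta identity, that is, to
    zeros tending to the origin, where Gamma has a pole.  The difference of two
    scalings of Euler's integral removes the pole, so that dominated convergence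
    applies: the integral of (exp (- t) - exp (- 2 t)) / t would vanish. *)
Lemma Gamma_neq0 (z : R[i]) : 0 < complex.Re z -> Gamma z != 0.
Proof.
move=> z0; apply/eqP => Gz.
pose a n := (2^-1 ^+ n)%:C * z.
have e01 n : 0 < 2^-1 ^+ n :> R /\ 2^-1 ^+ n <= 1 :> R.
  split; first by rewrite exprn_gt0// half_gt0.
  by rewrite exprn_ile1// ?ltW ?half_gt0// invf_lt1// ltr1n.
have a0 n : 0 < complex.Re (a n) by rewrite Re_realM mulr_gt0//; case: (e01 n).
have Ga n : Gamma (a n) = 0.
  elim: n => [|n IH]; first by rewrite /a expr0 mul1r.
  rewrite /a exprS rmorphM/= -mulrA; apply: Gamma_half_eq0 => //.
  exact: a0.
have mD n : measurable_fun setT (fun t : RT => (complex.Re (D (a n) t))%:E).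
  apply/measurable_EFinP; have [] : cmeasurable (D (a n) : RT -> R[i]) => //.
  apply: cmeasurableD; first exact: (@cmeasurable_gammac _ _ RT _ (fun=> 1) id).
  under eq_fun do rewrite -mulN1r.
  apply: cmeasurableM; first exact: cmeasurable_cst.
  exact: (@cmeasurable_gammac _ _ RT _ (fun=> 2) id).
have mL : measurable_fun setT (L : RT -> R).
  apply: measurable_fun_ifT; [exact: measurable_pos| |exact: measurable_cst].
  apply: measurable_funM; first exact: measurable_powR.
  apply: measurable_funB; apply: measurableT_comp => //.
  by apply: measurableT_comp => //; exact: measurable_funM.
have iG : leb.-integrable setT
    (fun t : RT => (gammar 1 t + gammar (complex.Re z + 1) t)%:E).
  rewrite (_ : (fun t => _) =
    ((EFin \o gammar 1) \+ (EFin \o gammar (complex.Re z + 1)))%E)//.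
  by apply: integrableD => //; apply: gammar_integrable => //; exact: addr_gt0.
have mEL : measurable_fun setT (EFin \o L : RT -> _) by exact/measurable_EFinP.
have Dd (t : RT) : forall n, [set: RT] t -> (`|(complex.Re (D (a n) t))%:E| <=
    (gammar 1 t + gammar (complex.Re z + 1) t)%:E)%E.
  move=> n _; rewrite /= lee_fin (le_trans (Re_le_normc _))//.
  apply: D_le; first by rewrite ltW.
  by rewrite /a Re_realM ler_piMl ?(ltW z0)//; case: (e01 n).
have Dc (t : RT) : [set: RT] t ->
    (fun n => (complex.Re (D (a n) t))%:E) @ \oo --> (EFin \o L) t.
  by move=> _; apply: cvg_EFin; [exact: nearW|exact: D_cvg].
have [_ _] := @dominated_convergence _ RT R leb setT measurableT
  (fun n t => (complex.Re (D (a n) t))%:E) (EFin \o L) _ mD mEL (aeW _ Dc) iG (aeW _ Dd).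
rewrite (_ : (fun n => _) = fun=> 0%E); last first.
  by apply/funext => n; apply: D_eq0.
move=> cL; have L0 : (\int[leb]_t (L t)%:E = 0)%E.
  by apply: (cvg_unique _ cL) => //; exact: cvg_cst.
have : (0 < \int[leb]_t (L t)%:E)%E.
  apply: gt0_integral_gt0 => // t.
    rewrite /L; case: ifPn => // t0; rewrite mulr_ge0 ?powR_ge0//.
    by rewrite ltW// exp_diff.
  by move=> t0; rewrite /L t0 mulr_gt0 ?powR_gt0// exp_diff.
by rewrite L0 ltxx.
Qed.

End GammaApplications.

(** * Lebesgue measure on tuples *)
(** Product measures and Fubini's theorem ask for sigma-finiteness in the type. *)
Section SigmaFinite.
Context d (T : measurableType d) (R : realType).
Variables (m : {measure set T -> \bar R}) (sf : sigma_finite setT m).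

Let sigma_finite_fun : set T -> \bar R := m.
HB.instance Definition _ := Measure.on sigma_finite_fun.
HB.instance Definition _ := Measure_isSigmaFinite.Build d T R sigma_finite_fun sf.
Definition sigma_finite_pack : {sigma_finite_measure set T -> \bar R} :=
  sigma_finite_fun.

End SigmaFinite.

Section LebesgueTuple.
Variable R : realType.
Local Notation leb := (@lebesgue_measure R).
Local Notation RT := (measurableTypeR R).

(** Sides are indexed by nat rather than by 'I_N, so that one family serves all
    dimensions. *)
Definition box N (A : nat -> set R) : set (N.-tuple R) :=
  [set t | forall i : 'I_N, A i (tnth t i)].

Lemma measurable_box N A : (forall i, measurable (A i)) -> measurable (@box N A).
Proof.
move=> mA; rewrite (_ : box _ = \bigcap_(i in [set: 'I_N]) ((@tnth _ R ^~ i) @^-1` A i)).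
  apply: fin_bigcap_measurable => // i _.
  by rewrite -[X in measurable X]setTI; apply: measurable_tnth.
by apply/seteqP; split => t /= h i; [move=> _|]; apply: h.
Qed.

Lemma lebesgue_box N A : (forall i, measurable (A i)) ->
  lebesgue_tuple R N (@box N A) = (\prod_(i < N) leb (A i))%E.
Proof.
elim: N A => [|N IH] A mA.
  rewrite big_ord0 /= diracE mem_set//; by case.
rewrite /= /pushforward big_ord_recl.
rewrite (_ : _ @^-1` _ = box (fun i => A i.+1) `*` A 0%N).
  by rewrite product_measure1E//; [rewrite IH// muleC|exact: measurable_box|exact: mA].
apply/seteqP; split => [[t x] /= h|[t x] /= [h1 h2] i].
  split; last exact: (h ord0).
  by move=> i; have := h (lift ord0 i); rewrite tnthS.
case: (unliftP ord0 i) => [j ->|->]; last by [].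
by rewrite tnthS; apply: h1.
Qed.

Definition cube (k : nat) : nat -> set R := fun=> `[- k%:R, k%:R]%classic.

Lemma cube_cover N : \bigcup_k (@box N (cube k)) = setT.
Proof.
apply/seteqP; split => // t _.
exists (\max_(i < N) (Num.truncn `|tnth t i|).+1)%N => // i; rewrite /cube /= in_itv/=.
rewrite -ler_norml (le_trans (ltW (truncnS_gt _)))// ler_nat.
exact: leq_bigmax.
Qed.

Lemma measurable_cube k i : measurable (cube k i).
Proof. by rewrite /cube. Qed.

Lemma lebesgue_cube_fin N k : (lebesgue_tuple R N (@box N (cube k)) < +oo)%E.
Proof.
rewrite lebesgue_box//; last exact: measurable_cube.
have h : (leb (cube k 0) \is a fin_num)%E.
  by rewrite /cube lebesgue_measure_itv/=; case: ifP.
have : (\prod_(i < N) leb (cube k i))%E \is a fin_num.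
  by elim/big_rec: _ => //= i x _ xf; rewrite fin_numM.
by move/fin_numPlt => /andP[].
Qed.

Lemma sigma_finite_lebesgue_tuple N : sigma_finite setT (lebesgue_tuple R N).
Proof.
exists (fun k => box (cube k)); first by rewrite cube_cover.
by move=> k; split; [apply: measurable_box => i; exact: measurable_cube|
  exact: lebesgue_cube_fin].
Qed.

(** Boxes generate the sigma-algebra, are stable under intersection, and the cubes
    exhaust the space with finite measure. *)
Lemma lebesgue_tuple_unique N (m : {measure set (N.-tuple R) -> \bar R}) :
  (forall A, (forall i, measurable (A i)) ->
     m (@box N A) = (\prod_(i < N) leb (A i))%E) ->
  forall B, measurable B -> lebesgue_tuple R N B = m B.
Proof.
move=> mE; pose G := [set B | exists2 A : nat -> set R,
  (forall i, measurable (A i)) & B = @box N A].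
apply: (measure_unique G (fun k => box (cube k))).
- apply/seteqP; split.
    apply: smallest_sub; first exact: smallest_sigma_algebra.
    apply: (@subset_trans _ G); last exact: sub_gen_smallest.
    rewrite -bigcup_seq => _ [i _ [B mB <-]].
    exists (fun j : nat => if j == i :> nat then B else setT); first by move=> j; case: ifP.
    apply/seteqP; split => t /=; first by move=> [_ h] j; case: eqP => // /val_inj ->.
    by move=> /(_ i); rewrite eqxx.
  apply: smallest_sub; first exact: sigma_algebra_measurable.
  by move=> _ [A mA ->]; exact: measurable_box.
- move=> _ _ [A mA ->] [B mB ->]; exists (fun i => A i `&` B i).
    by move=> i; exact: measurableI.
  apply/seteqP; split => t /=.
    by move=> [a b] i; split; [exact: a|exact: b].
  by move=> ab; split => i; case: (ab i).
- by move=> k; exists (cube k) => //; exact: measurable_cube.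
- exact: cube_cover.
- by move=> _ [A mA ->]; rewrite mE// lebesgue_box.
- exact: lebesgue_cube_fin.
Qed.

End LebesgueTuple.

(** * Successive integration of partial sums of squares *)
Section LineIntegral.
Variable R : realType.
Local Notation leb := (@lebesgue_measure R).
Local Notation RT := (measurableTypeR R).

Definition beta (z : R[i]) : R[i] :=
  (Num.sqrt pi)%:C * Gamma (z - 2^-1%:C) / Gamma z.
Definition betar (x : R) : R := Num.sqrt pi * Gammar (x - 2^-1) / Gammar x.

Lemma betar_ge0 x : 2^-1 < x -> 0 <= betar x.
Proof.
move=> x12; have x0 : 0 < x by apply: lt_trans x12; rewrite invr_gt0.
by rewrite divr_ge0 ?mulr_ge0 ?sqrtr_ge0// ltW// Gammar_gt0// subr_gt0.
Qed.

Variables (S t c : R).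
Hypotheses (S0 : 0 < S) (t0 : 0 < t).

(* The substitution w = a v + b turns S + (t v + c)^2 into S (1 + w^2). *)
Let a := t / Num.sqrt S.
Let b := c / Num.sqrt S.
Let rS0 : 0 < Num.sqrt S. Proof. by rewrite sqrtr_gt0. Qed.
Let a0 : 0 < a. Proof. by rewrite divr_gt0. Qed.

Let quadE v : S + (t * v + c) ^+ 2 = S * (1 + (a * v + b) ^+ 2).
Proof.
have <- : Num.sqrt S * (a * v + b) = t * v + c.
  by rewrite /a /b; field; exact: lt0r_neq0.
by rewrite exprMn sqr_sqrtr ?ltW//; ring.
Qed.

Let one0 (v : R) : 0 < 1 + v ^+ 2. Proof. by rewrite ltr_wpDr ?sqr_ge0. Qed.

Let aV : a^-1 = t^-1 * S `^ 2^-1.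
Proof. by rewrite /a powR12_sqrt ?ltW// invfM invrK mulrC. Qed.

Lemma quad_gt0 v : 0 < S + (t * v + c) ^+ 2.
Proof. by rewrite ltr_wpDr ?sqr_ge0. Qed.

Lemma integral_quad_normc z : 2^-1 < complex.Re z ->
  (\int[leb]_v (Normc.normc (cpow (S + (t * v + c) ^+ 2) (- z)))%:E =
   (t^-1 * betar (complex.Re z) * S `^ (2^-1 - complex.Re z))%:E)%E.
Proof.
move=> z12; under eq_integral do rewrite normc_cpow ?quad_gt0// Re_oppc quadE.
under eq_integral do rewrite powRM ?ltW// EFinM.
have m1 : measurable_fun setT (fun v : R => (1 + v ^+ 2) `^ (- complex.Re z)).
  apply: (measurableT_comp (measurable_powR _)).
  by apply: measurable_funD => //; exact: measurable_funX.
rewrite ge0_integralZl//=; first last.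
- by rewrite lee_fin powR_ge0.
- by move=> v _; rewrite lee_fin powR_ge0.
- apply/measurable_EFinP; apply: (measurableT_comp m1).
  by apply: measurable_funD => //; exact: measurable_funM.
rewrite (ge0_integral_affine b a0 m1) ?beta_normc//; last by move=> v; rewrite powR_ge0.
rewrite -!EFinM aV powRD; last by apply/implyP => _; rewrite gt_eqF.
by congr EFin; rewrite /betar; ring.
Qed.

Lemma cintegral_quad z : 2^-1 < complex.Re z ->
  cintegrable leb setT (fun v => cpow (S + (t * v + c) ^+ 2) (- z)) /\
  cintegral leb setT (fun v => cpow (S + (t * v + c) ^+ 2) (- z)) =
  t^-1%:C * beta z * cpow S (2^-1%:C - z).
Proof.
move=> z12; have [i e] := cintegral_affine b a0 (beta_integrable z12).
have -> : (fun v => cpow (S + (t * v + c) ^+ 2) (- z)) =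
    fun v => cpow S (- z) * cpow (1 + (a * v + b) ^+ 2) (- z).
  by apply/funext => v; rewrite quadE cpowM.
split; first exact: cintegrableZl.
rewrite cintegralZl// e aV.
have G0 : Gamma z != 0 by apply: Gamma_neq0; apply: lt_trans z12; rewrite invr_gt0.
have := beta_Gamma z12; move: (cintegral _ _ _) => B BE.
have -> : beta z = B by rewrite /beta -BE mulrC mulKf.
by rewrite (cpowD S 2^-1%:C) cpow_real// rmorphM/=; ring.
Qed.

End LineIntegral.

(** Since [cons_pair] puts the last factor of the product in front, the inner
    integral is over the head of the tuple. *)
Section TupleFubini.
Variable R : realType.
Local Notation leb := (@lebesgue_measure R).

Lemma lebesgue_tupleS N : lebesgue_tuple R N.+1 =
  pushforward_measure (lebesgue_tuple R N \x leb)%E (@measurable_cons_pair R N).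
Proof. by []. Qed.

Lemma integral_tupleS N (f : N.+1.-tuple R -> R) : measurable_fun setT f ->
  (forall t, 0 <= f t) ->
  (\int[lebesgue_tuple R N.+1]_t (f t)%:E =
   \int[lebesgue_tuple R N]_t \int[leb]_x (f (cons_pair (t, x)))%:E)%E.
Proof.
move=> mf f0; have mE : measurable_fun setT (EFin \o f) by exact/measurable_EFinP.
rewrite lebesgue_tupleS ge0_integral_pushforward_measure//.
apply: (@fubini_tonelli1 _ _ _ _ _
   (sigma_finite_pack (@sigma_finite_lebesgue_tuple R N)) leb
   (fun p : N.-tuple R * measurableTypeR R => (f (cons_pair p))%:E)).
  exact: (measurableT_comp mE (@measurable_cons_pair R N)).
by move=> p; rewrite lee_fin.
Qed.

Lemma cintegral_tupleS N (f : N.+1.-tuple R -> R[i]) :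
  cintegrable (lebesgue_tuple R N.+1) setT f ->
  (forall t, cintegrable leb setT (fun x => f (cons_pair (t, x)))) ->
  cintegral (lebesgue_tuple R N.+1) setT f =
  cintegral (lebesgue_tuple R N) setT (fun t =>
    cintegral leb setT (fun x => f (cons_pair (t, x)))).
Proof.
move=> fi fi2; have mf := cintegrable_measurable fi.
have mc := cmeasurable_comp (@measurable_cons_pair R N) mf.
pose m1 := sigma_finite_pack (@sigma_finite_lebesgue_tuple R N).
have fi3 : cintegrable (m1 \x leb)%E setT (f \o @cons_pair R N).
  refine (@cintegrable_le _ _ _ (m1 \x leb)%E _ _ mc (fun x => lexx _) _).
  apply/integrableP; split; first by apply/measurable_EFinP; exact: measurable_normc.
  have /integrableP[_] := cintegrable_normc fi.
  rewrite lebesgue_tupleS (ge0_integral_pushforward_measure _ _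
    (f := fun t => `|Normc.normc (f t)|))//.
  by apply: measurableT_comp => //; exact: measurable_normc.
have [_ e] := @cintegral_pushforward _ _ _ _ _ (lebesgue_tuple R N \x leb)%E _
  (@measurable_cons_pair R N) _ mf fi3.
by rewrite lebesgue_tupleS [LHS]e; exact: (cfubini1 fi3).
Qed.

End TupleFubini.

Section FlatFibre.
Variable R : realType.
Local Notation leb := (@lebesgue_measure R).
Local Notation RT := (measurableTypeR R).
(** Lists are read backwards: coordinate j is the head of a list with tail of
    length j.  Thus [qsum] of a list is
    1 + sum_j (tau_j x_j + gam_j (x_(j-1), ..., x_0))^2, and [qprod] multiplies the
    powers with exponent - nu_j of its partial sums up to index j. *)
Variables (tau : nat -> R) (gam : nat -> seq R -> R) (nu : nat -> R[i]).
Hypothesis tau0 : forall j, 0 < tau j.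

Fixpoint qsum (u : seq R) : R :=
  if u is x :: t then qsum t + (tau (size t) * x + gam (size t) t) ^+ 2 else 1.

Fixpoint qprod (u : seq R) : R[i] :=
  if u is x :: t then qprod t * cpow (qsum u) (- nu (size t)) else 1.

Lemma qsum_gt0 u : 0 < qsum u.
Proof. by elim: u => [|x t IH] //=; rewrite ltr_wpDr ?sqr_ge0. Qed.

Hypothesis mgam : forall j, measurable_fun setT (fun t : j.-tuple R => gam j t).

Lemma measurable_qsum N : measurable_fun setT (fun t : N.-tuple R => qsum t).
Proof.
elim: N => [|N IH].
  rewrite (_ : (fun _ => _) = fun=> 1); first exact: measurable_cst.
  by apply/funext => t; rewrite (tuple0 t).
rewrite (_ : (fun _ => _) = fun t : N.+1.-tuple R => qsum [tuple of behead t] +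
    (tau N * tnth t ord0 + gam N [tuple of behead t]) ^+ 2); last first.
  by apply/funext => t; case/tupleP: t => x t /=; rewrite tnth0 size_tuple.
have mb := @measurable_behead _ RT N.
apply: measurable_funD; first exact: (measurableT_comp IH mb).
apply: measurable_funX; apply: measurable_funD.
  by apply: measurable_funM => //; exact: measurable_tnth.
exact: (measurableT_comp (@mgam N) mb).
Qed.

Lemma cmeasurable_qprod N : cmeasurable (fun t : N.-tuple R => qprod t).
Proof.
elim: N => [|N IH].
  rewrite (_ : (fun _ => _) = fun=> 1); first exact: cmeasurable_cst.
  by apply/funext => t; rewrite (tuple0 t).
rewrite (_ : (fun _ => _) = fun t : N.+1.-tuple R => qprod [tuple of behead t] *
    cpow (qsum t) (- nu N)); last first.
  by apply/funext => t; case/tupleP: t => x t /=; rewrite size_tuple.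
have mb := @measurable_behead _ RT N.
apply: cmeasurableM; first exact: (cmeasurable_comp mb IH).
by apply: cmeasurable_cpow; exact: measurable_qsum.
Qed.

(* Integrating out one coordinate leaves an extra power of the full sum, so the
   induction is on integrands that carry one. *)
Let integrand (mu : R[i]) (u : seq R) : R[i] := qprod u * cpow (qsum u) (- mu).

Let cmeasurable_integrand mu N : cmeasurable (fun t : N.-tuple R => integrand mu t).
Proof.
apply: cmeasurableM; first exact: cmeasurable_qprod.
by apply: cmeasurable_cpow; exact: measurable_qsum.
Qed.

Let integrand_cons mu N x (t : N.-tuple R) : integrand mu (x :: t) =
  qprod t * cpow (qsum t + (tau N * x + gam N t) ^+ 2) (- (nu N + mu)).
Proof. by rewrite /integrand /= size_tuple -mulrA -cpowD -opprD. Qed.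

(** Exponent of the full sum when coordinate j is integrated out: mu and the
    nu_i with j <= i < N have been collected, and each of the N - j - 1 previous
    integrations has lowered the total by 1/2. *)
Definition qexp N (mu : R[i]) (j : nat) : R[i] :=
  \sum_(j <= i < N) nu i - ((N - j).-1%:R / 2)%:C + mu.

Lemma qexpS N mu j : (j < N)%N ->
  qexp N.+1 mu j = qexp N (nu N + mu - 2^-1%:C) j.
Proof.
move=> jN; rewrite /qexp big_nat_recr ?(ltnW jN)//=.
have -> : ((N.+1 - j).-1%:R / 2 : R)%:C = ((N - j).-1%:R / 2)%:C + 2^-1%:C.
  rewrite subSn ?(ltnW jN)//= -[(N - j)%N in LHS]prednK ?subn_gt0// -natr1.
  by rewrite -rmorphD/=; congr (_%:C); field.
by ring.
Qed.

Lemma qexp_last N mu : qexp N.+1 mu N = nu N + mu.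
Proof. by rewrite /qexp big_nat1 subSnn /= mul0r subr0. Qed.

Lemma qprod_normc N (mu : R[i]) :
  (forall j, (j < N)%N -> 2^-1 < complex.Re (qexp N mu j)) ->
  (\int[lebesgue_tuple R N]_t (Normc.normc (integrand mu t))%:E =
   (\prod_(j < N) ((tau j)^-1 * betar (complex.Re (qexp N mu j))))%:E)%E.
Proof.
elim: N mu => [|N IH] mu h.
  rewrite big_ord0 /= integral_dirac//=; last first.
    apply/measurable_EFinP/measurable_normc; exact: cmeasurable_integrand.
  by rewrite diracT mul1e /integrand mul1r /= cpow1 Normc.normc1.
rewrite integral_tupleS; last 2 first.
- by apply: measurable_normc; exact: cmeasurable_integrand.
- by move=> t; exact: normc_ge0.
have hN := h N (ltnSn N); rewrite qexp_last in hN.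
have inner (t : N.-tuple R) :
    (\int[leb]_x (Normc.normc (integrand mu (cons_pair (t, x))))%:E =
     ((tau N)^-1 * betar (complex.Re (nu N + mu)) *
      Normc.normc (integrand (nu N + mu - 2^-1%:C) t))%:E)%E.
  transitivity (\int[leb]_x ((Normc.normc (qprod t))%:E *
    (Normc.normc (cpow (qsum t + (tau N * x + gam N t) ^+ 2) (- (nu N + mu))))%:E))%E.
    by apply: eq_integral => x _; rewrite integrand_cons Normc.normcM EFinM.
  rewrite ge0_integralZl//=; first last.
  - by rewrite lee_fin normc_ge0.
  - by move=> v _; rewrite lee_fin normc_ge0.
  - apply/measurable_EFinP/measurable_normc/cmeasurable_cpow.
    apply: measurable_funD => //; apply: measurable_funX.
    by apply: measurable_funD => //; exact: measurable_funM.
  rewrite integral_quad_normc ?qsum_gt0// -EFinM; congr EFin.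
  rewrite /integrand Normc.normcM normc_cpow ?qsum_gt0//.
  have -> : complex.Re (- (nu N + mu - 2^-1%:C)) = 2^-1 - complex.Re (nu N + mu).
    by rewrite !(Re_oppc, Re_addc) /=; ring.
  by ring.
under eq_integral do rewrite inner EFinM.
rewrite /= ge0_integralZl//=; first last.
- by rewrite lee_fin mulr_ge0 ?invr_ge0 ?(ltW (tau0 N))// betar_ge0.
- by move=> t _; rewrite lee_fin normc_ge0.
- by apply/measurable_EFinP/measurable_normc; exact: cmeasurable_integrand.
rewrite IH; last by move=> j jN; rewrite -qexpS// h// ltnS ltnW.
have E : \prod_(j < N) ((tau j)^-1 * betar (complex.Re (qexp N.+1 mu j))) =
    \prod_(j < N) ((tau j)^-1 *
      betar (complex.Re (qexp N (nu N + mu - 2^-1%:C) j))).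
  by apply: eq_bigr => j _; rewrite (qexpS mu (ltn_ord j)).
by rewrite -EFinM big_ord_recr /= E qexp_last [in RHS]mulrC.
Qed.

Let integrand_integrable N (mu : R[i]) :
  (forall j, (j < N)%N -> 2^-1 < complex.Re (qexp N mu j)) ->
  cintegrable (lebesgue_tuple R N) setT (fun t => integrand mu t).
Proof.
move=> h; apply: (cintegrable_le (cmeasurable_integrand mu N) (fun=> lexx _)).
apply: (ge0_integrable _ _ (qprod_normc h)); last by move=> t; exact: normc_ge0.
by apply: measurable_normc; exact: cmeasurable_integrand.
Qed.

Lemma qprod_integral_mu N (mu : R[i]) :
  (forall j, (j < N)%N -> 2^-1 < complex.Re (qexp N mu j)) ->
  cintegral (lebesgue_tuple R N) setT (fun t => integrand mu t) =
  \prod_(j < N) ((tau j)^-1%:C * beta (qexp N mu j)).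
Proof.
elim: N mu => [|N IH] mu h.
  rewrite big_ord0 /cintegral /Rintegral.
  have e : integrand mu ([tuple] : 0.-tuple R) = 1 by rewrite /integrand mul1r cpow1.
  rewrite !integral_dirac//; last 2 first.
  - by apply/measurable_EFinP; case: (cmeasurable_integrand mu 0).
  - by apply/measurable_EFinP; case: (cmeasurable_integrand mu 0).
  by rewrite diracT !mul1e e.
have hN := h N (ltnSn N); rewrite qexp_last in hN.
have h' j : (j < N)%N -> 2^-1 < complex.Re (qexp N (nu N + mu - 2^-1%:C) j).
  by move=> jN; rewrite -qexpS// h// ltnS ltnW.
have inner (t : N.-tuple R) :
    (fun x => integrand mu (cons_pair (t, x))) = fun x =>
      qprod t * cpow (qsum t + (tau N * x + gam N t) ^+ 2) (- (nu N + mu)).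
  by apply/funext => x; rewrite integrand_cons.
rewrite cintegral_tupleS; first last.
- move=> t; rewrite inner; apply: cintegrableZl.
  by case: (cintegral_quad (gam N t) (qsum_gt0 t) (tau0 N) hN).
- exact: integrand_integrable.
rewrite big_ord_recr/= qexp_last mulrC.
rewrite (eq_bigr (fun j : 'I_N =>
   (tau j)^-1%:C * beta (qexp N (nu N + mu - 2^-1%:C) j))); last first.
  by move=> j _; rewrite qexpS.
rewrite -IH// -cintegralZl; last exact: integrand_integrable.
apply: eq_cintegral => t; rewrite inner cintegralZl; last first.
  by case: (cintegral_quad (gam N t) (qsum_gt0 t) (tau0 N) hN).
rewrite (cintegral_quad (gam N t) (qsum_gt0 t) (tau0 N) hN).2 /integrand.
rewrite (_ : - (nu N + mu - 2^-1%:C) = 2^-1%:C - (nu N + mu)); last by ring.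
by rewrite mulrCA.
Qed.

Lemma qprod_integral N :
  (forall j, (j < N)%N -> 2^-1 < complex.Re (qexp N 0 j)) ->
  [/\ cintegrable (lebesgue_tuple R N) setT (fun t => qprod t),
   cintegral (lebesgue_tuple R N) setT (fun t => qprod t) =
   \prod_(j < N) ((tau j)^-1%:C * beta (qexp N 0 j)) &
   (\int[lebesgue_tuple R N]_t (Normc.normc (qprod t))%:E =
    (\prod_(j < N) ((tau j)^-1 * betar (complex.Re (qexp N 0 j))))%:E)%E].
Proof.
move=> h.
have E : (fun t : N.-tuple R => integrand 0 t) = fun t => qprod t.
  by apply/funext => t; rewrite /integrand oppr0 cpow0 mulr1.
split; first by rewrite -E; exact: integrand_integrable.
  by rewrite -E; exact: qprod_integral_mu.
rewrite -(qprod_normc h); apply: eq_integral => t _.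
by rewrite -[qprod t]/((fun t : N.-tuple R => qprod t) t) -E.
Qed.

End FlatFibre.

(** * Scalars and orthonormalization *)
Section ScalarTheory.
Variables (R : realType) (K : division_algebra).
Local Notation S := (Defs.scalar R K).

Definition ofR : R -> S :=
  match K return R -> Defs.scalar R K with
  | Defs.realK => fun r => r
  | complexK => fun r => r%:C
  | quaternionK => fun r => Quat r 0 0 0
  end.

(** Equal to 0 when c is not smaller than kappa K. *)
Definition rcoord (c : nat) (x : S) : R := (to_reals x)`_c.

Definition nsq (x : S) : R := \sum_(c < kappa K) rcoord c x ^+ 2.
End ScalarTheory.
Arguments ofR {R} K.
Arguments rcoord {R K}.
Arguments nsq {R K}.

Section ScalarLemmas.
Variables (R : realType) (K : division_algebra).
Local Notation S := (Defs.scalar R K).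
Implicit Types (x y : S) (r s : R).

Lemma rcoord_ext x y : (forall c, (c < kappa K)%N -> rcoord c x = rcoord c y) -> x = y.
Proof.
move=> h; apply: (can_inj (@to_realsK R K)).
apply: (@eq_from_nth _ 0) => [|c]; rewrite ?size_to_reals// => cK; exact: h.
Qed.

Lemma rcoordD c x y : rcoord c (x + y) = rcoord c x + rcoord c y.
Proof.
rewrite /rcoord; case: K x y => [x y|[? ?] [? ?]|[????] [????]] /=;
  case: c => [|[|[|[|[|c]]]]] //=; rewrite ?nth_nil ?addr0//.
Qed.
Lemma rcoord0 c : rcoord c (0 : S) = 0.
Proof. by apply: (@addrI _ (rcoord c (0 : S))); rewrite -rcoordD !addr0. Qed.
Lemma rcoord_sum c I (u : seq I) (P : pred I) (f : I -> S) :
  rcoord c (\sum_(i <- u | P i) f i) = \sum_(i <- u | P i) rcoord c (f i).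
Proof. exact: (big_morph _ (rcoordD c) (rcoord0 c)). Qed.

Lemma rcoordZ c r x : rcoord c (ofR K r * x) = r * rcoord c x.
Proof.
rewrite /rcoord /ofR; case: K x => [x|[? ?]|[????]] /=;
  case: c => [|[|[|[|[|c]]]]] //=; rewrite ?nth_nil ?(mul0r, addr0, subr0, mulr0)//.
Qed.

Lemma ofR_comm r x : ofR K r * x = x * ofR K r.
Proof.
rewrite /ofR; case: K x => [x|[? ?]|[????]] /=; first exact: mulrC.
  by rewrite mulrC.
by congr Quat => /=; ring.
Qed.
Lemma ofRD r s : ofR K (r + s) = ofR K r + ofR K s.
Proof.
by rewrite /ofR; case: K => //=; [exact: rmorphD|congr Quat; rewrite /= ?addr0].
Qed.
Lemma ofRM r s : ofR K (r * s) = ofR K r * ofR K s.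
Proof.
by rewrite /ofR; case: K => //=; [exact: rmorphM|congr Quat => /=; ring].
Qed.
Lemma ofR1 : ofR K (1 : R) = 1. Proof. by rewrite /ofR; case: K. Qed.
Lemma ofR0 : ofR K (0 : R) = 0. Proof. by rewrite /ofR; case: K. Qed.
Lemma ofR_sum I (u : seq I) (P : pred I) (f : I -> R) :
  ofR K (\sum_(i <- u | P i) f i) = \sum_(i <- u | P i) ofR K (f i).
Proof. exact: (big_morph _ ofRD ofR0). Qed.

Lemma sconjD x y : sconj (x + y) = sconj x + sconj y.
Proof.
case: K x y => [x y|[? ?] [? ?]|[????] [????]] //=.
  by rewrite /conjc/= opprD.
by congr Quat => /=; rewrite ?opprD.
Qed.
Lemma sconj0 : sconj (0 : S) = 0.
Proof. by apply: (@addrI _ (sconj (0 : S))); rewrite -sconjD !addr0. Qed.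
Lemma sconj_sum I (u : seq I) (P : pred I) (f : I -> S) :
  sconj (\sum_(i <- u | P i) f i) = \sum_(i <- u | P i) sconj (f i).
Proof. exact: (big_morph _ sconjD sconj0). Qed.
Lemma sconjM x y : sconj (x * y) = sconj y * sconj x.
Proof.
case: K x y => [x y|x y|[????] [????]] /=; first exact: mulrC.
  by rewrite mulrC rmorphM.
by congr Quat => /=; ring.
Qed.
Lemma sconjK x : sconj (sconj x) = x.
Proof.
case: K x => [x|x|[????]] //=; first exact: conjcK.
by rewrite /quat_conj /= !opprK.
Qed.
Lemma sconj_ofR r : sconj (ofR K r) = ofR K r.
Proof.
rewrite /ofR; case: K => //=; first exact: conjc_real.
by rewrite /quat_conj /= oppr0.
Qed.
Lemma mul_sconj x : x * sconj x = ofR K (nsq x).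
Proof.
rewrite /nsq /ofR /rcoord; case: K x => [x|[a b]|[a b c d]] /=.
- by rewrite big_ord1 expr2.
- rewrite !big_ord_recl big_ord0 /=; apply: complex_ext => /=; ring.
- by rewrite !big_ord_recl big_ord0 /=; congr Quat => /=; ring.
Qed.
Lemma sconj_mul x : sconj x * x = ofR K (nsq x).
Proof.
rewrite /nsq /ofR /rcoord; case: K x => [x|[a b]|[a b c d]] /=.
- by rewrite big_ord1 expr2.
- rewrite !big_ord_recl big_ord0 /=; apply: complex_ext => /=; ring.
- by rewrite !big_ord_recl big_ord0 /=; congr Quat => /=; ring.
Qed.

Lemma nsq_ge0 x : 0 <= nsq x.
Proof. by apply: sumr_ge0 => c _; exact: sqr_ge0. Qed.
Lemma nsq_eq0 x : nsq x = 0 -> x = 0.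
Proof.
move=> h; apply: rcoord_ext => c cK; rewrite rcoord0; apply/eqP; rewrite -sqrf_eq0.
have /(_ (Ordinal cK) isT)/eqP := psumr_eq0P (fun (c : 'I_(kappa K)) _ => sqr_ge0 (rcoord c x)) h.
exact.
Qed.
Lemma nsq0 : nsq (0 : S) = 0.
Proof. by rewrite /nsq big1// => c _; rewrite rcoord0 expr0n. Qed.

Lemma ctrmxM m n p (A : 'M[S]_(m, n)) (B : 'M[S]_(n, p)) :
  ctrmx (A *m B) = ctrmx B *m ctrmx A.
Proof.
apply/matrixP => i j; rewrite !mxE sconj_sum; apply: eq_bigr => k _.
by rewrite !mxE sconjM.
Qed.
Lemma ctrmxK m n (A : 'M[S]_(m, n)) : ctrmx (ctrmx A) = A.
Proof. by apply/matrixP => i j; rewrite !mxE sconjK. Qed.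
Lemma ctrmx0 m n : ctrmx (0 : 'M[S]_(m, n)) = 0.
Proof. by apply/matrixP => i j; rewrite !mxE sconj0. Qed.
Lemma ctrmx_scalar n r : ctrmx ((ofR K r)%:M : 'M[S]_n) = (ofR K r)%:M.
Proof.
apply/matrixP => i j; rewrite !mxE eq_sym.
by case: eqP; rewrite ?mulr1n ?mulr0n ?sconj_ofR ?sconj0.
Qed.

(** Scalars multiply rows on the left, so Gram-Schmidt orthonormalization does not
    involve commutativity.  By induction on the number of rows: project the other
    rows to the orthogonal complement of the first row a. *)
Lemma gram_schmidt N m (A : 'M[S]_(N, m)) :
  (forall x : 'rV_N, x *m A = 0 -> x = 0) ->
  exists (T : 'M[S]_N) (tau : 'I_N -> R),
    [/\ forall i j : 'I_N, (i < j)%N -> T i j = 0,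
        forall i, 0 < tau i, forall i, T i i = ofR K (tau i) &
        (T *m A) *m ctrmx (T *m A) = 1%:M].
Proof.
elim: N A => [|N IH] A Ainj.
  by exists 1%:M, (fun=> 1); split => [[]//|[]//|[]//|]; apply/matrixP => -[].
move: A Ainj; rewrite -[N.+1]/(1 + N)%N => A Ainj.
have [a [A1 AE]] : exists (a : 'rV[S]_m) (A1 : 'M[S]_(N, m)), A = col_mx a A1.
  by exists (usubmx A), (dsubmx A); rewrite vsubmxK.
pose r := \sum_j nsq (a 0 j).
have aa : a *m ctrmx a = (ofR K r)%:M.
  apply/matrixP => i j; rewrite !ord1 !mxE eqxx mulr1n /r ofR_sum.
  by apply: eq_bigr => k _; rewrite mxE mul_sconj.
have r0 : 0 < r.
  rewrite lt_def sumr_ge0 ?andbT => [|j _]; last exact: nsq_ge0.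
  apply/eqP => re; have a0 : a = 0.
    apply/matrixP => i j; rewrite ord1 mxE; apply: nsq_eq0.
    exact: (psumr_eq0P (fun j _ => nsq_ge0 (a 0 j)) re).
  have := Ainj (row_mx 1%:M 0); rewrite AE mul_row_col mul1mx mul0mx addr0 => /(_ a0).
  rewrite -row_mx0 => /eq_row_mx[/matrixP/(_ 0 0)/eqP].
  by rewrite !mxE eqxx oner_eq0.
pose d : 'M[S]_1 := (ofR K r^-1)%:M.
have daa : d *m (a *m ctrmx a) = 1%:M.
  by rewrite aa -scalar_mxM -ofRM mulVf ?gt_eqF// ofR1.
pose q := A1 *m ctrmx a.
pose B := A1 - q *m d *m a.
have Ba : B *m ctrmx a = 0.
  by rewrite mulmxBl -!mulmxA daa mulmx1 subrr.
have [x|T1 [tau1 [T1l tau10 T1d T1B]]] := IH B.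
  rewrite mulmxBr => /eqP; rewrite subr_eq0 => /eqP xB.
  have := Ainj (row_mx (- (x *m (q *m d))) x).
  rewrite AE mul_row_col mulNmx xB !mulmxA addNr => /(_ erefl).
  by rewrite -row_mx0 => /eq_row_mx[].
pose s := (Num.sqrt r)^-1.
have s0 : 0 < s by rewrite invr_gt0 sqrtr_gt0.
pose sM : 'M[S]_1 := (ofR K s)%:M.
exists (block_mx sM 0 (- (T1 *m (q *m d))) T1).
exists (fun i => match @fintype.split 1 N i with inl _ => s | inr k => tau1 k end).
have TA : block_mx sM 0 (- (T1 *m (q *m d))) T1 *m A = col_mx (sM *m a) (T1 *m B).
  rewrite AE mul_block_col mul0mx addr0 mulNmx mulmxBr addrC.
  by rewrite -!mulmxA.
have YX : T1 *m B *m ctrmx (sM *m a) = 0.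
  by rewrite ctrmxM mulmxA -[T1 *m B *m _]mulmxA Ba mulmx0 mul0mx.
split.
- move=> i j; case: (split_ordP i) => k ->; case: (split_ordP j) => l -> /=.
  + by rewrite !ord1.
  + by rewrite block_mxEur mxE.
  + by rewrite ord1 ltn0.
  + by rewrite block_mxEdr ltn_add2l; exact: T1l.
- by move=> i; case: (fintype.split i).
- move=> i; case: (split_ordP i) => k ->.
  + by rewrite block_mxEul !ord1 mxE eqxx mulr1n.
  + by rewrite block_mxEdr T1d.
- rewrite TA.
  have -> : ctrmx (col_mx (sM *m a) (T1 *m B)) =
      row_mx (ctrmx (sM *m a)) (ctrmx (T1 *m B)).
    apply/matrixP => i j; rewrite !mxE.
    by case: splitP => k _; rewrite !mxE.
  rewrite mul_col_row YX T1B -[sM *m a *m ctrmx (T1 *m B)]ctrmxK.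
  rewrite [ctrmx (sM *m a *m _)]ctrmxM ctrmxK YX ctrmx0.
  rewrite ctrmxM ctrmx_scalar -mulmxA [a *m _]mulmxA aa -!scalar_mxM -!ofRM.
  rewrite (_ : s * (r * s) = 1) ?ofR1 -?scalar_mx_block//.
  by rewrite /s -{2}[r]sqr_sqrtr ?ltW//; field; rewrite gt_eqF// sqrtr_gt0.
Qed.

End ScalarLemmas.

(** * Gram determinants of triangular perturbations *)
Section Determinants.
Variable F : comNzRingType.

(** A rank f for the indices covers lower and upper triangular matrices, as well as
    the block triangular matrices with diagonal blocks that arise as real operators.
    A permutation preserves the sum of f; if it is not the identity, it therefore
    moves some index to one of at most the same rank, and its term vanishes. *)
Lemma det_tri p (A : 'M[F]_p) (f : 'I_p -> nat) :
  (forall i j, i != j -> (f j <= f i)%N -> A i j = 0) -> \det A = \prod_i A i i.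
Proof.
move=> Af; rewrite /determinant (bigD1 (1%g : {perm 'I_p}))//= odd_perm1 expr0 mul1r.
rewrite [X in _ + X]big1 ?addr0; first by apply: eq_bigr => i _; rewrite perm1.
move=> s s1; suff [i Ai] : exists i, A i (s i) = 0.
  by rewrite (bigD1 i)//= Ai mul0r mulr0.
have [i Ai|h] := pickP (fun i => A i (s i) == 0); first by exists i; exact/eqP.
have lef i : (f i <= f (s i))%N.
  have [<-//|si] := eqVneq i (s i); rewrite leqNgt; apply/negP => /ltnW fi.
  by have := h i; rewrite (Af _ _ si fi) eqxx.
have sumf : (\sum_i f i = \sum_i f (s i))%N by rewrite (reindex_inj (@perm_inj _ s)).
case/eqP: s1; apply/permP => i; rewrite perm1; apply/eqP/negPn/negP => si.
have : (f (s i) <= f i)%N.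
  move: sumf; rewrite (bigD1 i)//= [X in _ = X -> _](bigD1 i)//= => e.
  by rewrite -(leq_add2r (\sum_(j | j != i) f j)) e leq_add2l leq_sum.
by move=> fi; have := h i; rewrite (Af i (s i)) ?eqxx// eq_sym.
Qed.

(** Sylvester's identity, from the two block factorizations of
    the matrix with blocks 1, U, -V, 1. *)
Lemma det_1addmx p q (U : 'M[F]_(p, q)) (V : 'M[F]_(q, p)) :
  \det (1%:M + U *m V) = \det (1%:M + V *m U).
Proof.
have e1 : block_mx 1%:M U 0 1%:M *m block_mx (1%:M + U *m V) 0 (- V) 1%:M =
    block_mx 1%:M U (- V) 1%:M.
  rewrite mulmx_block !(mul1mx, mul0mx, mulmx0, mulmx1) mulmxN.
  by rewrite addrK !add0r ?addr0.
have e2 : block_mx 1%:M 0 (- V) 1%:M *m block_mx 1%:M U 0 (1%:M + V *m U) =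
    block_mx 1%:M U (- V) 1%:M.
  rewrite mulmx_block !(mul1mx, mul0mx, mulmx0, mulmx1) mulNmx.
  by rewrite addrCA addNr !addr0.
have := congr1 determinant e1; rewrite -e2 !det_mulmx !det_ublock !det_lblock.
by rewrite !det1 ?(mul1r, mulr1).
Qed.

End Determinants.

Section RealOperator.
Variable R : realType.
Local Notation H := (quat R).

Let vecH n (v : 'M[R]_(n, 4)) : 'cV[H]_n :=
  \col_k (of_reals quaternionK [seq v k d | d : 'I_4] : H).
Let coordsH n (x : 'cV[H]_n) : 'M[R]_(n, 4) :=
  \matrix_(i, c) (@to_reals R quaternionK (x i 0))`_c.

Let action m n (A : 'M[H]_(m, n)) (v : 'M[R]_(n, 4)) : 'M[R]_(m, 4) :=
  coordsH (A *m vecH v).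

Let vecH_rcoord n (v : 'M[R]_(n, 4)) k (d : 'I_4) :
  @rcoord R quaternionK d (vecH v k 0) = v k d.
Proof.
rewrite /rcoord mxE of_realsK; last by rewrite size_image card_ord.
by rewrite (nth_map d) ?size_enum_ord// nth_ord_enum.
Qed.

Let vecHK n (x : 'cV[H]_n) : vecH (coordsH x) = x.
Proof.
apply/matrixP => k j; rewrite ord1; apply: (@rcoord_ext R quaternionK) => c c4.
by rewrite (vecH_rcoord _ _ (Ordinal c4)) mxE.
Qed.

Let coordsHE n (x : 'cV[H]_n) i c : coordsH x i c = @rcoord R quaternionK c (x i 0).
Proof. by rewrite mxE. Qed.

Let action_is_linear m n (A : 'M[H]_(m, n)) : linear (action A).
Proof.
move=> a u v; apply/matrixP => i c; rewrite [RHS]mxE [X in _ = X + _]mxE !coordsHE.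
rewrite -(@rcoordZ R quaternionK) -(@rcoordD R quaternionK); congr (rcoord c _).
rewrite !mxE mulr_sumr -big_split/=; apply: eq_bigr => k _.
have -> : vecH (a *: u + v) k 0 =
    (@ofR R quaternionK a : H) * vecH u k 0 + vecH v k 0 :> H.
  apply: (@rcoord_ext R quaternionK) => d d4.
  rewrite rcoordD rcoordZ -[d]/(nat_of_ord (Ordinal d4)) !vecH_rcoord.
  by rewrite !mxE.
by rewrite mulrDr !mulrA -(@ofR_comm R quaternionK).
Qed.
HB.instance Definition _ m n (A : 'M[H]_(m, n)) :=
  GRing.isLinear.Build R _ _ _ (action A) (action_is_linear A).

(** Rectangular matrices are needed to pass 1 + u u^* and 1 + u^* u, for a column u,
    through Sylvester's identity: over the quaternions it is only available for the
    real images. *)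
Definition real_op m n (A : 'M[H]_(m, n)) : 'M[R]_(n * 4, m * 4) :=
  lin_mx (action A).

Lemma real_operatorE m (A : 'M[H]_m) : real_operator A = real_op A.
Proof. by []. Qed.

Lemma mx_ext p q (A B : 'M[R]_(p, q)) :
  (forall w : 'rV_p, w *m A = w *m B) -> A = B.
Proof. by move=> AB; apply/row_matrixP => i; rewrite !rowE. Qed.

Lemma real_opM m n p (A : 'M[H]_(m, n)) (B : 'M[H]_(n, p)) :
  real_op (A *m B) = real_op B *m real_op A.
Proof.
apply: mx_ext => w; rewrite -[w]vec_mxK mulmxA !mul_vec_lin.
by congr mxvec; rewrite /= /action vecHK mulmxA.
Qed.

Lemma real_opD m n (A B : 'M[H]_(m, n)) : real_op (A + B) = real_op A + real_op B.
Proof.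
apply: mx_ext => w; rewrite -[w]vec_mxK mulmxDr !mul_vec_lin -linearD.
congr mxvec; apply/matrixP => i c; rewrite /= /action mulmxDl !mxE.
exact: (@rcoordD R quaternionK).
Qed.

Lemma real_op_entry m n (A : 'M[H]_(m, n)) k d i c :
  real_op A (mxvec_index k d) (mxvec_index i c) =
  @rcoord R quaternionK c (A i k * of_reals quaternionK [seq (d == e)%:R | e : 'I_4]).
Proof.
rewrite /real_op /lin_mx mxE /= vec_mx_delta mxvecE /action !mxE.
rewrite -/(rcoord c _) (bigD1 k)//= big1 ?addr0 => [|l lk].
  congr (rcoord c (_ * _)); rewrite mxE; congr of_reals.
  by apply: eq_map => e; rewrite mxE eqxx /= eq_sym.
rewrite (_ : vecH _ l 0 = 0) ?mulr0//; apply: (@rcoord_ext R quaternionK) => e e4.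
by rewrite (vecH_rcoord _ _ (Ordinal e4)) mxE (negbTE lk) rcoord0.
Qed.

Lemma of_reals_delta (d : 'I_4) :
  of_reals quaternionK [seq (d == e)%:R | e : 'I_4] =
  Quat (d == 0%N :> nat)%:R (d == 1%N :> nat)%:R (d == 2%N :> nat)%:R (d == 3%N :> nat)%:R :> H.
Proof.
apply: (@rcoord_ext R quaternionK) => c c4.
rewrite /rcoord of_realsK; last by rewrite size_image card_ord.
rewrite (nth_map d) ?size_enum_ord// (nth_ord_enum _ (Ordinal c4)) -val_eqE /=.
by move: c c4 => [|[|[|[|]]]].
Qed.

(** The coefficients of the real image of x are the Re (conj e_c x e_d), and Re is
    invariant under conjugation. *)
Lemma real_op_ctrmx m n (A : 'M[H]_(m, n)) :
  real_op (@ctrmx R quaternionK _ _ A) = (real_op A)^T.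
Proof.
apply/matrixP => a b; case/mxvec_indexP: a => i c; case/mxvec_indexP: b => k d.
rewrite [RHS]mxE !real_op_entry !of_reals_delta mxE.
case: (A i k) => x y z t; move: c d => [c c4] [d d4] /=; rewrite /rcoord /=.
by move: c c4 => [|[|[|[|]]]]// _; move: d d4 => [|[|[|[|]]]]// _ /=; ring.
Qed.

Lemma real_op_scalar n (r : R) : real_op ((@ofR R quaternionK r)%:M : 'M[H]_n) = r%:M.
Proof.
apply/matrixP => a b; case/mxvec_indexP: a => k d; case/mxvec_indexP: b => i c.
rewrite real_op_entry of_reals_delta !mxE.
rewrite (inj_eq (@cast_ord_inj _ _ _)) (inj_eq enum_rank_inj) xpair_eqE [k == i]eq_sym.
case: (i == k); last by rewrite !mulr0n mul0r rcoord0.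
rewrite mulr1n rcoordZ /=; move: c d => [c c4] [d d4] /=; rewrite /rcoord -val_eqE /=.
by move: c c4 => [|[|[|[|]]]]// _; move: d d4 => [|[|[|[|]]]]// _ /=; rewrite ?mulr1 ?mulr0.
Qed.

(** Each diagonal entry is real, hence contributes a scalar 4 x 4 block. *)
Lemma det_real_op_tri p (T : 'M[H]_p) (f : 'I_p -> nat) (tau : 'I_p -> R) :
  (forall i j, i != j -> (f j <= f i)%N -> T i j = 0) ->
  (forall i, T i i = @ofR R quaternionK (tau i)) ->
  \det (real_op T) = (\prod_i tau i) ^+ 4.
Proof.
move=> Tf Td; pose g l := f (enum_val (cast_ord (esym (mxvec_cast p 4)) l)).1.
have gE i c : g (mxvec_index i c) = f i.
  by rewrite /g /mxvec_index cast_ordK enum_rankK.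
have diag k d c : real_op T (mxvec_index k d) (mxvec_index k c) =
    tau k * (d == c)%:R.
  rewrite real_op_entry Td rcoordZ of_reals_delta; congr (_ * _).
  move: c d => [c c4] [d d4]; rewrite /rcoord -val_eqE /=.
  by move: c c4 => [|[|[|[|]]]]// _; move: d d4 => [|[|[|[|]]]].
rewrite -det_tr (@det_tri _ _ _ g).
  rewrite (reindex _ (curry_mxvec_bij p 4))/=.
  rewrite (eq_bigr (fun ic => (fun i c =>
    (real_op T)^T (mxvec_index i c) (mxvec_index i c)) ic.1 ic.2)); last by case.
  rewrite -(pair_bigA _ (fun i c =>
    (real_op T)^T (mxvec_index i c) (mxvec_index i c)))/=.
  rewrite -prodrXl; apply: eq_bigr => i _.
  under eq_bigr do rewrite mxE diag eqxx mulr1.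
  by rewrite prodr_const card_ord.
move=> a b; case/mxvec_indexP: a => i c; case/mxvec_indexP: b => k d.
rewrite !gE mxE => ab fki; have [ik|ik] := eqVneq i k.
  rewrite -ik in ab *; rewrite diag; case: (eqVneq d c) => [dc|]; last by rewrite mulr0.
  by rewrite dc eqxx in ab.
by rewrite real_op_entry Tf// mul0r rcoord0.
Qed.

End RealOperator.

Section RDet.
Variables (R : realType) (K : division_algebra).
Local Notation S := (Defs.scalar R K).

Lemma ctrmx_mul_col p (u : 'cV[S]_p) :
  ctrmx u *m u = (ofR K (\sum_i nsq (u i 0)))%:M.
Proof.
apply/matrixP => i j; rewrite !ord1 !mxE eqxx mulr1n ofR_sum.
by apply: eq_bigr => k _; rewrite mxE sconj_mul.
Qed.

End RDet.

Lemma scalar_mx_add (F : nzRingType) n (a b : F) :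
  a%:M + b%:M = (a + b)%:M :> 'M[F]_n.
Proof. by rewrite raddfD. Qed.

Lemma powR_root4 (R : realType) (x : R) : 0 <= x -> (x ^+ 4) `^ 4^-1 = x.
Proof.
by move=> x0; rewrite -powR_mulrn// -powRrM mulfV ?powRr1// pnatr_eq0.
Qed.

(** Taking determinants in the hypothesis gives (prod tau)^2 det M on the left and,
    by Sylvester's identity, the determinant of the 1 x 1 matrix 1 + u^* u on the
    right.  Over the quaternions both sides are raised to the fourth power, which
    the fourth root in [rdet] undoes. *)
Lemma rdet_gram (R : realType) (K : division_algebra) p
    (M T : 'M[Defs.scalar R K]_p) (f : 'I_p -> nat) (tau : 'I_p -> R)
    (u : 'cV[Defs.scalar R K]_p) :
  (forall i j, i != j -> (f j <= f i)%N -> T i j = 0) ->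
  (forall i, T i i = ofR K (tau i)) -> (forall i, 0 < tau i) ->
  T *m M *m ctrmx T = 1%:M + u *m ctrmx u ->
  rdet M = ((\prod_i tau i) ^+ 2)^-1 * (1 + \sum_i nsq (u i 0)).
Proof.
move=> Tf Td tau0; have uu := ctrmx_mul_col u.
have P0 : 0 < \prod_i tau i by exact: prodr_gt0.
case: K M T u Tf Td uu => /= M T u Tf Td uu TM.
- have := congr1 determinant TM.
  rewrite det_1addmx uu scalar_mx_add det_scalar expr1 !det_mulmx.
  have -> : ctrmx (K := Defs.realK) T = T^T by apply/matrixP => i j; rewrite !mxE.
  have dT : \det T = \prod_i tau i by rewrite (det_tri Tf); apply: eq_bigr.
  rewrite det_tr dT => <-.
  by field; exact: lt0r_neq0.
- have := congr1 determinant TM.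
  rewrite det_1addmx uu scalar_mx_add det_scalar expr1 !det_mulmx.
  have -> : ctrmx (K := Defs.complexK) T = (map_mx (@conjc R) T)^T.
    by apply/matrixP => i j; rewrite !mxE.
  have dT : \det T = (\prod_i tau i)%:C.
    by rewrite (det_tri Tf) rmorph_prod; apply: eq_bigr => i _; rewrite Td.
  rewrite det_tr det_map_mx dT /= oppr0 -[(_ +i* 0)]/(_%:C).
  move=> /(congr1 (@complex.Re R)); rewrite mulrAC -rmorphM Re_realM Re_addc /= => <-.
  by field; exact: lt0r_neq0.
- have := congr1 (fun X => \det (real_operator X)) TM.
  rewrite /= !real_operatorE real_opD !real_opM real_op_ctrmx !det_mulmx det_tr.
  rewrite (det_real_op_tri Tf Td) -(ofR1 R quaternionK) real_op_scalar det_1addmx.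
  rewrite -real_opM uu real_op_scalar scalar_mx_add det_scalar mul1n.
  set s := \sum_i _ => e; have s0 : 0 <= 1 + s.
    by rewrite addr_ge0// sumr_ge0// => i _; exact: nsq_ge0.
  have -> : \det (real_op M) = ((1 + s) / (\prod_i tau i) ^+ 2) ^+ 4.
    by rewrite expr_div_n -e; field; exact: lt0r_neq0.
  rewrite powR_root4; first by rewrite mulrC.
  by rewrite divr_ge0 ?exprn_ge0 ?(ltW P0).
Qed.

Lemma rdet_unitri (R : realType) (K : division_algebra) p
    (T : 'M[Defs.scalar R K]_p) (f : 'I_p -> nat) :
  (forall i j, i != j -> (f j <= f i)%N -> T i j = 0) -> (forall i, T i i = 1) ->
  rdet (T *m ctrmx T) = 1.
Proof.
case: K T => /= T Tf Td.
- have -> : ctrmx (K := Defs.realK) T = T^T by apply/matrixP => i j; rewrite !mxE.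
  by rewrite det_mulmx det_tr (det_tri Tf) big1 ?mulr1.
- have -> : ctrmx (K := Defs.complexK) T = (map_mx (@conjc R) T)^T.
    by apply/matrixP => i j; rewrite !mxE.
  by rewrite det_mulmx det_tr det_map_mx (det_tri Tf) big1 ?rmorph1 ?mulr1.
- have Td' i : T i i = @ofR R quaternionK 1 by rewrite Td ofR1.
  rewrite real_operatorE real_opM real_op_ctrmx det_mulmx det_tr.
  by rewrite (det_real_op_tri Tf Td') big1// expr1n mulr1 powR1.
Qed.

(** * Corner determinants after adding a column *)
Lemma sum_lower (V : nmodType) (F : nat -> V) i p :
  (forall k, (i < k)%N -> F k = 0) -> (i < p)%N ->
  \sum_(k < p) F k = F i + \sum_(k < i) F k.
Proof.
move=> F0 ip; rewrite -(big_mkord xpredT F) (@big_cat_nat _ _ _ i.+1)//=.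
rewrite [X in _ + X]big_nat_cond [X in _ + X]big1 ?addr0.
  by rewrite big_mkord big_ord_recr /= addrC.
by move=> k /andP[/andP[ik _] _]; exact: F0.
Qed.

Section Corners.
Variables (R : realType) (K : division_algebra).
Local Notation S := (Defs.scalar R K).

(** Entries indexed by natural numbers, so that matrices of different sizes can be
    compared without casts. *)
Definition entry n (Z : unitri R K n) (k l : nat) : S :=
  if insub k is Some i then if insub l is Some j then Z i j else 0 else 0.

Lemma cornerE n (Z : unitri R K n) p q i j : corner Z p q i j = entry Z i j.
Proof. by rewrite mxE. Qed.

Lemma entryE n (Z : unitri R K n) (i j : 'I_n) : entry Z i j = Z i j.
Proof. by rewrite /entry !valK. Qed.

Lemma entry_forget n (Z : unitri R K n.+1) k l : (k < n)%N -> (l < n)%N ->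
  entry (forget Z) k l = entry Z k l.
Proof.
move=> kn ln; rewrite -[k]/(val (Ordinal kn)) -[l]/(val (Ordinal ln)) /= .
rewrite (entryE (forget Z) (Ordinal kn) (Ordinal ln)) mxE.
by rewrite -entryE.
Qed.

Lemma entry_lower n (Z : unitri R K n) (k l : nat) : (l < k)%N -> entry Z k l = 0.
Proof.
rewrite /entry; case: insubP => // i _ <-; case: insubP => // j _ <- ji.
by have /forallP/(_ i)/forallP/(_ j)/andP[/implyP/(_ ji)/eqP] := valP Z.
Qed.

Lemma entry_diag n (Z : unitri R K n) k : (k < n)%N -> entry Z k k = 1.
Proof.
move=> kn; rewrite (entryE Z (Ordinal kn) (Ordinal kn)).
by have /forallP/(_ (Ordinal kn))/forallP/(_ (Ordinal kn))/andP[_ /implyP/(_ (eqxx _))/eqP] := valP Z.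
Qed.

Lemma s_NN n (Z : unitri R K n) : s_ Z n n = 1.
Proof.
apply: (@rdet_unitri _ _ _ _ (fun i => i)).
  move=> i j ij ji; rewrite cornerE entry_lower// ltn_neqAle ji andbT.
  by rewrite eq_sym.
by move=> i; rewrite cornerE entry_diag.
Qed.

Lemma unitri_rows_free n (Z : unitri R K n) (x : 'rV[S]_n) :
  x *m (umx Z) = 0 -> x = 0.
Proof.
move=> xZ; suff h j : forall i : 'I_n, (i < j)%N -> x 0 i = 0.
  by apply/matrixP => i k; rewrite ord1 mxE (h n).
elim: j => // j IH i; rewrite ltnS leq_eqVlt => /predU1P[ij|]; last exact: IH.
have := congr1 (fun X : 'rV[S]_n => X 0 i) xZ; rewrite mxE [RHS]mxE (bigD1 i)//=.
rewrite big1 ?addr0 => [|k ki].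
  by rewrite -entryE entry_diag// mulr1.
have [kj|jk] := ltnP k j; first by rewrite IH// mul0r.
rewrite -entryE entry_lower ?mulr0// ij ltn_neqAle jk andbT eq_sym -ij.
by rewrite val_eqE.
Qed.

(** Being lower triangular, T orthonormalizes the first p rows of Z' for every p at
    once.  For a matrix Z above Z' the rows of T Z are orthonormal rows extended by
    one entry, whose Gram matrix is a rank one perturbation of the identity.
    The product of the tau_k is 1 because s_NN = 1.  Everything is indexed by nat,
    so that p can vary without casts. *)
Lemma corner_gram N (Z' : unitri R K N) :
  exists (T : nat -> nat -> S) (tau : nat -> R),
  [/\ forall k, 0 < tau k, \prod_(k < N) tau k = 1,
      forall p, (p <= N)%N -> s_ Z' p N = ((\prod_(k < p) tau k) ^+ 2)^-1 &
      forall Z : unitri R K N.+1, forget Z = Z' -> forall p, (p <= N)%N ->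
        s_ Z p N.+1 = ((\prod_(k < p) tau k) ^+ 2)^-1 *
        (1 + \sum_(k < p) nsq (ofR K (tau k) * entry Z k N +
                               \sum_(l < k) T k l * entry Z l N))].
Proof.
have [T0 [tau0 [T0l tau00 T0d T0Z]]] := gram_schmidt (@unitri_rows_free _ Z').
pose T k l : S := if insub k is Some i then if insub l is Some j then T0 i j else 0 else 0.
pose tau k := if insub k is Some i then tau0 i else 1.
have Tl k l : (k < l)%N -> T k l = 0.
  rewrite /T; case: insubP => // i _ <-; case: insubP => // j _ <-; exact: T0l.
have tau_gt0 k : 0 < tau k by rewrite /tau; case: insubP.
have Td k : (k < N)%N -> T k k = ofR K (tau k).
  by move=> kN; rewrite /T /tau -[k]/(val (Ordinal kN)) !valK T0d.
have TE (i j : 'I_N) : T i j = T0 i j by rewrite /T !valK.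
(* Row i of T X involves only the rows of X up to i, as T is lower triangular. *)
pose Y (X : nat -> nat -> S) i j := \sum_(k < i.+1) T i k * X k j.
have YY i i' : (i < N)%N -> (i' < N)%N ->
    \sum_(j < N) Y (entry Z') i j * sconj (Y (entry Z') i' j) = (i == i')%:R.
  move=> iN i'N; have Yi (k : 'I_N) j : Y (entry Z') k j = \sum_(l < N) T k l * entry Z' l j.
    rewrite (sum_lower (F := fun l => T k l * entry Z' l j) _ (ltn_ord k)).
      by rewrite /Y big_ord_recr addrC.
    by move=> l kl; rewrite Tl// mul0r.
  have := congr1 (fun X : 'M[S]_N => X (Ordinal iN) (Ordinal i'N)) T0Z.
  rewrite [in RHS]mxE -val_eqE /= => <-; rewrite mxE; apply: eq_bigr => j _.
  rewrite (Yi (Ordinal iN)) (Yi (Ordinal i'N)) mxE [ctrmx _ _ _]mxE mxE.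
  by congr (_ * sconj _); apply: eq_bigr => l _; rewrite TE entryE.
have gram (n : nat) (Z : unitri R K n) (w : nat -> S) p : (p <= N)%N ->
    (forall i i', (i < p)%N -> (i' < p)%N ->
      \sum_(j < n) Y (entry Z) i j * sconj (Y (entry Z) i' j) =
      (i == i')%:R + w i * sconj (w i')) ->
    s_ Z p n = ((\prod_(k < p) tau k) ^+ 2)^-1 * (1 + \sum_(k < p) nsq (w k)).
  move=> pN YYw; pose Tp : 'M[S]_p := \matrix_(i, j) T i j.
  rewrite /s_ (@rdet_gram _ _ _ _ Tp (fun i => (p - i)%N) tau (\col_i w i)).
  - by congr (_ * (1 + _)); apply: eq_bigr => k _; rewrite mxE.
  - move=> i j ij; rewrite leq_sub2lE ?(ltnW (ltn_ord _))// => ji.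
    by rewrite mxE Tl// ltn_neqAle ji andbT.
  - by move=> i; rewrite mxE Td// (leq_trans (ltn_ord i)).
  - by move=> i; exact: tau_gt0.
  - have TB (i : 'I_p) (j : 'I_n) : (Tp *m corner Z p n) i j = Y (entry Z) i j.
      rewrite mxE; under eq_bigr do rewrite mxE cornerE.
      rewrite (sum_lower (F := fun l => T i l * entry Z l j) _ (ltn_ord i)).
        by rewrite /Y big_ord_recr addrC.
      by move=> l kl; rewrite Tl// mul0r.
    rewrite mulmxA -[_ *m ctrmx Tp]mulmxA -ctrmxM.
    apply/matrixP => i i'; rewrite mxE.
    under eq_bigr do rewrite TB [ctrmx _ _ _]mxE TB.
    rewrite YYw// [RHS]mxE [X in _ = X + _]mxE [X in _ = _ + X]mxE big_ord1 !mxE.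
    by [].
have sZ' p : (p <= N)%N -> s_ Z' p N = ((\prod_(k < p) tau k) ^+ 2)^-1.
  move=> pN; rewrite (gram _ Z' (fun=> 0) p pN) => [|i i' ip i'p].
    by rewrite [X in 1 + X]big1 ?addr0 ?mulr1// => k _; exact: nsq0.
  by rewrite YY ?(leq_trans _ pN)// mul0r addr0.
exists T, tau; split => //.
  have := sZ' N (leqnn N); rewrite s_NN => /esym/(congr1 (@GRing.inv R)).
  rewrite invrK invr1 => /eqP; rewrite sqrf_eq1 => /orP[/eqP//|/eqP e].
  have : 0 < \prod_(k < N) tau k by exact: prodr_gt0.
  by rewrite e oppr_gt0 ltr10.
move=> Z ZZ' p pN;
apply: (gram _ Z (fun k => ofR K (tau k) * entry Z k N +
  \sum_(l < k) T k l * entry Z l N)) => // i i' ip i'p.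
have iN := leq_trans ip pN; have i'N := leq_trans i'p pN.
have YN k : (k < N)%N -> Y (entry Z) k N =
    ofR K (tau k) * entry Z k N + \sum_(l < k) T k l * entry Z l N.
  by move=> kN; rewrite /Y big_ord_recr addrC /= Td.
rewrite big_ord_recr /= !YN//; congr (_ + _); rewrite -YY//.
apply: eq_bigr => j _; rewrite -ZZ' /Y.
have lN k (l : 'I_k.+1) : (k < N)%N -> (l < N)%N by exact: leq_trans.
by congr (_ * sconj _); apply: eq_bigr => l _; rewrite entry_forget ?lN.
Qed.

End Corners.

(** * Measurability and boundedness of the corner determinants *)
Section PolynomialFunctions.
Variables (R : realType) (T : Type) (X : set (T -> R)).

(** A common source for measurability and for boundedness on bounded sets: both
    pass from the functions of X to polynomials in them. *)
Inductive pol : (T -> R) -> Prop :=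
| pol_cst r : pol (fun=> r)
| pol_gen f : X f -> pol f
| polD f g : pol f -> pol g -> pol (fun t => f t + g t)
| polM f g : pol f -> pol g -> pol (fun t => f t * g t).

Lemma polN f : pol f -> pol (fun t => - f t).
Proof. by move=> pf; under eq_fun do rewrite -mulN1r; exact: polM (pol_cst _) pf. Qed.

Lemma pol_sum I (s : seq I) (P : pred I) (f : I -> T -> R) :
  (forall i, pol (f i)) -> pol (fun t => \sum_(i <- s | P i) f i t).
Proof.
move=> pf; elim: s => [|i s IH].
  by under eq_fun do rewrite big_nil; exact: pol_cst.
under eq_fun do rewrite big_cons.
by case E: (P i) => //; exact: polD.
Qed.

Lemma pol_prod I (s : seq I) (P : pred I) (f : I -> T -> R) :
  (forall i, pol (f i)) -> pol (fun t => \prod_(i <- s | P i) f i t).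
Proof.
move=> pf; elim: s => [|i s IH].
  by under eq_fun do rewrite big_nil; exact: pol_cst.
under eq_fun do rewrite big_cons.
by case E: (P i) => //; exact: polM.
Qed.

Lemma pol_det p (A : T -> 'M[R]_p) :
  (forall i j, pol (fun t => A t i j)) -> pol (fun t => \det (A t)).
Proof.
move=> pA; apply: pol_sum => s; apply: polM; first exact: pol_cst.
exact: pol_prod.
Qed.

Lemma pol_bounded (D : set T) :
  (forall f, X f -> exists M, forall t, D t -> `|f t| <= M) ->
  forall f, pol f -> exists M, forall t, D t -> `|f t| <= M.
Proof.
move=> XM f; elim=> [r|g /XM//|g h _ [M gM] _ [M' hM]|g h _ [M gM] _ [M' hM]].
- by exists `|r|.
- by exists (M + M') => t Dt; rewrite (le_trans (ler_normD _ _))// lerD ?gM ?hM.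
- by exists (M * M') => t Dt; rewrite normrM ler_pM ?gM ?hM.
Qed.

Variable K : division_algebra.
Local Notation S := (Defs.scalar R K).

Definition kpol (f : T -> S) := forall c, pol (fun t => rcoord c (f t)).

Lemma kpol_cst x : kpol (fun=> x).
Proof. by move=> c; exact: pol_cst. Qed.

Lemma kpol_sum I (s : seq I) (P : pred I) (f : I -> T -> S) :
  (forall i, kpol (f i)) -> kpol (fun t => \sum_(i <- s | P i) f i t).
Proof. by move=> pf c; under eq_fun do rewrite rcoord_sum; apply: pol_sum => i; exact: pf. Qed.

End PolynomialFunctions.

Lemma pol_measurable d (T : measurableType d) (R : realType) (X : set (T -> R)) f :
  (forall g, X g -> measurable_fun setT g) -> pol X f -> measurable_fun setT f.
Proof.
move=> mX; elim=> [r|g /mX//|g h _ mg _ mh|g h _ mg _ mh].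
- exact: measurable_cst.
- exact: measurable_funD.
- exact: measurable_funM.
Qed.

Section PolynomialScalars.
Variables (R : realType) (T : Type) (X : set (T -> R)).

Lemma kpolM (K : division_algebra) (f g : T -> Defs.scalar R K) :
  kpol X f -> kpol X g -> kpol X (fun t => f t * g t).
Proof.
case: K f g => f g pf pg.
- move=> [|c]; first exact (polM (pf 0%N) (pg 0%N)).
  by rewrite /rcoord /=; under eq_fun do rewrite nth_nil; exact: pol_cst.
- have f0 : pol X (fun t => complex.Re (f t)) := pf 0%N.
  have f1 : pol X (fun t => complex.Im (f t)) := pf 1%N.
  have g0 : pol X (fun t => complex.Re (g t)) := pg 0%N.
  have g1 : pol X (fun t => complex.Im (g t)) := pg 1%N.
  move=> [|[|c]]; rewrite /rcoord /=.
  + by under eq_fun do rewrite Re_mulc; apply: polD; [|apply: polN]; exact: polM.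
  + by under eq_fun do rewrite Im_mulc; apply: polD; exact: polM.
  + by under eq_fun do rewrite nth_nil; exact: pol_cst.
- have f0 : pol X (fun t => q_re (f t)) := pf 0%N.
  have f1 : pol X (fun t => q_i (f t)) := pf 1%N.
  have f2 : pol X (fun t => q_j (f t)) := pf 2%N.
  have f3 : pol X (fun t => q_k (f t)) := pf 3%N.
  have g0 : pol X (fun t => q_re (g t)) := pg 0%N.
  have g1 : pol X (fun t => q_i (g t)) := pg 1%N.
  have g2 : pol X (fun t => q_j (g t)) := pg 2%N.
  have g3 : pol X (fun t => q_k (g t)) := pg 3%N.
  have E t : f t * g t = Quat (q_re (f t)) (q_i (f t)) (q_j (f t)) (q_k (f t)) *
      Quat (q_re (g t)) (q_i (g t)) (q_j (g t)) (q_k (g t)).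
    by case: (f t) (g t) => ? ? ? ? [].
  move=> [|[|[|[|c]]]]; rewrite /rcoord; under eq_fun do rewrite E /= ?nth_nil;
    rewrite ?(_ : nth _ _ _ = 0)//;
    repeat (first [exact: pol_cst | assumption | apply: polD | apply: polN
      | apply: polM]).
Qed.

Lemma kpol_conj (K : division_algebra) (f : T -> Defs.scalar R K) :
  kpol X f -> kpol X (fun t => sconj (f t)).
Proof.
case: K f => f pf; first exact: pf.
- have E t : sconj (K := complexK) (f t) = (complex.Re (f t) +i* - complex.Im (f t))%C.
    by case: (f t).
  move=> c; under eq_fun do rewrite E; case: c => [|[|c]]; rewrite /rcoord /=.
  + exact: (pf 0%N).
  + exact: polN (pf 1%N).
  + by under eq_fun do rewrite nth_nil; exact: pol_cst.
- move=> [|[|[|[|c]]]]; rewrite /rcoord /=.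
  + exact: (pf 0%N).
  + exact: polN (pf 1%N).
  + exact: polN (pf 2%N).
  + exact: polN (pf 3%N).
  + by under eq_fun do rewrite nth_nil; exact: pol_cst.
Qed.

Lemma kpol_prod_complex I (s : seq I) (f : I -> T -> R[i]) :
  (forall i, kpol X (f i : T -> Defs.scalar R complexK)) ->
  kpol X ((fun t => \prod_(i <- s) f i t) : T -> Defs.scalar R complexK).
Proof.
move=> pf; elim: s => [|i s IH].
  by under eq_fun do rewrite big_nil; exact: kpol_cst.
by under eq_fun do rewrite big_cons; exact: (@kpolM complexK (f i)).
Qed.

(** The second alternative is the quaternionic case, where [rdet] is the fourth root
    of a determinant. *)
Lemma rdet_pol (K : division_algebra) p (A : T -> 'M[Defs.scalar R K]_p) :
  (forall i j, kpol X (fun t => A t i j)) ->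
  pol X (fun t => rdet (A t)) \/
  exists2 P, pol X P & forall t, rdet (A t) = P t `^ 4^-1.
Proof.
case: K A => A pA.
- by left; apply: pol_det => i j; exact: (pA i j 0%N).
- left; have : kpol X ((fun t => \det (A t)) : T -> Defs.scalar R complexK).
    apply: kpol_sum => s; apply: (@kpolM complexK (fun=> (-1) ^+ s)).
      exact: kpol_cst.
    by apply: kpol_prod_complex => i; exact: pA.
  by move=> /(_ 0%N).
- right; exists (fun t => \det (real_operator (A t))) => //.
  apply: pol_det => a b; case/mxvec_indexP: a => k d; case/mxvec_indexP: b => i c.
  under eq_fun do rewrite real_operatorE real_op_entry.
  by apply: (@kpolM quaternionK) => //; exact: kpol_cst.
Qed.

End PolynomialScalars.

Section CornerFunctions.
Variables (R : realType) (K : division_algebra).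
Local Notation S := (Defs.scalar R K).

Definition coordinates n : set (unitri R K n -> R) :=
  [set f | exists k m c, f = fun Z => rcoord c (entry Z k m)].

Lemma s_pol n p q : pol (@coordinates n) (fun Z => s_ Z p q) \/
  exists2 P, pol (@coordinates n) P & forall Z, s_ Z p q = P Z `^ 4^-1.
Proof.
apply: rdet_pol => i j.
have ->: (fun Z => (corner Z p q *m ctrmx (corner Z p q)) i j) =
    (fun Z : unitri R K n => \sum_(k < q) entry Z i k * sconj (entry Z j k)).
  apply/funext => Z; rewrite mxE; apply: eq_bigr => k _.
  by rewrite [ctrmx _ _ _]mxE !cornerE.
have pe (k l : nat) : kpol (@coordinates n) (fun Z => entry Z k l).
  by move=> c; apply: pol_gen; exists k, l, c.
by apply: kpol_sum => k; apply: kpolM => //; exact: kpol_conj.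
Qed.

Lemma s_bounded n p q (D : set (unitri R K n)) (M : R) :
  (forall Z, D Z -> forall k m c, `|rcoord c (entry Z k m)| <= M) ->
  exists C, forall Z, D Z -> s_ Z p q <= C.
Proof.
move=> DM; have B f : pol (@coordinates n) f -> exists C, forall Z, D Z -> `|f Z| <= C.
  apply: pol_bounded => {}f [k [m [c ->]]]; exists M => Z DZ; exact: DM.
have [/B[C h]|[P /B[C PC] sP]] := s_pol n p q.
  by exists C => Z /h; apply: le_trans; exact: ler_norm.
exists (Num.max 1 (C `^ 4^-1)) => Z DZ; rewrite sP le_max.
have [P0|P0] := leP 0 (P Z).
  rewrite ge0_ler_powR ?orbT ?nnegrE// ?(le_trans (ler_norm _) (PC _ DZ))//.
  by rewrite (le_trans _ (PC _ DZ)).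
have -> : P Z `^ 4^-1 = 1.
  by rewrite /powR lt_eqF// ln0 ?(ltW P0)// mulr0 expR0.
by rewrite lexx.
Qed.

(** Passing from Z' to Z multiplies the determinant by 1 plus a sum of squares. *)
Lemma s_ge1 n (Z : unitri R K n) p : (p <= n)%N -> 1 <= s_ Z p n.
Proof.
elim: n Z => [|n IH] Z; first by rewrite leqn0 => /eqP ->; rewrite s_NN.
rewrite leq_eqVlt => /predU1P[->|]; first by rewrite s_NN.
rewrite ltnS => pn; have [T [tau [tau0 _ s1 s2]]] := corner_gram (forget Z).
rewrite (s2 Z erefl p pn) -s1//; apply: (le_trans (IH (forget Z) pn)).
rewrite ler_peMr ?(le_trans _ (IH _ _))// lerDl sumr_ge0// => k _.
exact: nsq_ge0.
Qed.

End CornerFunctions.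

(** * The measure dZ and its disintegration *)
Lemma big_blocks (V : Type) (idx : V) (op : Monoid.law idx) N k (F : nat -> V) :
  \big[op/idx]_(j < N * k) F j =
  \big[op/idx]_(i < N) \big[op/idx]_(c < k) F (i * k + c)%N.
Proof.
elim: N => [|N IH]; first by rewrite !big_ord0.
rewrite big_ord_recr -IH /= -[in LHS](big_mkord xpredT F) mulSnr.
rewrite (@big_cat_nat _ _ _ (N * k)) ?leq_addr//= big_mkord; congr (op _ _).
by rewrite -{1}[(N * k)%N]add0n big_addn addKn big_mkord;
  apply: eq_bigr => c _; rewrite addnC.
Qed.

Section CoordinateMeasure.
Variables (R : realType) (K : division_algebra).
Local Notation leb := (@lebesgue_measure R).
Local Notation unitri := (unitri R K).

(** Sides are indexed by position (k, m, c), which, unlike the rank in [coords], does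
    not depend on n; this makes boxes of sizes n and n + 1 comparable. *)
Definition ubox n (B : nat -> nat -> nat -> set R) : set (unitri n) :=
  [set Z | forall k m c, (k < m)%N -> (m < n)%N -> (c < kappa K)%N ->
     B k m c (rcoord c (entry Z k m))].

Let pos n (k m c : nat) : nat :=
  index (k, m, c) [seq (val x.1.1, val x.1.2, val x.2) | x <- coords K n].

Let triple_inj n : injective (fun x : 'I_n * 'I_n * 'I_(kappa K) =>
  (val x.1.1, val x.1.2, val x.2)).
Proof. by move=> [[a b] c] [[a' b'] c'] /= [/val_inj -> /val_inj -> /val_inj ->]. Qed.

Let posE n x : x \in coords K n -> pos n x.1.1 x.1.2 x.2 = index x (coords K n).
Proof. by move=> xc; rewrite /pos (index_map (@triple_inj n)). Qed.

Let coords_uniq n : uniq (coords K n).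
Proof. by rewrite filter_uniq// enum_uniq. Qed.

Lemma coordE n (Z : unitri n) (x : 'I_n * 'I_n * 'I_(kappa K)) :
  Defs.coord Z x = rcoord x.2 (entry Z x.1.1 x.1.2).
Proof. by rewrite /Defs.coord entryE. Qed.

Let box_ubox n (A : nat -> set R) :
  (@to_tuple R K n) @^-1` (box A) = ubox (fun k m c => A (pos n k m c)).
Proof.
apply/seteqP; split => Z /=.
  move=> h k m c km mn cK; have kn := ltn_trans km mn.
  pose x : 'I_n * 'I_n * 'I_(kappa K) := (Ordinal kn, Ordinal mn, Ordinal cK).
  have xc : x \in coords K n by rewrite mem_coords.
  rewrite (posE xc); move: (xc); rewrite -index_mem => xs.
  have := h (Ordinal xs); rewrite tnth_map (tnth_nth x) /= nth_index// coordE.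
  by [].
move=> h l; rewrite tnth_map; set x := tnth (in_tuple (coords K n)) l.
have xc : x \in coords K n by rewrite mem_tnth.
have := h _ _ _ _ (ltn_ord x.1.2) (ltn_ord x.2).
move=> /(_ x.1.1); rewrite -mem_coords -coordE => /(_ xc); rewrite posE//.
by rewrite {1}/x (tnth_nth x) index_uniq// coords_uniq.
Qed.

Let prod_coords n (F : nat -> nat -> nat -> \bar R) :
  (\prod_(x <- coords K n) F x.1.1 x.1.2 x.2 =
   \prod_(m < n) \prod_(k < m) \prod_(c < kappa K) F k m c)%E.
Proof.
rewrite big_filter big_enum_cond /=.
rewrite (eq_bigl (fun x : 'I_n * 'I_n * 'I_(kappa K) =>
   (xpredT x.1.2 && (x.1.1 < x.1.2)%N) && xpredT x.2)); last by move=> x; rewrite andbT.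
rewrite -(pair_big (fun km : 'I_n * 'I_n => xpredT km.2 && (km.1 < km.2)%N) xpredT
   (fun km (c : 'I_(kappa K)) => F km.1 km.2 c))/=.
rewrite -(pair_big_dep xpredT (fun k m : 'I_n => xpredT m && (k < m)%N)
   (fun k m => \prod_(c < kappa K) F k m c)%E)/=.
rewrite (exchange_big_dep xpredT)//=; apply: eq_bigr => m _.
by rewrite (big_ord_widen _ (fun k => \prod_(c < kappa K) F k m c)%E (ltnW (ltn_ord m))).
Qed.

Let prod_pos n (F : nat -> \bar R) :
  (\prod_(i < size (coords K n)) F i =
   \prod_(m < n) \prod_(k < m) \prod_(c < kappa K) F (pos n k m c))%E.
Proof.
rewrite -(prod_coords n (fun k m c => F (pos n k m c))) [RHS]big_tnth.
apply: eq_bigr => i _; rewrite posE ?mem_tnth//; congr F.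
case: (coords K n) (coords_uniq n) i => [|x s] us i; first by case: i.
by rewrite (tnth_nth x) index_uniq.
Qed.

Lemma measurable_to_tuple n : measurable_fun setT (@to_tuple R K n).
Proof. by move=> _ B mB; exists B. Qed.

Lemma measurable_unitri d (T : measurableType d) n (f : T -> unitri n) :
  (forall k m c, measurable_fun setT (fun t => rcoord c (entry (f t) k m))) ->
  measurable_fun setT f.
Proof.
move=> mf; have mt : measurable_fun setT (fun t => to_tuple (f t)).
  apply/measurable_fun_tnthP => l; have := mf _ _ _.
  set x := tnth (in_tuple (coords K n)) l => /(_ x.1.1 x.1.2 x.2).
  rewrite (_ : (fun t => rcoord _ _) = (@tnth _ R)^~ l \o (fun t => to_tuple (f t)))//.
  by apply/funext => t /=; rewrite tnth_map coordE.
by move=> _ A [B mB <-]; rewrite setTI; exact: (mt measurableT B mB).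
Qed.

Lemma measurable_rcoord_entry n k m c :
  measurable_fun setT (fun Z : unitri n => rcoord c (entry Z k m)).
Proof.
have m0 : measurable_fun setT (fun _ : unitri n => 0 : R) by exact: measurable_cst.
rewrite /entry; case: insubP => [i _ _|_]; last by under eq_fun do rewrite rcoord0.
case: insubP => [j _ _|_]; last by under eq_fun do rewrite rcoord0.
have [cK|cK] := ltnP c (kappa K); last first.
  rewrite (_ : (fun _ => _) = fun=> 0)//; apply/funext => Z.
  by rewrite /rcoord nth_default// size_to_reals.
have cst_case (x : Defs.scalar R K) : (forall Z : unitri n, Z i j = x) ->
    measurable_fun setT (fun Z : unitri n => rcoord c (Z i j)).
  by move=> h; under eq_fun do rewrite h; exact: measurable_cst.
have [ij|ji|/val_inj ij] := ltngtP i j.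
- pose x : 'I_n * 'I_n * 'I_(kappa K) := (i, j, Ordinal cK).
  have xc : x \in coords K n by rewrite mem_coords.
  move: (xc); rewrite -index_mem => xs.
  rewrite (_ : (fun _ => _) = (@tnth _ R)^~ (Ordinal xs) \o @to_tuple R K n).
    by apply: measurableT_comp; [exact: measurable_tnth|exact: measurable_to_tuple].
  by apply/funext => Z /=; rewrite tnth_map (tnth_nth x) /= nth_index.
- by apply: (cst_case 0) => Z; rewrite -entryE entry_lower.
- by apply: (cst_case 1) => Z; rewrite ij -entryE entry_diag.
Qed.

Let ubox_box n (B : nat -> nat -> nat -> set R) :
  (forall k m c, measurable (B k m c)) ->
  exists A : nat -> set R, [/\ forall i, measurable (A i),
    ubox B = @to_tuple R K n @^-1` (box A) &
    forall k m c, (k < m)%N -> (m < n)%N -> (c < kappa K)%N ->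
      A (pos n k m c) = B k m c].
Proof.
move=> mB.
pose A (i : nat) : set R := let x := nth (0, 0, 0)%N
  [seq (val x.1.1, val x.1.2, val x.2) | x <- coords K n] i in B x.1.1 x.1.2 x.2.
have AB k m c : (k < m)%N -> (m < n)%N -> (c < kappa K)%N -> A (pos n k m c) = B k m c.
  move=> km mn cK; rewrite /A /pos nth_index//.
  have kn := ltn_trans km mn.
  by apply/mapP; exists (Ordinal kn, Ordinal mn, Ordinal cK); rewrite // mem_coords.
exists A; split => //; first by move=> i; exact: mB.
rewrite box_ubox; apply/seteqP; split => Z /= h k m c km mn cK;
  by have := h k m c km mn cK; rewrite AB.
Qed.

Lemma measurable_ubox n (B : nat -> nat -> nat -> set R) :
  (forall k m c, measurable (B k m c)) -> measurable (@ubox n B).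
Proof.
move=> /(ubox_box n)[A [mA -> _]].
by rewrite -[X in measurable X]setTI; apply: measurable_to_tuple => //; exact: measurable_box.
Qed.

Lemma dZ_ubox n (B : nat -> nat -> nat -> set R) :
  (forall k m c, measurable (B k m c)) ->
  (dZ R K n (@ubox n B) =
   \prod_(m < n) \prod_(k < m) \prod_(c < kappa K) leb (B k m c))%E.
Proof.
move=> mB; have [A [mA -> AB]] := ubox_box n mB.
rewrite /dZ /= /pushforward -comp_preimage.
rewrite (_ : _ \o _ = id); last by apply/funext => t /=; exact: of_tupleK.
rewrite preimage_id lebesgue_box//.
rewrite (prod_pos n (fun i => leb (A i))); apply: eq_bigr => m _.
by apply: eq_bigr => k _; apply: eq_bigr => c _; rewrite AB.
Qed.

Lemma dZ_unique n (mu : {measure set (unitri n) -> \bar R}) :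
  (forall B, (forall k m c, measurable (B k m c)) ->
    (mu (@ubox n B) =
     \prod_(m < n) \prod_(k < m) \prod_(c < kappa K) leb (B k m c))%E) ->
  forall D, measurable D -> dZ R K n D = mu D.
Proof.
move=> muB _ [B mB <-]; rewrite setTI.
rewrite /dZ /= /pushforward -comp_preimage.
rewrite (_ : _ \o _ = id); last by apply/funext => t /=; exact: of_tupleK.
rewrite preimage_id.
rewrite (@lebesgue_tuple_unique _ _ (pushforward_measure mu (@measurable_to_tuple n)))//.
move=> A mA /=; rewrite /pushforward box_ubox muB => [|k m c]; last exact: mA.
by rewrite (prod_pos n (fun i => leb (A i))).
Qed.

Lemma sigma_finite_dZ n : sigma_finite setT (dZ R K n).
Proof.
exists (fun k => @to_tuple R K n @^-1` box (@cube R k)).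
  by rewrite -preimage_bigcup cube_cover preimage_setT.
move=> k; split.
  rewrite -[X in measurable X]setTI; apply: measurable_to_tuple => //.
  by apply: measurable_box => i; exact: measurable_cube.
rewrite /dZ /= /pushforward -comp_preimage.
rewrite (_ : _ \o _ = id); last by apply/funext => t /=; exact: of_tupleK.
by rewrite preimage_id lebesgue_cube_fin.
Qed.

End CoordinateMeasure.

Lemma kappa_gt0 K : (0 < kappa K)%N. Proof. by case: K. Qed.

Section JoinColumn.
Variables (R : realType) (K : division_algebra).
Local Notation leb := (@lebesgue_measure R).
Local Notation S := (Defs.scalar R K).
Local Notation unitri := (unitri R K).

(** The k-th block of kappa K consecutive real numbers is the k-th entry. *)
Definition column (v : seq R) (k : nat) : S :=
  of_reals K [seq v`_(k * kappa K + c) | c : 'I_(kappa K)].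

Lemma rcoord_column v k c : (c < kappa K)%N ->
  rcoord c (column v k) = v`_(k * kappa K + c).
Proof.
move=> cK; rewrite /rcoord of_realsK; last by rewrite size_image card_ord.
by rewrite (nth_map (Ordinal cK)) ?size_enum_ord// (nth_ord_enum _ (Ordinal cK)).
Qed.

Section SizeN.
Variable N : nat.
Local Notation M := (N * kappa K)%N.

Definition join_column_mx (Z : unitri N) (v : seq R) : 'M[S]_N.+1 :=
  \matrix_(k, m) if (m < N)%N then entry Z k m
                 else if (k < N)%N then column v k else 1.

Fact join_column_subproof Z v : is_unitri (join_column_mx Z v).
Proof.
apply/forallP => k; apply/forallP => m; rewrite mxE; apply/andP; split; apply/implyP.
  move=> mk; have mN : (m < N)%N by rewrite (leq_trans mk)// -ltnS.
  by rewrite mN entry_lower.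
move=> /eqP <-; case: (ltnP k N) => // kN; by rewrite entry_diag.
Qed.

(** The coordinates of the column are read backwards because the head of a tuple is
    integrated first, and the last coordinate has to go first. *)
Definition join_column (p : unitri N * M.-tuple R) : unitri N.+1 :=
  Unitri (join_column_subproof p.1 (rev p.2)).

Lemma entry_join_column_old p k m : (k <= N)%N -> (m < N)%N ->
  entry (join_column p) k m = entry p.1 k m.
Proof.
rewrite -ltnS => kN mN; have mN1 : (m < N.+1)%N by exact: ltnW.
by rewrite (entryE (join_column p) (Ordinal kN) (Ordinal mN1)) /= mxE /= mN.
Qed.

Lemma entry_join_column_new p k : (k < N)%N ->
  entry (join_column p) k N = column (rev p.2) k.
Proof.
move=> kN; have kN1 : (k < N.+1)%N by exact: ltnW.
by rewrite (entryE (join_column p) (Ordinal kN1) (Ordinal (ltnSn N))) /= mxE /= ltnn kN.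
Qed.

Lemma forget_join_column p : forget (join_column p) = p.1.
Proof.
apply: val_inj; apply/matrixP => i j; rewrite mxE mxE /=.
by rewrite (ltn_ord j) entryE.
Qed.

Lemma measurable_join_column : measurable_fun setT join_column.
Proof.
have mcst k m c (x : S) : (forall p, entry (join_column p) k m = x) ->
    measurable_fun setT (fun p => rcoord c (entry (join_column p) k m)).
  by move=> h; under eq_fun do rewrite h; exact: measurable_cst.
apply: measurable_unitri => k m c; have [kN|kN] := leqP k N; last first.
  by apply: (mcst _ _ _ 0) => p; rewrite /entry insubN// -leqNgt.
have [mN|mN] := ltnP m N.
  under eq_fun do rewrite entry_join_column_old//.
  by apply: (measurableT_comp (@measurable_rcoord_entry R K N k m c)).
have [mN1|mN1] := ltnP N m.
  apply: (mcst _ _ _ 0) => p; rewrite /entry; case: insubP => // i _ _.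
  by rewrite insubN// -leqNgt.
have {mN mN1} -> : m = N by apply/eqP; rewrite eqn_leq mN1 mN.
move: kN; rewrite leq_eqVlt => /predU1P[->|kN].
  by apply: (mcst _ _ _ 1) => p; rewrite entry_diag.
under eq_fun do rewrite entry_join_column_new//.
have [cK|cK] := ltnP c (kappa K); last first.
  rewrite (_ : (fun _ => _) = fun=> 0); first exact: measurable_cst.
  by apply/funext => p; rewrite /rcoord nth_default// size_to_reals.
under eq_fun do rewrite rcoord_column//.
have jM : (k * kappa K + c < M)%N.
  by rewrite -ltn_divLR ?kappa_gt0// divnMDl ?kappa_gt0// divn_small// addn0.
have jM' : (M - (k * kappa K + c).+1 < M)%N by rewrite ltn_subrL (leq_ltn_trans _ jM).
rewrite (_ : (fun _ => _) = (@tnth _ R)^~ (Ordinal jM') \o snd).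
  by apply: (measurableT_comp (measurable_tnth _)).
by apply/funext => p; rewrite /= nth_rev size_tuple// (tnth_nth 0).
Qed.

Definition fibre_measure := sigma_finite_pack (@sigma_finite_lebesgue_tuple R M).
Definition base_measure := sigma_finite_pack (@sigma_finite_dZ R K N).

(** Both measures give a box the product of the lengths of its sides: the sides in
    columns before the last one come from the base, the others from the fibre. *)
Lemma dZ_join_column D : measurable D -> dZ R K N.+1 D =
  pushforward_measure (base_measure \x fibre_measure)%E measurable_join_column D.
Proof.
apply: dZ_unique => B mB.
rewrite -[LHS]/((base_measure \x fibre_measure)%E (join_column @^-1` ubox B)).
pose A i := let j := (M - i.+1)%N in B (j %/ kappa K)%N N (j %% kappa K)%N.
have -> : join_column @^-1` ubox B = ubox B `*` box A.
  apply/seteqP; split => [[Z u] /= h|[Z u] /= [h1 h2] k m c km mN1 cK].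
    split => [k m c km mN cK|i].
      have := h k m c km (ltnW mN) cK.
      by rewrite entry_join_column_old// ltnW// (ltn_trans km).
    pose j := (M - i.+1)%N; have jM : (j < M)%N.
      by rewrite ltn_subrL (leq_ltn_trans _ (ltn_ord i)).
    have kN : (j %/ kappa K < N)%N by rewrite ltn_divLR ?kappa_gt0.
    have cK : (j %% kappa K < kappa K)%N by rewrite ltn_mod kappa_gt0.
    have := h _ N _ kN (ltnSn N) cK; rewrite entry_join_column_new// rcoord_column//.
    rewrite -divn_eq nth_rev ?size_tuple// /j subnSK// subKn; last exact: ltnW.
    by rewrite (tnth_nth 0).
  have [mN|] := ltnP m N.
    by rewrite entry_join_column_old ?(ltnW (ltn_trans km mN))//; exact: h1.
  rewrite leq_eqVlt ltnNge -ltnS mN1 orbF => /eqP mN; rewrite -mN in km *.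
  rewrite entry_join_column_new// rcoord_column//=.
  have jM : (k * kappa K + c < M)%N.
    by rewrite -ltn_divLR ?kappa_gt0// divnMDl ?kappa_gt0// divn_small// addn0.
  have jM' : (M - (k * kappa K + c).+1 < M)%N by rewrite ltn_subrL (leq_ltn_trans _ jM).
  have := h2 (Ordinal jM'); rewrite /A /= subnSK// subKn; last exact: ltnW.
  rewrite divnMDl ?kappa_gt0// divn_small// addn0 modnMDl modn_small//.
  by rewrite nth_rev size_tuple// (tnth_nth 0).
transitivity (dZ R K N (ubox B) * lebesgue_tuple R M (box A))%E.
  apply: product_measure1E; first exact: measurable_ubox.
  by apply: measurable_box => i; exact: mB.
rewrite dZ_ubox// lebesgue_box; last by move=> i; exact: mB.
rewrite big_ord_recr/=; congr (_ * _)%E.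
rewrite (reindex_inj rev_ord_inj)/=.
rewrite (eq_bigr (fun j : 'I_M => leb (B (j %/ kappa K)%N N (j %% kappa K)%N))).
  rewrite (big_blocks _ N (kappa K) (fun j => leb (B (j %/ kappa K)%N N (j %% kappa K)%N))).
  apply: eq_bigr => k _; apply: eq_bigr => c _.
  by rewrite divnMDl ?kappa_gt0// divn_small// addn0 modnMDl modn_small.
by move=> j _; rewrite /A subnSK// subKn// ltnW.
Qed.

End SizeN.
End JoinColumn.

(** * Real coordinates grouped into entries *)
Section Blocks.
Variables (R : realType) (K : division_algebra).
Local Notation S := (Defs.scalar R K).
Local Notation ka := (kappa K).
Variables (T : nat -> nat -> S) (tau : nat -> R) (lam : nat -> R[i]).

(** The real coordinate j = i kappa + c is coordinate c of entry i.  The diagonal of T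
    is real, so tau_i scales the coordinates of entry i separately, and the other terms of
    row i only involve earlier entries.  The determinant s_(i+1) is the partial sum
    that ends with the last coordinate of entry i; this is where its exponent sits. *)
Definition block_tau (j : nat) : R := tau (j %/ ka).
Definition block_gam (j : nat) (t : seq R) : R :=
  rcoord (j %% ka) (\sum_(l < j %/ ka) T (j %/ ka) l * column K (rev t) l).
Definition block_nu (j : nat) : R[i] :=
  if (j %% ka == ka.-1)%N then lam (j %/ ka).+1 else 0.

Let ka0 : (0 < ka)%N. Proof. exact: kappa_gt0. Qed.

Let blockE i c : (c < ka)%N -> ((i * ka + c) %/ ka = i)%N /\ ((i * ka + c) %% ka = c)%N.
Proof. by move=> cK; rewrite divnMDl// divn_small// addn0 modnMDl modn_small. Qed.

Lemma measurable_block_gam j : measurable_fun setT (fun t : j.-tuple R => block_gam j t).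
Proof.
pose X : set (j.-tuple R -> R) := [set f | exists i,
    f = fun t : j.-tuple R => (rev t)`_i].
apply: (@pol_measurable _ _ _ X).
  move=> _ [i ->]; have [ij|ij] := ltnP i j; last first.
    rewrite (_ : (fun _ => _) = fun=> 0); first exact: measurable_cst.
    by apply/funext => t; rewrite nth_default// size_rev size_tuple.
  have ij' : (j - i.+1 < j)%N by rewrite ltn_subrL (leq_ltn_trans _ ij).
  rewrite (_ : (fun _ => _) = (@tnth _ R)^~ (Ordinal ij')); first exact: measurable_tnth.
  by apply/funext => t; rewrite /= nth_rev size_tuple// (tnth_nth 0).
suff : kpol X (fun t : j.-tuple R =>
    \sum_(l < j %/ ka) T (j %/ ka) l * column K (rev t) l) by exact.
apply: kpol_sum => l; apply: kpolM; first exact: kpol_cst.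
move=> c; have [cK|cK] := ltnP c ka.
  under eq_fun do rewrite rcoord_column//.
  by apply: pol_gen; exists (l * ka + c)%N.
rewrite (_ : (fun _ => _) = fun=> 0); first exact: pol_cst.
by apply/funext => t; rewrite /rcoord nth_default// size_to_reals.
Qed.

Local Notation qs := (qsum block_tau block_gam).
Local Notation qp := (qprod block_tau block_gam block_nu).

Let take_rconsl (v : seq R) x j : (j <= size v)%N -> take j (rcons v x) = take j v.
Proof. by move=> jv; rewrite -cats1 takel_cat. Qed.

Let qsum_flat v : qs (rev v) =
  1 + \sum_(j < size v) (block_tau j * v`_j + block_gam j (rev (take j v))) ^+ 2.
Proof.
elim/last_ind: v => [|v x IH]; first by rewrite big_ord0 addr0.
rewrite rev_rcons /= IH size_rcons big_ord_recr /= addrA.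
rewrite nth_rcons ltnn eqxx take_rconsl// take_size size_rev; congr (1 + _ + _).
apply: eq_bigr => j _; rewrite nth_rcons ltn_ord take_rconsl//; exact: ltnW.
Qed.

Let qprod_flat v : qp (rev v) =
  \prod_(j < size v) cpow (qs (rev (take j.+1 v))) (- block_nu j).
Proof.
elim/last_ind: v => [|v x IH]; first by rewrite big_ord0.
transitivity (qp (rev v) * cpow (qs (rev (rcons v x))) (- block_nu (size (rev v)))).
  by rewrite rev_rcons.
rewrite IH size_rcons big_ord_recr [RHS]/= size_rev.
rewrite -[X in take X (rcons v x)](size_rcons v x) take_size; congr (_ * _).
by apply: eq_bigr => j _; rewrite take_rconsl.
Qed.

Lemma qsum_block v k : size v = (k * ka)%N -> qs (rev v) =
  1 + \sum_(i < k) nsq (ofR K (tau i) * column K v i +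
                         \sum_(l < i) T i l * column K v l).
Proof.
move=> vs; rewrite qsum_flat vs (big_blocks _ k ka (fun j =>
  (block_tau j * v`_j + block_gam j (rev (take j v))) ^+ 2)).
congr (1 + _); apply: eq_bigr => i _; apply: eq_bigr => c _.
have [id im] := blockE i (ltn_ord c); rewrite /block_tau /block_gam id im revK.
rewrite rcoordD rcoordZ rcoord_column//; congr ((_ + rcoord c _) ^+ 2).
apply: eq_bigr => l _; congr (_ * _); apply: rcoord_ext => d dK.
rewrite !rcoord_column// nth_take//.
apply: (@leq_trans (l.+1 * ka)); first by rewrite mulSnr ltn_add2l.
by rewrite (@leq_trans (i * ka)) ?leq_mul2r ?ltn_ord ?orbT ?leq_addr.
Qed.

Let prod_nu (F : nat -> R[i] -> R[i]) i : (forall j, F j 0 = 1) ->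
  \prod_(c < ka) F (i * ka + c)%N (block_nu (i * ka + c)) =
  F (i * ka + ka.-1)%N (lam i.+1).
Proof.
move=> F0; have kl : (ka.-1 < ka)%N by rewrite prednK.
rewrite (bigD1 (Ordinal kl))//= big1 ?mulr1 => [|c ck].
  by have [id im] := blockE i kl; rewrite /block_nu id im eqxx.
have [id im] := blockE i (ltn_ord c); rewrite /block_nu im ifF//.
by apply/negbTE; move: ck; rewrite -val_eqE.
Qed.

Lemma qprod_block v k : size v = (k * ka)%N -> qp (rev v) =
  \prod_(i < k) cpow (qs (rev (take (i.+1 * ka) v))) (- lam i.+1).
Proof.
move=> vs; rewrite qprod_flat vs (big_blocks _ k ka (fun j =>
  cpow (qs (rev (take j.+1 v))) (- block_nu j))).
apply: eq_bigr => i _.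
rewrite (prod_nu (F := fun j z => cpow (qs (rev (take j.+1 v))) (- z))).
  by rewrite -addnS prednK// -mulSnr.
by move=> j; rewrite oppr0 cpow0.
Qed.

Let sum_nu k : \sum_(j < k * ka) block_nu j = \sum_(i < k) lam i.+1.
Proof.
rewrite (big_blocks _ k ka block_nu); apply: eq_bigr => i _.
have kl : (ka.-1 < ka)%N by rewrite prednK.
rewrite (bigD1 (Ordinal kl))//= big1 ?addr0 => [|c ck].
  by have [id im] := blockE i kl; rewrite /block_nu id im eqxx.
have [id im] := blockE i (ltn_ord c); rewrite /block_nu im ifF//.
by apply/negbTE; move: ck; rewrite -val_eqE.
Qed.

Let sum_nu_part i c : (c < ka)%N ->
  \sum_(j < i * ka + c) block_nu j = \sum_(i < i) lam i.+1.
Proof.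
move=> cK; rewrite -(big_mkord xpredT block_nu).
rewrite (@big_cat_nat _ _ _ (i * ka)) ?leq_addr//= big_mkord sum_nu.
rewrite [X in _ + X]big_nat_cond [X in _ + X]big1 ?addr0// => j /andP[/andP[j1 j2] _].
have jE : j = (i * ka + (j - i * ka))%N by rewrite subnKC.
have jc : (j - i * ka < c)%N by rewrite ltn_subLR.
have [id im] := blockE i (ltn_trans jc cK); rewrite /block_nu jE im ifF//.
by apply/negbTE; rewrite neq_ltn (leq_trans jc)// -ltnS prednK.
Qed.

Lemma qexp_block N i c : (i < N)%N -> (c < ka)%N ->
  qexp block_nu (N * ka) 0 (i * ka + c) =
  \sum_(i.+1 <= q < N.+1) lam q - (((N - i) * ka - c.+1)%:R / 2)%:C.
Proof.
move=> iN cK; have jN : (i * ka + c <= N * ka)%N.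
  apply: ltnW; apply: (@leq_trans (i.+1 * ka)); first by rewrite mulSnr ltn_add2l.
  by rewrite leq_mul2r iN orbT.
rewrite /qexp addr0; congr (_ - (_ %:R / 2)%:C).
  apply: (@addrI _ (\sum_(j < i * ka + c) block_nu j)).
  rewrite -[X in X + _](big_mkord xpredT block_nu) -(@big_cat_nat _ _ _ (i * ka + c))//=.
  rewrite (big_mkord xpredT block_nu) sum_nu sum_nu_part// big_add1 /=.
  rewrite -[X in X + _](big_mkord xpredT (fun i => lam i.+1)).
  by rewrite -(@big_cat_nat _ _ _ i)//= ?(ltnW iN)// big_mkord.
by rewrite subnS subnDA -mulnBl.
Qed.

End Blocks.

Section GammaProducts.
Variable R : realType.

Lemma prod_ratio (F : fieldType) (f : nat -> F) k : (forall c, f c != 0) ->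
  \prod_(c < k) (f c / f c.+1) = f 0%N / f k.
Proof.
move=> f0; elim: k => [|k IH]; first by rewrite big_ord0 mulfV.
by rewrite big_ord_recr /= IH mulrA mulfVK.
Qed.

Lemma natr_half_complex (k : nat) : (k%:R / 2 : R)%:C = k%:R / 2 :> R[i].
Proof. by rewrite rmorphM/= fmorphV !rmorph_nat. Qed.

(** The exponents of the consecutive coordinates of one entry differ by 1/2, and the
    denominator of each factor is the numerator of the next one. *)
Lemma prod_beta (L : R[i]) (a k : nat) : (k <= a)%N -> a%:R / 2 < complex.Re L ->
  \prod_(c < k) beta (L - ((a - c.+1)%:R / 2)%:C) =
  (Num.sqrt pi)%:C ^+ k *
  (Gamma (L - (a%:R / 2)%:C) / Gamma (L - ((a - k)%:R / 2)%:C)).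
Proof.
move=> ka aL; pose f c := Gamma (L - ((a - c)%:R / 2)%:C).
have f0 c : f c != 0.
  apply: Gamma_neq0; rewrite Re_addc Re_oppc /= subr_gt0 (le_lt_trans _ aL)//.
  by rewrite ler_wpM2r ?invr_ge0// ler_nat leq_subr.
rewrite -[Gamma (L - ((a - k)%:R / 2)%:C)]/(f k).
have -> : Gamma (L - (a%:R / 2)%:C) = f 0%N by rewrite /f subn0.
rewrite -(prod_ratio k f0) -[k in _ ^+ k]card_ord -prodr_const.
rewrite -big_split/=; apply: eq_bigr => c _; rewrite /beta mulrA; congr (_ * Gamma _ / _).
have ca : (c < a)%N by exact: leq_trans (ltn_ord c) ka.
have -> : ((a - c)%:R / 2 : R)%:C = ((a - c.+1)%:R / 2)%:C + 2^-1%:C.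
  rewrite subnS -[(a - c)%N in LHS]prednK ?subn_gt0// -natr1.
  by rewrite -rmorphD/=; congr (_%:C); field.
by ring.
Qed.

End GammaProducts.

(** * Integration along the fibres *)
Lemma eq_measure_cintegral d (T : measurableType d) (R : realType)
    (m m' : {measure set T -> \bar R}) (f : T -> R[i]) :
  (forall A, measurable A -> m A = m' A) -> cintegrable m' setT f ->
  cintegrable m setT f /\ cintegral m setT f = cintegral m' setT f.
Proof.
move=> mm' [i1 i2].
have key (g : T -> \bar R) : m'.-integrable setT g -> m.-integrable setT g.
  move=> /integrableP[mg gi]; apply/integrableP; split => //.
  by rewrite (eq_measure_integral m')// => A mA _; exact: mm'.
split; first by split; exact: key.
rewrite /cintegral /Rintegral.
by congr (fine _ +i* fine _); apply: eq_measure_integral => A mA _; exact: mm'.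
Qed.

Lemma prod_drop_last (R : realType) (F : nat -> R[i]) N : (0 < N)%N -> F N = 1 ->
  \prod_(1 <= p < N) F p = \prod_(i < N) F i.+1.
Proof.
case: N => // N _ FN; rewrite big_add1 big_mkord.
by rewrite big_ord_recr/= FN mulr1.
Qed.

Section Fibre.
Variables (R : realType) (K : division_algebra) (N : nat) (lam : nat -> R[i]).
Local Notation unitri := (unitri R K).
Local Notation M := (N * kappa K)%N.
Local Notation Lam p := (\sum_(p <= q < N.+1) lam q).

Definition density (Z : unitri N.+1) : R[i] :=
  \prod_(1 <= p < N.+1) cpow (s_ Z p N.+1) (- lam p).
Definition base_density (Z : unitri N) : R[i] :=
  \prod_(1 <= p < N) cpow (s_ Z p N) (- lam p).
Definition fibre_mass : R[i] :=
  (pi `^ ((N * kappa K)%:R / 2))%:C *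
  \prod_(1 <= p < N.+1)
    (Gamma (Lam p - ((N.+1 - p) * kappa K)%:R / 2) /
     Gamma (Lam p - ((N.+1 - p).-1 * kappa K)%:R / 2)).
Definition fibre_total_mass : R :=
  \prod_(j < M) betar (complex.Re (qexp (block_nu K lam) M 0 j)).

Hypothesis N0 : (0 < N)%N.
Hypothesis conv : forall p, (1 <= p <= N)%N ->
  ((N.+1 - p) * kappa K)%:R / 2 < complex.Re (Lam p).

Let ka0 : (0 < kappa K)%N. Proof. exact: kappa_gt0. Qed.

Let convi i : (i < N)%N -> ((N - i) * kappa K)%:R / 2 < complex.Re (Lam i.+1).
Proof. by move=> iN; have := conv (p := i.+1); rewrite subSS; apply. Qed.

(* Within an entry the first coordinate has the smallest exponent, for which the
   bound is the hypothesis. *)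
Let exponents j : (j < M)%N -> 2^-1 < complex.Re (qexp (block_nu K lam) M 0 j).
Proof.
move=> jM; have iN : (j %/ kappa K < N)%N by rewrite ltn_divLR.
have cK : (j %% kappa K < kappa K)%N by rewrite ltn_mod.
rewrite (divn_eq j (kappa K)) qexp_block// Re_addc Re_oppc /=.
set i := (j %/ kappa K)%N in iN *; set c := (j %% kappa K)%N in cK *.
rewrite ltrBrDr (le_lt_trans _ (convi iN))//.
have aK : (c.+1 <= (N - i) * kappa K)%N.
  by rewrite (leq_trans cK)// leq_pmull// subn_gt0.
rewrite natrB// -[leLHS]/(2^-1 + _ / 2) mulrBl addrCA gerDl.
by rewrite -[X in X - _]mul1r -mulrBl pmulr_lle0 ?invr_gt0// subr_le0 ler1n.
Qed.

Lemma fibre_total_mass_ge0 : 0 <= fibre_total_mass.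
Proof.
by apply: prodr_ge0 => j _; apply: betar_ge0; exact: exponents (ltn_ord j).
Qed.

(* The product of the scale factors over all coordinates is (prod tau)^-kappa = 1,
   so that the result depends on the base point only through its density. *)
Let constant (tau : nat -> R) : (forall k, 0 < tau k) -> \prod_(k < N) tau k = 1 ->
  \prod_(j < M) ((block_tau K tau j)^-1%:C * beta (qexp (block_nu K lam) M 0 j)) =
  fibre_mass /\
  \prod_(j < M) ((block_tau K tau j)^-1 *
     betar (complex.Re (qexp (block_nu K lam) M 0 j))) = fibre_total_mass.
Proof.
move=> tau0 tau1; have tauV : \prod_(j < M) (block_tau K tau j)^-1 = 1.
  rewrite (big_blocks _ N (kappa K) (fun j => (block_tau K tau j)^-1)).
  rewrite (eq_bigr (fun k : 'I_N => (tau k)^-1 ^+ kappa K)) => [|k _].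
    by rewrite prodrXl prodfV tau1 invr1 expr1n.
  rewrite (eq_bigr (fun=> (tau k)^-1)) => [|c _]; first by rewrite prodr_const card_ord.
  by rewrite /block_tau divnMDl// divn_small// addn0.
split; last by rewrite big_split/= tauV mul1r.
rewrite big_split/= -(rmorph_prod (real_complex R)) tauV mul1r.
rewrite (big_blocks _ N (kappa K) (fun j => beta (qexp (block_nu K lam) M 0 j))).
rewrite /fibre_mass big_add1 big_mkord.
have -> : (pi `^ ((N * kappa K)%:R / 2) : R) = Num.sqrt pi ^+ (N * kappa K).
  rewrite mulrC powRrM powR12_sqrt ?pi_ge0// powR_mulrn ?sqrtr_ge0//.
rewrite [X in _ ^+ X]mulnC exprM rmorphXn/= -[N in _ ^+ N]card_ord -prodr_const -big_split/=.
apply: eq_bigr => i _.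
rewrite (eq_bigr (fun c : 'I_(kappa K) =>
    beta (Lam i.+1 - (((N - i) * kappa K - c.+1)%:R / 2)%:C))) => [|c _]; last first.
  by rewrite /= qexp_block.
rewrite prod_beta; [|by rewrite leq_pmull// subn_gt0|exact: convi].
rewrite rmorphXn/= subSS -!natr_half_complex.
by have -> : ((N - i).-1 * kappa K = (N - i) * kappa K - kappa K)%N
  by rewrite -subn1 mulnBl mul1n.
Qed.

(** By [corner_gram] each corner determinant is the one of the base times a partial
    sum of squares of affine functions in the column, so [qprod_integral]
    applies after the base density has been factored out. *)
Lemma fibre_integral (Z' : unitri N) :
  [/\ cintegrable (lebesgue_tuple R M) setT (fun u => density (join_column (Z', u))),
   cintegral (lebesgue_tuple R M) setT (fun u => density (join_column (Z', u))) =
   fibre_mass * base_density Z' &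
   (\int[lebesgue_tuple R M]_u (Normc.normc (density (join_column (Z', u))))%:E =
   (fibre_total_mass * Normc.normc (base_density Z'))%:E)%E].
Proof.
have [T [tau [tau0 tau1 sZ' sZ]]] := corner_gram Z'.
have btau0 j : 0 < block_tau K tau j by exact: tau0.
have [i e n] := qprod_integral btau0 (measurable_block_gam T) exponents.
have [c1 c2] := constant tau0 tau1; rewrite {}c1 in e; rewrite {}c2 in n.
have E (u : M.-tuple R) : density (join_column (Z', u)) =
    base_density Z' * qprod (block_tau K tau) (block_gam T) (block_nu K lam) u.
  have us : size (rev u) = (N * kappa K)%N by rewrite size_rev size_tuple.
  rewrite -[X in qprod _ _ _ X]revK (qprod_block T tau lam us) /density big_add1 big_mkord.
  have -> : base_density Z' = \prod_(i < N) cpow (s_ Z' i.+1 N) (- lam i.+1).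
    rewrite /base_density (prod_drop_last (F := fun p => cpow (s_ Z' p N) (- lam p)))//.
    by rewrite s_NN cpow1.
  rewrite -big_split/=; apply: eq_bigr => k _.
  have ts : size (take (k.+1 * kappa K) (rev u)) = (k.+1 * kappa K)%N.
    by rewrite size_takel// us leq_mul2r ltn_ord orbT.
  have colE l : (l < k.+1)%N -> entry (join_column (Z', u)) l N =
      column K (take (k.+1 * kappa K) (rev u)) l.
    move=> lk; rewrite entry_join_column_new; last exact: leq_trans lk (ltn_ord k).
    apply: rcoord_ext => c cK; rewrite !rcoord_column// nth_take//.
    apply: (@leq_trans (l.+1 * kappa K)); first by rewrite mulSnr ltn_add2l.
    by rewrite leq_mul2r lk orbT.
  have sE : s_ (join_column (Z', u)) k.+1 N.+1 = s_ Z' k.+1 N *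
      qsum (block_tau K tau) (block_gam T) (rev (take (k.+1 * kappa K) (rev u))).
    rewrite (sZ _ (forget_join_column (Z', u)) _ (ltn_ord k)) (sZ' _ (ltn_ord k)).
    rewrite (qsum_block T tau ts); congr (_ * (1 + _)).
    apply: eq_bigr => l _; rewrite colE//; congr (nsq (_ + _)).
    by apply: eq_bigr => l' _; rewrite colE// (ltn_trans (ltn_ord l')).
  have s0 : 0 < s_ Z' k.+1 N by rewrite (lt_le_trans ltr01)// s_ge1.
  by rewrite sE (cpowM _ s0 (qsum_gt0 _ _ _)).
have Ef : (fun u => density (join_column (Z', u))) = fun u : M.-tuple R =>
    base_density Z' * qprod (block_tau K tau) (block_gam T) (block_nu K lam) u.
  by apply/funext => u; exact: E.
rewrite Ef; split; first exact: cintegrableZl.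
  by rewrite cintegralZl// e mulrC.
rewrite mulrC EFinM -n -ge0_integralZl//.
- by apply: eq_integral => u _; rewrite E Normc.normcM EFinM.
- have mq := cmeasurable_qprod (block_tau K tau) (block_nu K lam)
    (measurable_block_gam T) M.
  by apply/measurable_EFinP; exact: (measurable_normc mq).
- by move=> u _; rewrite lee_fin normc_ge0.
- by rewrite lee_fin normc_ge0.
Qed.

End Fibre.

(** * The pushforward *)
Section Base.
Variables (R : realType) (K : division_algebra).
Local Notation unitri := (unitri R K).

Lemma measurable_s n p q : measurable_fun setT (fun Z : unitri n => s_ Z p q).
Proof.
have mX (g : unitri n -> R) : coordinates g -> measurable_fun setT g.
  by move=> [k [m [c ->]]]; exact: measurable_rcoord_entry.
have [/(pol_measurable mX)//|[P /(pol_measurable mX) mP sP]] := s_pol R K n p q.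
by under eq_fun do rewrite sP; exact: (measurableT_comp (measurable_powR _) mP).
Qed.

Lemma cmeasurable_density N (lam : nat -> R[i]) : cmeasurable (@density R K N lam).
Proof.
by apply: cmeasurable_prod => p _; apply: cmeasurable_cpow; exact: measurable_s.
Qed.

Lemma cmeasurable_base_density N (lam : nat -> R[i]) :
  cmeasurable (@base_density R K N lam).
Proof.
by apply: cmeasurable_prod => p _; apply: cmeasurable_cpow; exact: measurable_s.
Qed.

Lemma measurable_forget N : measurable_fun setT (@forget R K N.+1).
Proof.
apply: measurable_unitri => k m c.
have outside : ~~ ((k < N) && (m < N))%N ->
    measurable_fun setT (fun Z : unitri N.+1 => rcoord c (entry (forget Z) k m)).
  move=> km; rewrite (_ : (fun _ => _) = fun=> 0); first exact: measurable_cst.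
  apply/funext => Z; rewrite /entry; case: insubP => [i kN _|_]; last exact: rcoord0.
  case: insubP => [j mN _|_]; last exact: rcoord0.
  by rewrite kN mN in km.
have [/andP[kN mN]|] := boolP ((k < N) && (m < N))%N; last exact: outside.
under eq_fun do rewrite entry_forget//.
exact: measurable_rcoord_entry.
Qed.

Lemma compact_cube N (A : set (unitri N)) : compact A ->
  exists L : nat, A `<=` @to_tuple R K N @^-1` box (cube L).
Proof.
move=> cA.
have B (l : 'I_(size (coords K N))) : exists M : R, forall Z, A Z -> `|tnth (to_tuple Z) l| <= M.
  pose f (Z : unitri N) : R := to_row Z 0 l.
  have cf : continuous f.
    move=> Z; apply: (@continuous_comp _ _ _ (@to_row R K N) (fun x : 'rV_ _ => x 0 l)).
      exact: (@initial_continuous _ _ (@to_row R K N)).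
    exact: coord_continuous.
  have /compact_bounded[M [_ MB]] : compact (f @` A).
    by apply: continuous_compact => //; exact: continuous_subspaceT.
  exists (M + 1) => Z AZ; have := MB (M + 1); rewrite ltrDl ltr01 => /(_ isT).
  by move=> /(_ (f Z)); rewrite /f mxE; apply; exists Z => //; rewrite /f mxE.
have [M MB] := fin_all_exists B.
exists (Num.truncn (\sum_l `|M l|)).+1 => Z AZ l; rewrite /cube /= in_itv/= -ler_norml.
apply: (le_trans (MB l Z AZ)); apply: (le_trans (ler_norm _)).
rewrite (le_trans _ (ltW (truncnS_gt _)))// (bigD1 l)//= lerDl.
by apply: sumr_ge0 => i _; exact: normr_ge0.
Qed.

Lemma cube_entry N L (Z : unitri N) : (to_tuple Z) \in box (@cube R L) ->
  forall k m c, `|rcoord c (entry Z k m)| <= L%:R + 1.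
Proof.
rewrite inE => ZL k m c; have L0 : 0 <= L%:R :> R by [].
have small (x : R) : `|x| <= 1 -> `|x| <= L%:R + 1 by move=> /le_trans; apply; rewrite lerDr.
have [cK|cK] := ltnP c (kappa K); last first.
  by apply: small; rewrite /rcoord nth_default ?size_to_reals// normr0.
have [mN|mN] := ltnP m N; last first.
  apply: small; rewrite /entry; case: insubP => [i _ _|_]; last by rewrite rcoord0 normr0.
  by rewrite insubN ?rcoord0 ?normr0// -leqNgt.
have [km|mk|km] := ltngtP k m.
- have kN := ltn_trans km mN.
  pose x : 'I_N * 'I_N * 'I_(kappa K) := (Ordinal kN, Ordinal mN, Ordinal cK).
  have xc : x \in coords K N by rewrite mem_coords.
  move: (xc); rewrite -index_mem => xs.
  have := ZL (Ordinal xs); rewrite tnth_map (tnth_nth x) /= nth_index// coordE.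
  by rewrite /cube /= in_itv/= -ler_norml => /le_trans; apply; rewrite lerDl.
- by apply: small; rewrite entry_lower// rcoord0 normr0.
- apply: small; rewrite km entry_diag// -(ofR1 R K) -[ofR K 1]mulr1 rcoordZ mul1r.
  rewrite /rcoord; case: (K) c cK => -[|[|[|[|c]]]]//= _; rewrite ?normr1 ?normr0//.
Qed.

Lemma dZ_cube_fin N L :
  (dZ R K N (@to_tuple R K N @^-1` box (@cube R L)) < +oo)%E.
Proof.
rewrite /dZ /= /pushforward -comp_preimage.
rewrite (_ : _ \o _ = id); last by apply/funext => t /=; exact: of_tupleK.
by rewrite preimage_id lebesgue_cube_fin.
Qed.

(** The base density is bounded on cubes, because its factors are powers of numbers
    between 1 and a constant; so a bounded function with compact support is
    integrable against it. *)
Lemma base_integrable N (lam : nat -> R[i]) (Psi : unitri N -> R[i]) :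
  cmeasurable Psi -> cbounded Psi -> compactly_supported Psi ->
  cintegrable (dZ R K N) setT (fun Z => Psi Z * base_density lam Z).
Proof.
move=> mPsi [M PsiM] [A cA PsiA]; have [L AL] := compact_cube cA.
pose D := @to_tuple R K N @^-1` box (@cube R L).
have mD : measurable D.
  rewrite -[X in measurable X]setTI; apply: measurable_to_tuple => //.
  by apply: measurable_box => i; exact: measurable_cube.
have [C bC] : exists C, forall Z, D Z -> Normc.normc (@base_density R K N lam Z) <= C.
  have sC p : exists C, forall Z, D Z -> s_ Z p N <= C.
    by apply: (@s_bounded R K N p N D (L%:R + 1)) => Z DZ; apply: cube_entry; rewrite inE.
  have bp p : (p <= N)%N ->
      exists C, forall Z, D Z -> Normc.normc (cpow (s_ Z p N) (- lam p)) <= C.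
    move=> pN; have [C hC] := sC p; exists (C `^ `|complex.Re (lam p)|) => Z DZ.
    have s1 := s_ge1 Z pN; have s0 : 0 < s_ Z p N by exact: lt_le_trans ltr01 s1.
    rewrite normc_cpow// Re_oppc (@le_trans _ _ (s_ Z p N `^ `|complex.Re (lam p)|))//.
      by rewrite ler_powR// -normrN ler_norm.
    apply: ge0_ler_powR; rewrite ?nnegrE ?normr_ge0//; first exact: ltW s0.
      exact: le_trans (ltW s0) (hC Z DZ).
    exact: hC.
  have : forall s : seq nat, exists C, forall Z, D Z -> Normc.normc
      (\prod_(p <- s | (1 <= p < N)%N && true) cpow (s_ Z p N) (- lam p)) <= C.
    elim=> [|p s [C hC]].
      by exists 1 => Z _; rewrite big_nil Normc.normc1.
    case E : ((1 <= p < N)%N && true); last first.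
      by exists C => Z DZ; rewrite big_cons E; exact: hC.
    have pN : (p <= N)%N by move: E => /andP[/andP[_ /ltnW]].
    have [C' hC'] := bp p pN; exists (C' * C) => Z DZ; rewrite big_cons E.
    by rewrite Normc.normcM ler_pM ?normc_ge0 ?hC ?hC'.
  move=> /(_ (index_iota 1 N))[C hC]; exists C => Z DZ.
  by rewrite /base_density big_nat_cond; exact: hC.
refine (@cintegrable_le _ _ _ (dZ R K N) _ (fun Z => (M * C) * \1_D Z) _ _ _).
- by apply: cmeasurableM => //; exact: cmeasurable_base_density.
- move=> Z; rewrite Normc.normcM indicE; case: (boolP (Z \in D)) => ZD.
    rewrite mulr1 ler_pM ?normc_ge0//; apply: bC; exact: set_mem.
  rewrite PsiA ?Normc.normc0 ?mul0r ?mulr0// => AZ.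
  by move/negP: ZD; apply; rewrite inE; exact: AL.
- rewrite (_ : EFin \o _ = fun Z => ((M * C)%:E * (\1_D Z)%:E)%E).
    apply: integrableZl => //; apply/integrableP; split; first exact/measurable_EFinP.
    under eq_integral do rewrite /= ger0_norm//.
    by rewrite integral_indic// setIT; exact: dZ_cube_fin.
  by apply/funext => Z; rewrite /= EFinM.
Qed.

End Base.

Theorem theorem1p2 (R : realType) (K : division_algebra) (n : nat)
    (lam : nat -> R[i]) :
  (2 <= n)%N ->
  (forall p : nat, (1 <= p <= n.-1)%N ->
    ((n - p) * kappa K)%:R / 2 < complex.Re (\sum_(p <= q < n) lam q)) ->
  is_pushforward
    (fun Z : unitri R K n => \prod_(1 <= p < n) cpow (s_ Z p n) (- lam p))
    (fun Z : unitri R K n.-1 =>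
       (pi `^ ((n.-1 * kappa K)%:R / 2))%:C *
       \prod_(1 <= p < n)
         (Gamma ((\sum_(p <= q < n) lam q) - ((n - p) * kappa K)%:R / 2) /
          Gamma ((\sum_(p <= q < n) lam q) - ((n - p).-1 * kappa K)%:R / 2)) *
       \prod_(1 <= p < n.-1) cpow (s_ Z p n.-1) (- lam p)).
Proof.
case: n => // N; rewrite ltnS => N0 conv Psi mPsi bPsi cPsi.
pose C := @fibre_mass R K N lam.
have -> : (fun Z : unitri R K N.+1.-1 => Psi Z *
    ((pi `^ ((N.+1.-1 * kappa K)%:R / 2))%:C *
       \prod_(1 <= p < N.+1)
         (Gamma ((\sum_(p <= q < N.+1) lam q) - ((N.+1 - p) * kappa K)%:R / 2) /
          Gamma ((\sum_(p <= q < N.+1) lam q) - ((N.+1 - p).-1 * kappa K)%:R / 2)) *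
       \prod_(1 <= p < N.+1.-1) cpow (s_ Z p N.+1.-1) (- lam p))) =
   (fun Z : unitri R K N => C * (Psi Z * base_density lam Z)).
  by apply/funext => Z; rewrite mulrCA.
have -> : (fun Z : unitri R K N.+1 => Psi (forget Z) *
    \prod_(1 <= p < N.+1) cpow (s_ Z p N.+1) (- lam p)) =
  (fun Z => Psi (forget Z) * density lam Z) by [].
have iB := base_integrable lam mPsi bPsi cPsi.
pose m1 := base_measure R K N; pose m2 := fibre_measure R K N.
pose f (Z : unitri R K N.+1) := Psi (forget Z) * density lam Z.
pose g (p : unitri R K N * (N * kappa K).-tuple R) :=
  Psi p.1 * density lam (join_column p).
have gE p : f (join_column p) = g p by rewrite /f forget_join_column.
have mg : cmeasurable g.
  apply: cmeasurableM; first exact: (cmeasurable_comp measurable_fst mPsi).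
  have mdj := cmeasurable_comp (@measurable_join_column R K N) (@cmeasurable_density R K N lam).
  exact mdj.
have fib Z := fibre_integral N0 conv Z.
have mass0 := fibre_total_mass_ge0 conv.
have ig : cintegrable (m1 \x m2)%E setT g.
  apply: cintegrable_prod => //.
  have E Z : (\int[m2]_u (Normc.normc (g (Z, u)))%:E =
      (@fibre_total_mass R K N lam)%:E *
      (Normc.normc (Psi Z * base_density lam Z))%:E)%E.
    have [/cintegrable_normc/measurable_int md _ nd] := fib Z.
    under eq_integral do rewrite /g /= Normc.normcM EFinM.
    rewrite ge0_integralZl//; last 2 first.
    - by move=> u _; rewrite lee_fin normc_ge0.
    - by rewrite lee_fin normc_ge0.
    by rewrite [X in (_ * X)%E]nd -!EFinM Normc.normcM mulrCA.
  rewrite (eq_integral (fun Z => (@fibre_total_mass R K N lam)%:E *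
      (Normc.normc (Psi Z * base_density lam Z))%:E)%E) => [|Z _]; last exact: E.
  have /integrableP[mB] := cintegrable_normc iB.
  under eq_integral do rewrite /= ger0_norm ?normc_ge0//.
  move=> finB; rewrite ge0_integralZl//.
  - by rewrite lte_mul_pinfty// lee_fin.
  - by move=> Z _; rewrite lee_fin normc_ge0.
have mf : cmeasurable f.
  apply: cmeasurableM; last exact: cmeasurable_density.
  exact: (cmeasurable_comp (@measurable_forget R K N) mPsi).
have fg : f \o @join_column R K N = g by apply/funext => p; exact: gE.
have := cintegral_pushforward (m := (m1 \x m2)%E) (@measurable_join_column R K N) mf.
rewrite fg => /(_ ig)[pushi pushe].
have [fi fe] := eq_measure_cintegral (@dZ_join_column R K N) pushi.
split => //; first exact: cintegrableZl.
have sections Z : cintegrable m2 setT (fun u => g (Z, u)).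
  by have [i _ _] := fib Z; exact (cintegrableZl (Psi Z) i).
refine (etrans fe (etrans pushe (etrans (cfubini1 ig sections) _))).
apply: eq_cintegral => Z; have [i e _] := fib Z.
by rewrite /g /= cintegralZl// [X in _ * X]e mulrCA.
Qed.
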